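(* Let $\beta_0\in(0,1)$ and let $\xi^0\in G$ be a point such that $\det \mathcal{K}(\xi^0)\neq 0$ and $|\mathrm{Re}\,\lambda_l(\xi^0)|\neq|\mathrm{Im}\,\lambda_l(\xi^0)|$ for $l=1,\dots,m$. Then there exists a number $T_1=T_1(\xi^0,\beta_0)>1$ such that for every $t_0>T_1$ the following holds. Let $\mathbf{d}=\langle d_1,\dots,d_m\rangle$ be given numbers such that the components $b_1,\dots,b_m$ of the vector $\mathcal{K}^{-1}(\xi^0)\,\mathbf{d}$ satisfy $$b_l\in R_{RL,l}=\{t_0^{\beta-1}E_{\beta,\beta}(\lambda_l(\xi^0)t_0^{\beta}) : \beta\in[\beta_0,1)\},\qquad l=1,\dots,m.$$ Then for each $l=1,\dots,m$ there exists a unique number $\beta_l^\ast\in[\beta_0,1]$ such that the Fourier transform of the solution $U=\langle u_1,\dots,u_m\rangle$ of the second forward problem with vector-order $\mathcal{B}=\langle\beta_1^\ast,\dots,\beta_m^\ast\rangle$ satisfies $$\hat u_j(t_0,\xi^0)=d_j,\qquad j=1,\dots,m$$ (that is, there is exactly one vector $\langle\beta_1^\ast,\dots,\beta_m^\ast\rangle\in[\beta_0,1]^m$ for which these $m$ equalities hold).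
   Context: Spaces and operators. Let $G\subseteq\mathbb{R}^n$ be open and $p\ge1$. $\mathbf{\Psi}_{G,p}(\mathbb{R}^n)$ is the space of functions $\psi\in L_p(\mathbb{R}^n)$ whose Fourier transform $\hat\psi(\xi)=\int_{\mathbb{R}^n}\psi(x)e^{-ix\xi}\,dx$ has compact support in $G$. For a function $A(\xi)$ continuous on $G$ (possibly with arbitrary singularities on the boundary of or outside $G$), the pseudo-differential operator $A(D)$ is $A(D)\varphi(x)=\frac{1}{(2\pi)^n}\int_G A(\xi)\hat\varphi(\xi)e^{ix\xi}\,d\xi$ for $\varphi\in\mathbf{\Psi}_{G,p}(\mathbb{R}^n)$. Matrix symbol (standing assumptions). $\mathcal{A}(\xi)=(A_{j,k}(\xi))_{j,k=1}^m$ is a matrix-symbol defined and continuous on $G$, $\mathbb{A}(D)=(A_{j,k}(D))_{j,k=1}^m$. It is symmetric, $A_{k,j}(\xi)=A_{j,k}(\xi)$, and diagonalizable: there is an invertible $m\times m$ matrix function $M(\xi)$ with $\mathcal{A}(\xi)=M^{-1}(\xi)\Lambda(\xi)M(\xi)$, $\xi\in G$, where $\Lambda(\xi)=\mathrm{diag}(\lambda_1(\xi),\dots,\lambda_m(\xi))$. It is assumed that $|\arg\lambda_j(\xi)|>\frac{\pi}{2}$ for all $\xi\in G$, $j=1,\dots,m$ (principal argument; so $\mathrm{Re}\,\lambda_j(\xi)<0$). Let $\mu_{j,k}(\xi)$ denote the entries of $M^{-1}(\xi)$ and $\nu_{j,k}(\xi)$ the entries of $M(\xi)$. Riemann-Liouville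 derivative. For $0<\beta<1$, $D_+^\beta f(t)=\frac{1}{\Gamma(1-\beta)}\frac{d}{dt}\int_0^t\frac{f(\tau)\,d\tau}{(t-\tau)^{\beta}}$, and $D_+^1=\frac{d}{dt}$. For $\mathcal{B}=\langle\beta_1,\dots,\beta_m\rangle$, $D_+^{\mathcal{B}}U=\langle D_+^{\beta_1}u_1,\dots,D_+^{\beta_m}u_m\rangle$ and $J^{1-\mathcal{B}}U=\langle J^{1-\beta_1}u_1,\dots,J^{1-\beta_m}u_m\rangle$, where $J^{\alpha}f(t)=\frac{1}{\Gamma(\alpha)}\int_0^t(t-\tau)^{\alpha-1}f(\tau)\,d\tau$ for $\alpha>0$ and $J^0$ is the identity; $J^{1-\mathcal{B}}U(0,x)$ is its value at $t=0$ (limit $t\to0^+$). Second forward problem. For $0<\beta_j\le1$ and $\Phi=\langle\varphi_1,\dots,\varphi_m\rangle$ with $\varphi_j\in\mathbf{\Psi}_{G,p}(\mathbb{R}^n)$, the second forward problem is $$D_+^{\mathcal{B}}U(t,x)=\mathbb{A}(D)U(t,x),\ t>0,\ x\in\mathbb{R}^n;\qquad J^{1-\mathcal{B}}U(0,x)=\Phi(x),\ x\in\mathbb{R}^n.$$ Its solution is $u_j(t,x)=\frac{1}{(2\pi)^n}\int_{\mathbb{R}^n}\sum_{l=1}^m t^{\beta_l-1}E_{\beta_l,\beta_l}(\lambda_l(\xi)t^{\beta_l})K_{j,l}(\xi,\widehat\Phi(\xi))e^{ix\xi}\,d\xi$, with Fourier transform in $x$ $$\hat u_j(t,\xi)=\sum_{l=1}^m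 t^{\beta_l-1}E_{\beta_l,\beta_l}(\lambda_l(\xi)t^{\beta_l})K_{j,l}(\xi,\widehat\Phi(\xi)),\qquad j=1,\dots,m,$$ regarded as defined at each point $\xi$, where $K_{j,l}(\xi,\widehat\Phi(\xi))=\mu_{j,l}(\xi)\sum_{k=1}^m\nu_{l,k}(\xi)\hat\varphi_k(\xi)$, $\widehat\Phi=\langle\hat\varphi_1,\dots,\hat\varphi_m\rangle$, and $E_{\beta,\beta}(z)=\sum_{k\ge0}z^k/\Gamma(\beta k+\beta)$ is the two-parametric Mittag-Leffler function. Matrix $\mathcal{K}$. $\mathcal{K}(\xi^0)=\big(K_{j,l}(\xi^0,\widehat\Phi(\xi^0))\big)_{j,l=1}^m$. The numbers $d_j$, $b_l$ may be complex. *)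

(* Defs.v *)
From HB Require Import structures.
From mathcomp Require Import all_boot all_order all_algebra complex.
From mathcomp Require Import all_classical all_reals all_analysis.

Set Implicit Arguments.
Unset Strict Implicit.
Unset Printing Implicit Defensive.

Import Order.TTheory GRing.Theory Num.Theory.
Import numFieldNormedType.Exports.

Local Open Scope classical_set_scope.
Local Open Scope ring_scope.
Local Open Scope complex_scope.

(* A point of R^n is a row vector x : 'rV[R]_n (which carries the topology),
   but the product sigma-algebra of the library lives on n.-tuple R.  Lebesgue
   measure is therefore built on n.-tuple R, as an iterated product, and
   functions on 'rV[R]_n are integrated through rv_of_tuple. *)
Section LebesgueRn.
Variable R : realType.

Definition cons_pt n (y : n.-tuple (measurableTypeR R) * measurableTypeR R) :
  n.+1.-tuple (measurableTypeR R) := [tuple of y.2 :: y.1].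

Lemma measurable_cons_pt n : measurable_fun setT (@cons_pt n).
Proof. exact: measurable_cons. Qed.

Fixpoint lebesgue_tuple (n : nat) :
    {measure set (n.-tuple (measurableTypeR R)) -> \bar R} :=
  if n is k.+1 then
    measure_function_pushforward__canonical__measure_function_Measure
      (lebesgue_tuple k \x (@lebesgue_measure R))%E (measurable_cons_pt (n := k))
  else \d_[tuple].

Definition rv_of_tuple n (t : n.-tuple (measurableTypeR R)) : 'rV[R]_n :=
  \row_i tnth t i.

Definition cplx_measurable n (f : 'rV[R]_n -> R[i]) : Prop :=
  measurable_fun setT (fun t => complex.Re (f (rv_of_tuple t)) : measurableTypeR R) /\
  measurable_fun setT (fun t => complex.Im (f (rv_of_tuple t)) : measurableTypeR R).

Definition cplx_integrable n (f : 'rV[R]_n -> R[i]) : Prop :=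
  (lebesgue_tuple n).-integrable setT
    (fun t => (complex.Re (f (rv_of_tuple t)))%:E) /\
  (lebesgue_tuple n).-integrable setT
    (fun t => (complex.Im (f (rv_of_tuple t)))%:E).

Definition cplx_integral n (f : 'rV[R]_n -> R[i]) : R[i] :=
  Rintegral (lebesgue_tuple n) setT (fun t => complex.Re (f (rv_of_tuple t)))
  +i*
  Rintegral (lebesgue_tuple n) setT (fun t => complex.Im (f (rv_of_tuple t))).

Definition in_Lp n (p : R) (f : 'rV[R]_n -> R[i]) : Prop :=
  cplx_measurable f /\
  (Lnorm (lebesgue_tuple n) p%:E
     (fun t => (Normc.normc (f (rv_of_tuple t)))%:E) < +oo)%E.

End LebesgueRn.

Section Fourier.
Variables (R : realType) (n : nat).
Local Notation Rn := 'rV[R]_n.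

Definition dotp (x xi : Rn) : R := \sum_(i < n) x 0 i * xi 0 i.

Definition expi (a : R) : R[i] := cos a +i* sin a.

Definition fourier_integral (psi : Rn -> R[i]) (xi : Rn) : R[i] :=
  cplx_integral (fun x => psi x * expi (- dotp x xi)).

Definition iter_partial (s : seq 'I_n) (h : Rn -> R) : Rn -> R :=
  foldr (fun i (g : Rn -> R) => fun x => 'D_(delta_mx 0 i) g x) h s.

Definition schwartz (h : Rn -> R) : Prop :=
  forall s : seq 'I_n,
    (forall x : Rn, differentiable (iter_partial s h) x) /\
    forall k : nat, exists C : R,
      forall x : Rn, `|x| ^+ k * `|iter_partial s h x| <= C.

(* psih is a pointwise-defined Fourier transform of psi: it is the integral
   \int psi(x) e^{-i x xi} dx at every point when psi is integrable; an L_p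
   function with p > 1 need not be integrable, and then psih represents the
   Fourier transform of psi as a tempered distribution (real-valued test
   functions suffice by linearity).  For integrable psi the second clause is
   the multiplication formula, a consequence of the first. *)
Definition is_fourier (psi psih : Rn -> R[i]) : Prop :=
  (cplx_integrable psi -> forall xi, psih xi = fourier_integral psi xi) /\
  (forall h : Rn -> R, schwartz h ->
     cplx_integrable (fun xi => psih xi * (h xi)%:C) /\
     cplx_integral (fun xi => psih xi * (h xi)%:C) =
     cplx_integral (fun x => psi x * fourier_integral (fun xi => (h xi)%:C) x)).

Definition supp (g : Rn -> R[i]) : set Rn := closure [set xi | g xi != 0].

Definition in_Psi (G : set Rn) (p : R) (psi psih : Rn -> R[i]) : Prop :=
  [/\ in_Lp p psi, is_fourier psi psih, compact (supp psih)
    & supp psih `<=` G].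

End Fourier.

Section MittagLeffler.
Variable R : realType.

Definition Gamma (a : R) : R :=
  Rintegral (@lebesgue_measure R) `]0, +oo[ (fun x => x `^ (a - 1) * expR (- x)).

(* R[i]^o carries the topology of the modulus. *)
Definition mittag_leffler (a b : R) (z : R[i]) : R[i] :=
  limn (series (fun k : nat =>
    z ^+ k / (Gamma (a * k%:R + b))%:C : R[i]^o)).

(* Principal argument in ]-pi, pi]; the junk value at 0 is pi / 2, so that
   pi / 2 < `|carg z| excludes z = 0. *)
Definition carg (z : R[i]) : R :=
  let a := acos (complex.Re z / Normc.normc z) in if 0 <= complex.Im z then a else - a.

End MittagLeffler.

Section SecondForwardProblem.
Variables (R : realType) (n m : nat).
Local Notation Rn := 'rV[R]_n.

Record matrix_symbol (G : set Rn) (A M : Rn -> 'M[R[i]]_m)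
    (lam : Rn -> 'rV[R[i]]_m) : Prop := MatrixSymbol {
  symbol_continuous : forall j k : 'I_m,
    {within G, continuous (fun xi => A xi j k : R[i]^o)} ;
  symbol_symmetric : forall xi, G xi -> (A xi)^T = A xi ;
  symbol_unit : forall xi, G xi -> M xi \in unitmx ;
  symbol_diag : forall xi, G xi ->
    A xi = invmx (M xi) *m diag_mx (lam xi) *m M xi ;
  symbol_arg : forall xi (l : 'I_m), G xi -> pi / 2 < `|carg (lam xi 0 l)|
}.

Definition Kmatrix (M : Rn -> 'M[R[i]]_m) (Phih : 'I_m -> Rn -> R[i])
    (xi : Rn) : 'M[R[i]]_m :=
  \matrix_(j < m, l < m)
    (invmx (M xi) j l * \sum_(k < m) M xi l k * Phih k xi).

Definition RL_factor (lam : R[i]) (b t : R) : R[i] :=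
  (t `^ (b - 1))%:C * mittag_leffler b b (lam * (t `^ b)%:C).

(* The Fourier transform in x of the solution of the second forward problem
   with vector-order B, at the time t and the point xi.  It is a formula at
   each point: M and lam need not be continuous, so a value at xi could not be
   recovered from the solution in x. *)
Definition solution_fourier (M : Rn -> 'M[R[i]]_m) (lam : Rn -> 'rV[R[i]]_m)
    (Phih : 'I_m -> Rn -> R[i]) (B : 'rV[R]_m) (j : 'I_m) (t : R) (xi : Rn) :
    R[i] :=
  \sum_(l < m) RL_factor (lam xi 0 l) (B 0 l) t * Kmatrix M Phih xi j l.

(* The solution itself is the inverse Fourier transform of solution_fourier. *)
Definition solution (M : Rn -> 'M[R[i]]_m) (lam : Rn -> 'rV[R[i]]_m)
    (Phih : 'I_m -> Rn -> R[i]) (B : 'rV[R]_m) (j : 'I_m) (t : R) (x : Rn) :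
    R[i] :=
  ((2 * pi) ^- n)%:C *
  cplx_integral (fun xi =>
    solution_fourier M lam Phih B j t xi * expi (dotp x xi)).

Definition R_RL (lam : R[i]) (beta0 t0 : R) : set R[i] :=
  [set RL_factor lam b t0 | b in `[beta0, 1[].

End SecondForwardProblem.

(* Main.v *)
(* Multiplying by K^-1 decouples the m equalities, so everything reduces to a
   scalar fact: if Re(lam) < 0 then, for t large, b |-> t^(b-1) E_{b,b}(lam t^b)
   is injective on [beta0, 1].

   In the logarithmic variable w = ln(zeta) the Hankel contour becomes the pair of
   curves w = x + v +- i th (1 - e^-v), v > 0, with pi/2 < th <= pi, along which
   kern w = e^(e^w) decays doubly exponentially.  Expanding
   1 / (zeta^b - z) geometrically far out on the contour gives
     2 pi i E_{b,b}(z) = \int e^zeta / (zeta^b - z) dzeta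
   as soon as zeta^b stays away from z, and th is chosen depending on lam only, so
   that this holds for z = lam t^b and all b in ]0, 1] at once.  With
   2 pi i / Gamma(a) = \int e^zeta zeta^-a dzeta, three terms of the expansion in
   zeta^b / z leave
     2 pi i lam^2 t RL_factor lam b t =
       2 pi i t^-b b (1 - b) / Gamma(2 - b) + \int e^zeta S(zeta, b),
   where S = (zeta / t)^(2b) / ((zeta / t)^b - lam).  For b1 < b2 the difference of
   the main terms is at least c t^-b1 (b2 - b1), because t^-b and 1 - b both decrease,
   whereas that of the remainders is O(t^-(b1 + beta0/2) (b2 - b1)). *)
Require Import Defs.
From HB Require Import structures.
From mathcomp Require Import all_boot all_order all_algebra complex.
From mathcomp Require Import all_classical all_reals all_analysis.
From mathcomp Require Import measurable_realfun lebesgue_integral_under.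
From mathcomp Require Import ring lra.
Import Order.TTheory GRing.Theory Num.Theory.
Import numFieldNormedType.Exports.
Local Open Scope classical_set_scope.
Local Open Scope ring_scope.
Local Open Scope complex_scope.
Set Implicit Arguments.
Unset Strict Implicit.
Unset Printing Implicit Defensive.

(** * Complex calculus on the real line and in the plane *)

(** The main term carries the factor 1 - b and vanishes at b = 1, so comparing sizes of main term
    and remainder says nothing near that end. Only differences in b are compared, and every estimate
    is therefore a Lipschitz bound in the order. In the variable w each power of zeta is the entire
    function e^(a w): there is no branch cut, and its dependence on a is explicit. Cauchy's theorem
    is replaced by translation. Both curves start at the same point x, moving x changes the integral
    along each by the same boundary term, and the two terms cancel in the difference. The link with
    Euler's integral for Gamma comes from the pole of zeta^-a / (1 - zeta) at zeta = 1. Its contour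
    integral is 0 when the contour starts to the right of the pole and 2 pi i when it starts to the
    left, and on the left 1 / (1 - zeta) is the integral of e^(-Y (1 - zeta)) over Y > 0. The value
    2 pi i is computed as the growth of an argument along a curve. *)

Notation nrm := Normc.normc.
Notation RE := complex.Re.
Notation IM := complex.Im.

Section ComplexCalculus.
Variable R : realType.
Local Notation C := R[i].
Implicit Types (f g : R -> C) (z w : C) (x v : R).

Lemma reD z w : RE (z + w) = RE z + RE w. Proof. by case: z w => ? ? []. Qed.
Lemma imD z w : IM (z + w) = IM z + IM w. Proof. by case: z w => ? ? []. Qed.
Lemma reN z : RE (- z) = - RE z. Proof. by case: z. Qed.
Lemma imN z : IM (- z) = - IM z. Proof. by case: z. Qed.
Lemma reM z w : RE (z * w) = RE z * RE w - IM z * IM w.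
Proof. by case: z w => ? ? []. Qed.
Lemma imM z w : IM (z * w) = RE z * IM w + IM z * RE w.
Proof. by case: z w => ? ? []. Qed.
Lemma reV z : RE z^-1 = RE z / (RE z ^+ 2 + IM z ^+ 2). Proof. by case: z. Qed.
Lemma imV z : IM z^-1 = - (IM z / (RE z ^+ 2 + IM z ^+ 2)).
Proof. by case: z. Qed.
Definition reimE := (reD, imD, reN, imN, reM, imM).

Lemma cplx_ext z w : RE z = RE w -> IM z = IM w -> z = w.
Proof. by case: z w => ? ? [? ?] /= -> ->. Qed.

Lemma sqnrm z : nrm z ^+ 2 = RE z ^+ 2 + IM z ^+ 2.
Proof. by case: z => a b /=; rewrite sqr_sqrtr// addr_ge0// sqr_ge0. Qed.

Lemma nrm_ge0 z : 0 <= nrm z. Proof. by case: z => a b; exact: sqrtr_ge0. Qed.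

Lemma nrm_eq0 z : (nrm z == 0) = (z == 0).
Proof.
apply/eqP/eqP => [/Normc.eq0_normc//|->]; exact: Normc.normc0.
Qed.

Lemma nrm_gt0 z : (0 < nrm z) = (z != 0).
Proof. by rewrite lt_neqAle nrm_ge0 andbT eq_sym nrm_eq0. Qed.

Lemma sqnrm_neq0 z : z != 0 -> RE z ^+ 2 + IM z ^+ 2 != 0.
Proof. by rewrite -sqnrm sqrf_eq0 nrm_eq0. Qed.

Lemma ler_nrmD z w : nrm (z + w) <= nrm z + nrm w.
Proof. exact: le_normcD. Qed.

Lemma nrmN z : nrm (- z) = nrm z. Proof. exact: normcN. Qed.

Lemma ler_nrmB z w : nrm (z - w) <= nrm z + nrm w.
Proof. by rewrite -(nrmN w) ler_nrmD. Qed.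

Lemma nrmM z w : nrm (z * w) = nrm z * nrm w. Proof. exact: Normc.normcM. Qed.
Lemma nrmV z : nrm z^-1 = (nrm z)^-1. Proof. exact: Normc.normcV. Qed.
Lemma nrmX z n : nrm (z ^+ n) = nrm z ^+ n.
Proof.
elim: n => [|n IH]; first by rewrite !expr0 Normc.normc1.
by rewrite !exprS nrmM IH.
Qed.

Lemma nrmC x : nrm (x%:C) = `|x|.
Proof. by rewrite /= expr0n /= addr0 sqrtr_sqr. Qed.

Lemma normRe_le z : `|RE z| <= nrm z.
Proof.
rewrite -(@ler_pXn2r _ 2)// ?nnegrE ?nrm_ge0// sqnrm real_normK ?num_real//.
by rewrite lerDl sqr_ge0.
Qed.

Lemma normIm_le z : `|IM z| <= nrm z.
Proof.
rewrite -(@ler_pXn2r _ 2)// ?nnegrE ?nrm_ge0// sqnrm real_normK ?num_real//.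
by rewrite lerDr sqr_ge0.
Qed.

Lemma nrm_le_ReIm z : nrm z <= `|RE z| + `|IM z|.
Proof.
rewrite -(@ler_pXn2r _ 2)// ?nnegrE ?nrm_ge0 ?addr_ge0// sqnrm.
rewrite sqrrD !real_normK ?num_real// lerD2r lerDl.
by rewrite mulrn_wge0// mulr_ge0.
Qed.

Lemma nrm_sub_ge z w : nrm z - nrm w <= nrm (z - w).
Proof. by rewrite lerBlDr (le_trans _ (ler_nrmD _ _))// subrK. Qed.

Definition cexp z : C := (expR (RE z) * cos (IM z)) +i* (expR (RE z) * sin (IM z)).

Lemma cexpD z w : cexp (z + w) = cexp z * cexp w.
Proof.
by apply: cplx_ext; rewrite !reimE /= !reimE expRD ?cosD ?sinD; ring.
Qed.

Lemma nrm_cexp z : nrm (cexp z) = expR (RE z).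
Proof.
apply/eqP; rewrite -(@eqrXn2 _ 2)// ?nrm_ge0 ?expR_ge0// sqnrm /=; apply/eqP.
by rewrite !exprMn -mulrDr cos2Dsin2 mulr1.
Qed.

Lemma cexp_neq0 z : cexp z != 0.
Proof. by rewrite -nrm_gt0 nrm_cexp expR_gt0. Qed.

Lemma cexp0 : cexp 0 = 1.
Proof. by apply: cplx_ext; rewrite /= expR0 ?cos0 ?sin0 ?mulr1 ?mulr0. Qed.

Lemma cexpN z : cexp (- z) = (cexp z)^-1.
Proof.
by apply: (mulIf (cexp_neq0 z)); rewrite -cexpD addNr cexp0 mulVf ?cexp_neq0.
Qed.

Lemma cexpC x : cexp (x%:C) = (expR x)%:C.
Proof. by apply: cplx_ext; rewrite /= ?cos0 ?sin0 ?mulr1 ?mulr0. Qed.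

Lemma rderD (f g : R -> R) df dg x : is_derive x (1 : R) f df -> is_derive x (1 : R) g dg ->
  is_derive x (1 : R) (fun v => f v + g v) (df + dg).
Proof. by move=> hf hg; exact: is_deriveD. Qed.

Lemma rderN (f : R -> R) df x : is_derive x (1 : R) f df ->
  is_derive x (1 : R) (fun v => - f v) (- df).
Proof. by move=> hf; exact: is_deriveN. Qed.

Lemma rderB (f g : R -> R) df dg x : is_derive x (1 : R) f df -> is_derive x (1 : R) g dg ->
  is_derive x (1 : R) (fun v => f v - g v) (df - dg).
Proof. by move=> hf hg; exact: is_deriveB. Qed.

Lemma rderM (f g : R -> R) df dg x : is_derive x (1 : R) f df -> is_derive x (1 : R) g dg ->
  is_derive x (1 : R) (fun v => f v * g v) (df * g x + f x * dg).
Proof.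
move=> hf hg; apply: (is_derive_eq (is_deriveM hf hg)).
by rewrite /GRing.scale /=; ring.
Qed.

Lemma rder_comp (f g : R -> R) df dg x : is_derive x (1 : R) f df ->
  is_derive (f x) (1 : R) g dg ->
  is_derive x (1 : R) (fun v => g (f v)) (dg * df).
Proof. by move=> hf hg; exact: (is_derive1_comp hg hf). Qed.

Lemma rderV (f : R -> R) df x : f x != 0 -> is_derive x (1 : R) f df ->
  is_derive x (1 : R) (fun v => (f v)^-1) (- df / f x ^+ 2).
Proof.
move=> f0 hf; apply: (is_derive_eq (is_deriveV f0 hf)).
by rewrite /GRing.scale /= mulrC mulNr mulrN.
Qed.

Definition cderiv f (df : C) x :=
  is_derive x (1 : R) (fun v => RE (f v)) (RE df) /\
  is_derive x (1 : R) (fun v => IM (f v)) (IM df).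

Definition ccont f x :=
  {for x, continuous (fun v => RE (f v))} /\
  {for x, continuous (fun v => IM (f v))}.

Lemma is_derive_cont (h : R -> R) x dh : is_derive x (1 : R) h dh -> {for x, continuous h}.
Proof. by move=> [dh' _]; exact/differentiable_continuous/derivable1_diffP. Qed.

Lemma cderiv_cont f df x : cderiv f df x -> ccont f x.
Proof. by move=> [? ?]; split; apply: is_derive_cont; eauto. Qed.

Lemma eq_cderiv f df df' x : cderiv f df x -> df = df' -> cderiv f df' x.
Proof. by move=> + <-. Qed.

Lemma cderiv_cst z x : cderiv (fun=> z) 0 x.
Proof. by split => /=; exact: is_derive_cst. Qed.

Lemma cderivD f g df dg x : cderiv f df x -> cderiv g dg x ->
  cderiv (fun v => f v + g v) (df + dg) x.
Proof.
move=> [f1 f2] [g1 g2]; split.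
- under eq_fun do rewrite reD; rewrite reD; exact: is_deriveD.
- under eq_fun do rewrite imD; rewrite imD; exact: is_deriveD.
Qed.

Lemma cderivN f df x : cderiv f df x -> cderiv (fun v => - f v) (- df) x.
Proof.
move=> [f1 f2]; split.
- under eq_fun do rewrite reN; rewrite reN; exact: is_deriveN.
- under eq_fun do rewrite imN; rewrite imN; exact: is_deriveN.
Qed.

Lemma cderivB f g df dg x : cderiv f df x -> cderiv g dg x ->
  cderiv (fun v => f v - g v) (df - dg) x.
Proof. by move=> hf hg; apply: cderivD => //; exact: cderivN. Qed.

Lemma cderivM f g df dg x : cderiv f df x -> cderiv g dg x ->
  cderiv (fun v => f v * g v) (df * g x + f x * dg) x.
Proof.
move=> [f1 f2] [g1 g2]; split.
- under eq_fun do rewrite reM.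
  apply: (is_derive_eq (rderB (rderM f1 g1) (rderM f2 g2))).
  by rewrite !reimE; ring.
- under eq_fun do rewrite imM.
  apply: (is_derive_eq (rderD (rderM f1 g2) (rderM f2 g1))).
  by rewrite !reimE; ring.
Qed.

Lemma cderiv_real (h : R -> R) dh x : is_derive x (1 : R) h dh ->
  cderiv (fun v => (h v)%:C) (dh%:C) x.
Proof. by move=> hd; split => //=; exact: is_derive_cst. Qed.

Lemma cderiv_exp f df x : cderiv f df x ->
  cderiv (fun v => cexp (f v)) (df * cexp (f x)) x.
Proof.
move=> [f1 f2]; split => /=.
- apply: (is_derive_eq (rderM (rder_comp f1 (is_derive_expR _))
    (rder_comp f2 (is_derive_cos _)))).
  by rewrite !reimE /=; ring.
- apply: (is_derive_eq (rderM (rder_comp f1 (is_derive_expR _))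
    (rder_comp f2 (is_derive_sin _)))).
  by rewrite !reimE /=; ring.
Qed.

Lemma cderivV f df x : f x != 0 -> cderiv f df x ->
  cderiv (fun v => (f v)^-1) (- df / f x ^+ 2) x.
Proof.
move=> fx0 [f1 f2].
have q0 := sqnrm_neq0 fx0.
pose q v := RE (f v) ^+ 2 + IM (f v) ^+ 2.
have dq : is_derive x (1 : R) q
    (RE df * RE (f x) + RE (f x) * RE df + (IM df * IM (f x) + IM (f x) * IM df)).
  rewrite /q; under eq_fun do rewrite !expr2.
  by apply: rderD; apply: rderM.
have dqV := rderV (q0 : q x != 0) dq.
have q2 : (f x ^+ 2)^-1 = ((RE (f x) ^+ 2 - IM (f x) ^+ 2) / q x ^+ 2) +i*
    (- (2 * RE (f x) * IM (f x)) / q x ^+ 2).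
  apply: (mulfI (expf_neq0 2 fx0)); rewrite mulfV ?expf_neq0//.
  move: q0; rewrite /q; case: (f x) => a b /= q0.
  by apply: cplx_ext; rewrite /=; field.
split.
- under eq_fun do rewrite reV.
  apply: (is_derive_eq (rderM f1 dqV)).
  rewrite q2 /q reM reN imN /=.
  by move: q0; rewrite /q; case: (f x) => a b /= q0; case: df {f1 f2 dq dqV} => c d /=; field.
- under eq_fun do rewrite imV.
  apply: (is_derive_eq (rderN (rderM f2 dqV))).
  rewrite q2 /q imM reN imN /=.
  by move: q0; rewrite /q; case: (f x) => a b /= q0; case: df {f1 f2 dq dqV} => c d /=; field.
Qed.

(** Complex differentiability encoded as the chain rule along every differentiable real curve
    through z. The integrals only ever see [F] composed with a curve, in v along a ray or in x
    across rays. *)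
Definition hol (F : C -> C) (dF : C) (z : C) :=
  forall (g : R -> C) dg x, g x = z -> cderiv g dg x ->
    cderiv (fun v => F (g v)) (dF * dg) x.

Lemma eq_hol F dF dF' z : hol F dF z -> dF = dF' -> hol F dF' z.
Proof. by move=> + <-. Qed.

Lemma hol_cst c z : hol (fun=> c) 0 z.
Proof. by move=> g dg x _ _; rewrite mul0r; exact: cderiv_cst. Qed.

Lemma hol_id z : hol id 1 z.
Proof. by move=> g dg x _ h; rewrite mul1r. Qed.

Lemma holD F G dF dG z : hol F dF z -> hol G dG z -> hol (fun w => F w + G w) (dF + dG) z.
Proof. by move=> hF hG g dg x gz h; rewrite mulrDl; apply: cderivD; [apply: hF|apply: hG]. Qed.

Lemma holN F dF z : hol F dF z -> hol (fun w => - F w) (- dF) z.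
Proof. by move=> hF g dg x gz h; rewrite mulNr; apply: cderivN; apply: hF. Qed.

Lemma holM F G dF dG z : hol F dF z -> hol G dG z ->
  hol (fun w => F w * G w) (dF * G z + F z * dG) z.
Proof.
move=> hF hG g dg x gz h; apply: (eq_cderiv (cderivM (hF _ _ _ gz h) (hG _ _ _ gz h))).
by rewrite gz; ring.
Qed.

Lemma holV F dF z : F z != 0 -> hol F dF z -> hol (fun w => (F w)^-1) (- dF / F z ^+ 2) z.
Proof.
move=> Fz hF g dg x gz h; subst z.
apply: (eq_cderiv (cderivV Fz (hF _ _ _ erefl h))).
by rewrite !mulNr; congr (- _); rewrite mulrAC.
Qed.

Lemma hol_exp F dF z : hol F dF z -> hol (fun w => cexp (F w)) (dF * cexp (F z)) z.
Proof.
move=> hF g dg x gz h; apply: (eq_cderiv (cderiv_exp (hF _ _ _ gz h))).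
by rewrite gz; ring.
Qed.

Lemma hol_comp_cont F dF (g : R -> C) dg x : hol F dF (g x) -> cderiv g dg x ->
  ccont (fun v => F (g v)) x.
Proof. by move=> hF h; exact: cderiv_cont (hF _ _ _ erefl h). Qed.

End ComplexCalculus.

(** * Integrals over the half-line *)

Section HalfLine.
Variable R : realType.
Implicit Types (f g A : R -> R) (c e v : R).
Let mu : {measure set _ -> \bar R} := @lebesgue_measure R.
Local Notation D := (`]0%R, +oo[%classic : set R).

Definition rint f : R := \int[mu]_(v in D) f v.

Lemma is_derive_expN e v : is_derive v (1 : R) (fun v => expR (- (e * v))) (- e * expR (- (e * v))).
Proof.
apply: (is_derive_eq (rder_comp (rderN (rderM (is_derive_cst e v 1) (is_derive_id v 1)))
  (is_derive_expR _))).
by rewrite /=; ring.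
Qed.

Lemma continuous_expN e : continuous (fun v : R => expR (- (e * v))).
Proof. by move=> v; exact: (is_derive_cont (is_derive_expN e v)). Qed.

Lemma cvg_expN e : 0 < e -> expR (- (e * v)) @[v --> +oo] --> (0 : R).
Proof.
move=> e0; apply: (@cvg_comp _ _ _ (fun v => e * v) (fun x => expR (- x)) _ (+oo)).
  exact: gt0_cvgMry.
exact: cvgr_expR.
Qed.

Lemma cvg_ZexpN c e : 0 < e -> c * expR (- (e * v)) @[v --> +oo] --> (0 : R).
Proof.
move=> e0; rewrite -[X in _ --> X](mulr0 c).
by apply: cvgM; [exact: cvg_cst|exact: cvg_expN].
Qed.

Lemma integral_expN e : 0 < e ->
  (\int[mu]_(v in `[0%R, +oo[) (expR (- (e * v)))%:E = (e^-1)%:E)%E.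
Proof.
move=> e0.
rewrite (@ge0_continuous_FTC2y _ _ (fun v => - (e^-1 * expR (- (e * v)))) _ 0).
- by rewrite mulr0 oppr0 expR0 mulr1 -EFinD sub0r opprK.
- by move=> x _; exact: expR_ge0.
- by apply: continuous_subspaceT; exact: continuous_expN.
- rewrite -oppr0; apply: cvgN; rewrite -(mulr0 (e^-1)).
  by apply: cvgM; [exact: cvg_cst|exact: cvg_expN].
- move=> x _; have := rderN (rderM (is_derive_cst (e^-1) x 1) (is_derive_expN e x)).
  by case.
- apply: cvg_at_right_filter; apply: cvgN; apply: cvgM; [exact: cvg_cst|].
  exact: continuous_expN.
- move=> x _; rewrite derive1E.
  have [_ ->] := rderN (rderM (is_derive_cst (e^-1) x 1) (is_derive_expN e x)).
  by rewrite mul0r add0r mulNr mulrN opprK mulrA mulVf ?gt_eqF// mul1r.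
Qed.

Lemma measurable_Dcont f : (forall v, 0 < v -> {for v, continuous f}) ->
  measurable_fun D f.
Proof.
move=> cf; apply: open_continuous_measurable_fun; first exact: interval_open.
by move=> x; rewrite inE /= in_itv /= andbT; exact: cf.
Qed.

Lemma integrable_expN c e : 0 < e ->
  mu.-integrable D (EFin \o (fun v => c * expR (- (e * v)))).
Proof.
move=> e0.
have mf : measurable_fun D (fun v => expR (- (e * v))).
  by apply: measurable_Dcont => v _; exact: continuous_expN.
have h : mu.-integrable D (EFin \o (fun v => expR (- (e * v)))).
  apply/integrableP; split; first exact/measurable_EFinP.
  have -> : (\int[mu]_(x in D) `|(EFin \o (fun v => expR (- (e * v)))) x|)%E = (e^-1)%:E.
    rewrite -integral_expN// -[RHS]integral_itv_obnd_cbnd; last exact/measurable_EFinP.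
    by apply: eq_integral => x _ /=; rewrite ger0_norm ?expR_ge0.
  exact: ltry.
rewrite (_ : _ \o _ = (fun x => c%:E * (EFin \o (fun v => expR (- (e * v)))) x)%E).
  exact: integrableZl.
by apply/funext => x /=; rewrite EFinM.
Qed.

Lemma rint_expN c e : 0 < e -> rint (fun v => c * expR (- (e * v))) = c / e.
Proof.
move=> e0; rewrite /rint RintegralZl//; last first.
  by have := integrable_expN 1 e0; under [X in EFin \o X]eq_fun do rewrite mul1r.
congr (_ * _); rewrite Rintegral_itv_obnd_cbnd.
  by rewrite /Rintegral integral_expN.
by have := integrable_expN 1 e0; under [X in EFin \o X]eq_fun do rewrite mul1r.
Qed.

(** The endpoint 0 is left out on purpose: a ray starting at w = 0 starts at the pole of the
    integrands of the residue computation. *)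
Definition rapidR f := (forall v, 0 < v -> {for v, continuous f}) /\
  exists c e, 0 < e /\ forall v, 0 < v -> `|f v| <= c * expR (- (e * v)).

Lemma rapid_integrable f : rapidR f -> mu.-integrable D (EFin \o f).
Proof.
move=> [cf [c [e [e0 fb]]]].
apply: (le_integrable _ _ _ (integrable_expN c e0)) => //.
  by apply/measurable_EFinP; exact: measurable_Dcont.
move=> x; rewrite /= in_itv /= andbT => x0.
rewrite lee_fin; apply: (le_trans (fb _ x0)); exact: ler_norm.
Qed.

Lemma rint_bound f c e : (forall v, 0 < v -> {for v, continuous f}) -> 0 < e ->
  (forall v, 0 < v -> `|f v| <= c * expR (- (e * v))) -> `|rint f| <= c / e.
Proof.
move=> cf e0 fb.
have fi : mu.-integrable D (EFin \o f) by apply: rapid_integrable; split => //; exists c, e.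
rewrite -rint_expN//; apply: (le_trans (le_normr_Rintegral _ fi)) => //.
apply: le_Rintegral => //.
- exact: (integrable_norm fi).
- exact: integrable_expN.
by move=> x; rewrite /= in_itv /= andbT; exact: fb.
Qed.

Lemma rintD f g : rapidR f -> rapidR g -> rint (fun v => f v + g v) = rint f + rint g.
Proof. by move=> hf hg; rewrite /rint RintegralD//; exact: rapid_integrable. Qed.

Lemma rintB f g : rapidR f -> rapidR g -> rint (fun v => f v - g v) = rint f - rint g.
Proof. by move=> hf hg; rewrite /rint RintegralB//; exact: rapid_integrable. Qed.

Lemma rintZ c f : rapidR f -> rint (fun v => c * f v) = c * rint f.
Proof. by move=> hf; rewrite /rint RintegralZl//; exact: rapid_integrable. Qed.

Lemma eq_rint f g : (forall v, 0 < v -> f v = g v) -> rint f = rint g.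
Proof.
move=> fg; apply: eq_Rintegral => x; rewrite inE /= in_itv /= andbT; exact: fg.
Qed.

Lemma rapidR_Z c f : rapidR f -> rapidR (fun v => c * f v).
Proof.
move=> [cf [C [e [e0 fb]]]]; split.
  by move=> v v0; apply: continuousM; [exact: cst_continuous|exact: cf].
exists (`|c| * C), e; split => // v v0.
by rewrite normrM -mulrA ler_wpM2l// fb.
Qed.

Lemma rapidR_expN c e : 0 < e -> rapidR (fun v => c * expR (- (e * v))).
Proof.
move=> e0; split.
  by move=> v v0; apply: continuousM; [exact: cst_continuous|exact: continuous_expN].
exists `|c|, e; split => // v v0; by rewrite normrM (ger0_norm (expR_ge0 _)).
Qed.

Lemma rint_FTC f A l c e :
  (forall v, 0 <= v -> {for v, continuous f}) -> 0 < e ->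
  (forall v, 0 <= v -> `|f v| <= c * expR (- (e * v))) ->
  (forall v, 0 <= v -> is_derive v (1 : R) A (f v)) ->
  A v @[v --> +oo] --> l -> rint f = l - A 0.
Proof.
move=> cf e0 fb dA Al.
have rf : rapidR f.
  split; first by move=> v /ltW; exact: cf.
  by exists c, e; split => // v /ltW; exact: fb.
have rg := rapidR_expN c e0.
(* The fundamental theorem applied below asks for a nonnegative integrand; adding the dominating
   exponential, whose integral is known, makes [f] one. *)
suff : rint (fun v => f v + c * expR (- (e * v))) = l - (A 0 - c / e).
  by rewrite rintD// rint_expN// => /(canRL (addrK _)) ->; ring.
have cfg v : 0 <= v -> {for v, continuous (fun v => f v + c * expR (- (e * v)))}.
  move=> v0; apply: continuousD; first exact: cf.
  by apply: continuousM; [exact: cst_continuous|exact: continuous_expN].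
have rfg : rapidR (fun v => f v + c * expR (- (e * v))).
  split; first by move=> v /ltW; exact: cfg.
  exists (c + `|c|), e; split => // v v0.
  rewrite mulrDl (le_trans (ler_normD _ _))// lerD//; first exact/fb/ltW.
  by rewrite normrM (ger0_norm (expR_ge0 (- (e * v)))).
rewrite /rint Rintegral_itv_obnd_cbnd; last exact: rapid_integrable.
have dA2 v : 0 <= v -> is_derive v (1 : R) (fun v => A v - c / e * expR (- (e * v))) (f v + c * expR (- (e * v))).
  move=> v0; apply: (is_derive_eq (rderB (dA _ v0) (rderM (is_derive_cst (c / e) v 1) (is_derive_expN e v)))).
  by rewrite mul0r add0r mulNr mulrN opprK mulrA mulfVK ?gt_eqF.
rewrite (@Rintegral_ge0_continuous_FTC2y _ _ (fun v => A v - c / e * expR (- (e * v))) _ l).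
- by rewrite mulr0 oppr0 expR0 mulr1.
- by move=> x x0; have := fb _ x0; rewrite ler_norml => /andP[h _]; rewrite -lerBlDr sub0r.
- apply/continuous_within_itvcyP; split.
    by move=> x; rewrite in_itv /= andbT => /ltW; exact: cfg.
  by apply: cvg_at_right_filter; exact: cfg.
- rewrite -[X in _ --> X]subr0; apply: cvgB => //.
  exact: cvg_ZexpN.
- by move=> x /ltW /dA2[].
- by apply: cvg_at_right_filter; exact: (is_derive_cont (dA2 _ (lexx _))).
- move=> x; rewrite in_itv /= andbT => /ltW /dA2[_]; by rewrite derive1E.
Qed.

Lemma rint_deriv (K dK : R -> R -> R) (a b x c e : R) : a < x < b ->
  (forall y, a < y < b -> rapidR (K y)) -> 0 < e ->
  (forall y v, a < y < b -> 0 < v -> is_derive y (1 : R) (K ^~ v) (dK y v)) ->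
  (forall y v, a < y < b -> 0 < v -> `|dK y v| <= c * expR (- (e * v))) ->
  is_derive x (1 : R) (fun y => rint (K y)) (rint (dK x)).
Proof.
move=> xab rK e0 dKd dKb.
have Ix : [set` `]a, b[]  x by rewrite /= in_itv.
have H1 : forall y, [set` `]a, b[]  y -> mu.-integrable D (EFin \o K y).
  by move=> y; rewrite /= in_itv /= => yab; exact/rapid_integrable/rK.
have H2 : forall y v, [set` `]a, b[]  y -> D v -> derivable (K ^~ v) y 1.
  by move=> y v; rewrite /= !in_itv /= andbT => yab v0; case: (dKd _ _ yab v0).
have E y v : [set` `]a, b[]  y -> D v -> partial1of2 K y v = dK y v.
  rewrite /= !in_itv /= andbT => yab v0; rewrite partial1of2E.
  by case: (dKd _ _ yab v0).
(* No sign is assumed for [c], and the dominating function has to be nonnegative. *)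
pose G v := `|c| * expR (- (e * v)).
have G0 v : 0 <= G v by rewrite mulr_ge0 ?expR_ge0.
have iG : mu.-integrable D (EFin \o G) by exact: integrable_expN.
have Gb y v : [set` `]a, b[]  y -> D v -> `|partial1of2 K y v| <= G v.
  move=> Iy Dv; rewrite E//; move: Iy Dv; rewrite /= !in_itv /= andbT => yab v0.
  by rewrite (le_trans (dKb _ _ yab v0))// ler_wpM2r ?expR_ge0 ?ler_norm.
have mD := measurable_itv (`]0%R, +oo[ : interval R).
apply: DeriveDef.
  exact: (@derivable_under_integral R _ _ mu K D mD x a b Ix H1 H2 G G0 iG Gb).
rewrite -derive1E (@differentiation_under_integral R _ _ mu K D mD x a b Ix H1 H2 G G0 iG Gb).
apply: eq_Rintegral => v /set_mem Dv; exact: E.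
Qed.

Lemma rint_continuous (K : R -> R -> R) (a b c e : R) :
  (forall y, a < y < b -> rapidR (K y)) -> 0 < e ->
  (forall y v, a < y < b -> 0 < v -> {for y, continuous (K ^~ v)}) ->
  (forall y v, a < y < b -> 0 < v -> `|K y v| <= c * expR (- (e * v))) ->
  forall x, a < x < b -> {for x, continuous (fun y => rint (K y))}.
Proof.
move=> rK e0 cK Kb x xab.
have mD : measurable D by exact: measurable_itv.
apply: (@continuity_under_integral _ _ _ mu K D mD a b _ _ (fun v => c * expR (- (e * v)))).
- by move=> y; rewrite /= in_itv /= => yab; exact/rapid_integrable/rK.
- apply: aeW => v; rewrite /= in_itv /= andbT => v0 y; rewrite inE /= in_itv /= => yab.
  exact: cK.
- exact: integrable_expN.
- move=> y; rewrite /= in_itv /= => yab; apply: aeW => v; rewrite /= in_itv /= andbT => v0.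
  exact: Kb.
- by rewrite inE /= in_itv.
Qed.

End HalfLine.

(** * Contour integrals *)

Section ComplexIntegral.
Variable R : realType.
Local Notation C := R[i].
Implicit Types (f g A : R -> C) (z w : C) (x y v c e th : R).

Lemma ccontM f g v : ccont f v -> ccont g v -> ccont (fun v => f v * g v) v.
Proof.
move=> [f1 f2] [g1 g2]; split.
- rewrite (_ : (fun v => RE (f v * g v)) = fun v => RE (f v) * RE (g v) - IM (f v) * IM (g v)).
    by apply: continuousB; apply: continuousM.
  by apply/funext => u; rewrite reM.
- rewrite (_ : (fun v => IM (f v * g v)) = fun v => RE (f v) * IM (g v) + IM (f v) * RE (g v)).
    by apply: continuousD; apply: continuousM.
  by apply/funext => u; rewrite imM.
Qed.

Lemma ccontD f g v : ccont f v -> ccont g v -> ccont (fun v => f v + g v) v.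
Proof.
move=> [f1 f2] [g1 g2]; split.
- rewrite (_ : (fun v => RE (f v + g v)) = fun v => RE (f v) + RE (g v)).
    exact: continuousD.
  by apply/funext => u; rewrite reD.
- rewrite (_ : (fun v => IM (f v + g v)) = fun v => IM (f v) + IM (g v)).
    exact: continuousD.
  by apply/funext => u; rewrite imD.
Qed.

Lemma ccontB f g v : ccont f v -> ccont g v -> ccont (fun v => f v - g v) v.
Proof.
move=> [f1 f2] [g1 g2]; split.
- rewrite (_ : (fun v => RE (f v - g v)) = fun v => RE (f v) - RE (g v)).
    exact: continuousB.
  by apply/funext => u; rewrite reD reN.
- rewrite (_ : (fun v => IM (f v - g v)) = fun v => IM (f v) - IM (g v)).
    exact: continuousB.
  by apply/funext => u; rewrite imD imN.
Qed.

Lemma ccont_cst z v : ccont (fun=> z) v.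
Proof. by split; exact: cst_continuous. Qed.

Definition cint f : C := rint (fun v => RE (f v)) +i* rint (fun v => IM (f v)).

Definition rapid f := (forall v, 0 < v -> ccont f v) /\
  exists c e, 0 < e /\ forall v, 0 < v -> nrm (f v) <= c * expR (- (e * v)).

Lemma rapid_Re f : rapid f -> rapidR (fun v => RE (f v)).
Proof.
move=> [cf [c [e [e0 fb]]]]; split; first by move=> v /cf[].
by exists c, e; split => // v /fb; exact: le_trans (normRe_le _).
Qed.

Lemma rapid_Im f : rapid f -> rapidR (fun v => IM (f v)).
Proof.
move=> [cf [c [e [e0 fb]]]]; split; first by move=> v /cf[].
by exists c, e; split => // v /fb; exact: le_trans (normIm_le _).
Qed.

Lemma rapidM z f : rapid f -> rapid (fun v => z * f v).
Proof.
move=> [cf [c [e [e0 fb]]]]; split.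
  by move=> v v0; apply: ccontM; [exact: ccont_cst|exact: cf].
exists (nrm z * c), e; split => // v v0.
by rewrite nrmM -mulrA ler_wpM2l ?nrm_ge0 ?fb.
Qed.

Lemma rapidD f g : rapid f -> rapid g -> rapid (fun v => f v + g v).
Proof.
move=> [cf [c [e [e0 fb]]]] [cg [c' [e' [e'0 gb]]]]; split.
  by move=> v v0; apply: ccontD; [exact: cf|exact: cg].
exists (`|c| + `|c'|), (Num.min e e'); split; first by rewrite lt_min e0.
move=> v v0; rewrite (le_trans (ler_nrmD _ _))// mulrDl lerD//.
- rewrite (le_trans (fb _ v0))// (le_trans (ler_wpM2r (expR_ge0 _) (ler_norm _)))//.
  by rewrite ler_wpM2l// ler_expR lerN2 ler_wpM2r ?ge_min ?lexx// ltW.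
- rewrite (le_trans (gb _ v0))// (le_trans (ler_wpM2r (expR_ge0 _) (ler_norm _)))//.
  by rewrite ler_wpM2l// ler_expR lerN2 ler_wpM2r ?ge_min ?lexx ?orbT// ltW.
Qed.

Lemma eq_rapid f g : (forall v, f v = g v) -> rapid f -> rapid g.
Proof. by move=> fg; have -> : f = g by apply/funext. Qed.

Lemma rapidN f : rapid f -> rapid (fun v => - f v).
Proof. by move=> /(rapidM (-1)); apply: eq_rapid => v; rewrite mulN1r. Qed.

Lemma eq_cint f g : (forall v, 0 < v -> f v = g v) -> cint f = cint g.
Proof. by move=> fg; apply: cplx_ext => /=; apply: eq_rint => v v0; rewrite fg. Qed.

Lemma cintD f g : rapid f -> rapid g -> cint (fun v => f v + g v) = cint f + cint g.
Proof.
move=> hf hg; apply: cplx_ext; rewrite !reimE /=.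
- under eq_rint => v _ do rewrite reD.
  by rewrite rintD//; exact: rapid_Re.
- under eq_rint => v _ do rewrite imD.
  by rewrite rintD//; exact: rapid_Im.
Qed.

Lemma cintM z f : rapid f -> cint (fun v => z * f v) = z * cint f.
Proof.
move=> hf; have hR := rapid_Re hf; have hI := rapid_Im hf.
apply: cplx_ext; rewrite !reimE /=.
- under eq_rint => v _ do rewrite reM.
  by rewrite rintB ?rintZ//; exact: rapidR_Z.
- under eq_rint => v _ do rewrite imM.
  by rewrite rintD ?rintZ//; exact: rapidR_Z.
Qed.

Lemma cintB f g : rapid f -> rapid g -> cint (fun v => f v - g v) = cint f - cint g.
Proof.
move=> hf hg; rewrite cintD//; last exact: rapidN.
by congr (_ + _); rewrite -mulN1r -cintM//; apply: eq_cint => v _; rewrite mulN1r.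
Qed.

Lemma cint_bound f c e : (forall v, 0 < v -> ccont f v) -> 0 < e ->
  (forall v, 0 < v -> nrm (f v) <= c * expR (- (e * v))) ->
  nrm (cint f) <= c / e + c / e.
Proof.
move=> cf e0 fb; apply: (le_trans (nrm_le_ReIm _)); apply: lerD => /=.
- apply: rint_bound => // v v0; first by case: (cf _ v0).
  exact: le_trans (normRe_le _) (fb _ v0).
- apply: rint_bound => // v v0; first by case: (cf _ v0).
  exact: le_trans (normIm_le _) (fb _ v0).
Qed.

Lemma cvg_expbound (h : R -> R) c e : 0 < e ->
  (forall v, 0 <= v -> `|h v| <= c * expR (- (e * v))) -> h v @[v --> +oo] --> (0 : R).
Proof.
move=> e0 hb; apply: norm_cvg0.
apply: (@squeeze_cvgr _ _ _ _ (cst 0) _ _ _ _ _ (cvg_ZexpN c e0)).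
- near=> v; rewrite normr_ge0 /=; apply: hb.
  by near: v; exact: nbhs_pinfty_ge.
- exact: cvg_cst.
Unshelve. all: by end_near. Qed.

Lemma cint_FTC f A c e c' e' : (forall v, 0 <= v -> ccont f v) -> 0 < e -> 0 < e' ->
  (forall v, 0 <= v -> nrm (f v) <= c * expR (- (e * v))) ->
  (forall v, 0 <= v -> nrm (A v) <= c' * expR (- (e' * v))) ->
  (forall v, 0 <= v -> cderiv A (f v) v) -> cint f = - A 0.
Proof.
move=> cf e0 e'0 fb Ab dA; apply: cplx_ext; rewrite !reimE /=.
- rewrite -[RHS]sub0r; apply: (@rint_FTC _ _ (fun v => RE (A v)) 0 c e) => //.
  + by move=> v /cf[].
  + by move=> v v0; exact: le_trans (normRe_le _) (fb _ v0).
  + by move=> v /dA[].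
  + apply: (cvg_expbound e'0) => v v0; exact: le_trans (normRe_le _) (Ab _ v0).
- rewrite -[RHS]sub0r; apply: (@rint_FTC _ _ (fun v => IM (A v)) 0 c e) => //.
  + by move=> v /cf[].
  + by move=> v v0; exact: le_trans (normIm_le _) (fb _ v0).
  + by move=> v /dA[].
  + apply: (cvg_expbound e'0) => v v0; exact: le_trans (normIm_le _) (Ab _ v0).
Qed.

Lemma cint_deriv (K dK : R -> R -> C) (a b x c e : R) : a < x < b ->
  (forall y, a < y < b -> rapid (K y)) -> 0 < e ->
  (forall y v, a < y < b -> 0 < v -> cderiv (K ^~ v) (dK y v) y) ->
  (forall y v, a < y < b -> 0 < v -> nrm (dK y v) <= c * expR (- (e * v))) ->
  cderiv (fun y => cint (K y)) (cint (dK x)) x.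
Proof.
move=> xab rK e0 dKd dKb; split => /=.
- apply: (rint_deriv (K := fun y v => RE (K y v)) (dK := fun y v => RE (dK y v)) xab _ e0).
  + by move=> y /rK; exact: rapid_Re.
  + by move=> y v yab v0; case: (dKd _ _ yab v0).
  + by move=> y v yab v0; exact: le_trans (normRe_le _) (dKb _ _ yab v0).
- apply: (rint_deriv (K := fun y v => IM (K y v)) (dK := fun y v => IM (dK y v)) xab _ e0).
  + by move=> y /rK; exact: rapid_Im.
  + by move=> y v yab v0; case: (dKd _ _ yab v0).
  + by move=> y v yab v0; exact: le_trans (normIm_le _) (dKb _ _ yab v0).
Qed.

Lemma cint_continuous (K : R -> R -> C) (a b c e : R) :
  (forall y, a < y < b -> rapid (K y)) -> 0 < e ->
  (forall y v, a < y < b -> 0 < v -> ccont (K ^~ v) y) ->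
  (forall y v, a < y < b -> 0 < v -> nrm (K y v) <= c * expR (- (e * v))) ->
  forall x, a < x < b -> ccont (fun y => cint (K y)) x.
Proof.
move=> rK e0 cK Kb x xab; split => /=.
- apply: (rint_continuous (K := fun y v => RE (K y v)) (a := a) (b := b) (c := c) (e := e)) => //.
  + by move=> y /rK; exact: rapid_Re.
  + by move=> y v yab v0; case: (cK _ _ yab v0).
  + by move=> y v yab v0; exact: le_trans (normRe_le _) (Kb _ _ yab v0).
- apply: (rint_continuous (K := fun y v => IM (K y v)) (a := a) (b := b) (c := c) (e := e)) => //.
  + by move=> y /rK; exact: rapid_Im.
  + by move=> y v yab v0; case: (cK _ _ yab v0).
  + by move=> y v yab v0; exact: le_trans (normIm_le _) (Kb _ _ yab v0).
Qed.

Lemma rderiv0_const (f : R -> R) (a b x y : R) : a < x < b -> a < y < b ->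
  (forall z : R, a < z < b -> is_derive z (1 : R) f 0) -> f x = f y.
Proof.
wlog xy : x y / x < y.
  move=> h xab yab df; case: (ltgtP x y) => [xy|yx|->//]; first exact: h.
  by apply/esym; exact: h.
move=> /andP[ax xb] /andP[ay yb] df.
have I (z : R) : x <= z <= y -> a < z < b.
  by move=> /andP[xz zy]; rewrite (lt_le_trans ax)//= (le_lt_trans zy).
have [||c _] := @MVT _ f (fun=> 0) _ _ xy.
- by move=> z; rewrite in_itv /= => /andP[xz zy]; apply: df; apply: I; rewrite !ltW.
- apply: derivable_within_continuous => z; rewrite in_itv /= => /I/df[]//.
by rewrite mul0r => /eqP; rewrite subr_eq0 => /eqP.
Qed.

Lemma cderiv0_const f (a b x y : R) : a < x < b -> a < y < b ->
  (forall z : R, a < z < b -> cderiv f 0 z) -> f x = f y.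
Proof.
move=> xab yab df; apply: cplx_ext.
- by apply: (rderiv0_const (f := fun v => RE (f v)) xab yab) => z /df[].
- by apply: (rderiv0_const (f := fun v => IM (f v)) xab yab) => z /df[].
Qed.

Definition W x th v : C := (x + v) +i* (th * (1 - expR (- v))).
Definition dW th v : C := 1 +i* (th * expR (- v)).

Lemma is_derive_expN1 v : is_derive v (1 : R) (fun v : R => expR (- v)) (- expR (- v)).
Proof.
apply: (is_derive_eq (rder_comp (rderN (is_derive_id v 1)) (is_derive_expR _))).
by rewrite mulrN1.
Qed.

Lemma W_deriv x th v : cderiv (W x th) (dW th v) v.
Proof.
split => /=.
- apply: (is_derive_eq (rderD (is_derive_cst x v 1) (is_derive_id v 1))).
  by rewrite add0r.
- apply: (is_derive_eq (rderM (is_derive_cst th v 1) (rderB (is_derive_cst (1 : R) v 1) (is_derive_expN1 v)))).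
  by rewrite mul0r add0r sub0r opprK.
Qed.

Lemma W_deriv1 x th v : cderiv (fun y => W y th v) 1 x.
Proof.
split => /=.
- apply: (is_derive_eq (rderD (is_derive_id x 1) (is_derive_cst v x 1))).
  by rewrite addr0.
- exact: is_derive_cst.
Qed.

Lemma dW_cont th v : ccont (dW th) v.
Proof.
split => /=; first exact: cst_continuous.
apply: continuousM; first exact: cst_continuous.
exact: (is_derive_cont (is_derive_expN1 v)).
Qed.

Lemma nrm_dW th v : 0 <= v -> nrm (dW th v) <= 1 + `|th|.
Proof.
move=> v0; apply: (le_trans (nrm_le_ReIm _)) => /=; rewrite normr1 lerD2l normrM.
by rewrite ler_piMr// ger0_norm ?expR_ge0// expR_le1 oppr_le0.
Qed.

Lemma W0 x th : W x th 0 = x%:C.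
Proof. by rewrite /W addr0 oppr0 expR0 subrr mulr0. Qed.

Definition ray (F : C -> C) x th := cint (fun v => F (W x th v) * dW th v).
Definition contour F x th := ray F x th - ray F x (- th).

Lemma ray_rapid F dF th x c e : 0 < e ->
  (forall v, 0 < v -> hol F (dF (W x th v)) (W x th v)) ->
  (forall v, 0 < v -> nrm (F (W x th v)) <= c * expR (- (e * v))) ->
  rapid (fun v => F (W x th v) * dW th v).
Proof.
move=> e0 hF Fb; split.
  move=> v v0; apply: ccontM; last exact: dW_cont.
  exact: (hol_comp_cont (hF _ v0) (W_deriv _ _ _)).
exists (c * (1 + `|th|)), e; split => // v v0.
rewrite nrmM mulrAC; apply: ler_pM; rewrite ?nrm_ge0 ?Fb//.
by rewrite nrm_dW// ltW.
Qed.

Lemma ray_exact F dF th x c e : 0 < e ->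
  (forall v, 0 <= v -> hol F (dF (W x th v)) (W x th v)) ->
  (forall v, 0 <= v -> ccont (fun u => dF (W x th u)) v) ->
  (forall v, 0 <= v -> nrm (F (W x th v)) <= c * expR (- (e * v))) ->
  (forall v, 0 <= v -> nrm (dF (W x th v)) <= c * expR (- (e * v))) ->
  ray dF x th = - F (x%:C).
Proof.
move=> e0 hF cF Fb dFb.
rewrite /ray (@cint_FTC _ (fun v => F (W x th v)) (c * (1 + `|th|)) e c e) ?W0//.
- by move=> v v0; apply: ccontM; [exact: cF|exact: dW_cont].
- move=> v v0; rewrite nrmM mulrAC; apply: ler_pM; rewrite ?nrm_ge0 ?dFb//.
  exact: nrm_dW.
- move=> v v0; exact: hF v0 _ _ _ erefl (W_deriv _ _ _).
Qed.

(** Translating the ray by dx and moving along it by dv both act through the derivative of F. The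
    x-derivative of the integrand is thus an exact v-derivative, and only the value at the start of
    the ray survives. *)
Lemma ray_deriv F dF th (a b x c e : R) : a < x < b -> 0 < e ->
  (forall y v, a < y < b -> 0 <= v -> hol F (dF (W y th v)) (W y th v)) ->
  (forall y v, a < y < b -> 0 <= v -> ccont (fun u => dF (W y th u)) v) ->
  (forall y v, a < y < b -> 0 <= v -> nrm (F (W y th v)) <= c * expR (- (e * v))) ->
  (forall y v, a < y < b -> 0 <= v -> nrm (dF (W y th v)) <= c * expR (- (e * v))) ->
  cderiv (fun y => ray F y th) (- F (x%:C)) x.
Proof.
move=> xab e0 hF cF Fb dFb.
have dFb' y v : a < y < b -> 0 <= v ->
    nrm (dF (W y th v) * dW th v) <= c * (1 + `|th|) * expR (- (e * v)).
  move=> yab v0; rewrite nrmM mulrAC; apply: ler_pM; rewrite ?nrm_ge0 ?dFb//.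
  exact: nrm_dW.
rewrite -(@ray_exact F dF th x c e) => // [|v v0|v v0|v v0|v v0];
  [|exact: hF|exact: cF|exact: Fb|exact: dFb].
apply: (cint_deriv (K := fun y v => F (W y th v) * dW th v)
  (dK := fun y v => dF (W y th v) * dW th v) xab _ e0).
- move=> y yab; apply: (@ray_rapid F dF _ _ c e) => // v /ltW v0; [exact: hF|exact: Fb].
- move=> y v yab /ltW v0.
  apply: (eq_cderiv (cderivM (hF _ _ yab v0 (fun u => W u th v) 1 y erefl (W_deriv1 y th v)) (cderiv_cst (dW th v) _))).
  by rewrite mulr1 mulr0 addr0.
- move=> y v yab /ltW v0; exact: dFb'.
Qed.

(** This stands in for Cauchy's theorem: the two rays leave from the same point, so their boundary
    terms cancel. *)
Lemma contour_const F dF th (a b x y c e : R) : a < x < b -> a < y < b -> 0 < e ->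
  (forall s y v, s = th \/ s = - th -> a < y < b -> 0 <= v ->
    [/\ hol F (dF (W y s v)) (W y s v), ccont (fun u => dF (W y s u)) v,
        nrm (F (W y s v)) <= c * expR (- (e * v)) &
        nrm (dF (W y s v)) <= c * expR (- (e * v))]) ->
  contour F x th = contour F y th.
Proof.
move=> xab yab e0 H.
apply: (cderiv0_const (f := fun y => contour F y th) xab yab) => z zab.
rewrite -(subrr (- F (z%:C))); apply: cderivB.
- apply: (@ray_deriv _ dF _ a b _ c e) => // w v wab v0;
    by have [] := H th w v (or_introl erefl) wab v0.
- apply: (@ray_deriv _ dF _ a b _ c e) => // w v wab v0;
    by have [] := H (- th) w v (or_intror erefl) wab v0.
Qed.

End ComplexIntegral.

(** * Hankel-type integrals in the logarithmic plane *)

Section HankelContour.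
Variable R : realType.
Local Notation C := R[i].
Implicit Types (G H : C -> C) (z w : C) (x v c e s : R).

Lemma reZ (b : R) w : RE (b%:C * w) = b * RE w.
Proof. by rewrite reM /= mul0r subr0. Qed.

Lemma imZ (b : R) w : IM (b%:C * w) = b * IM w.
Proof. by rewrite imM /= mul0r addr0. Qed.

(** Since e^v >= v^2 / 4, it is enough that c v^2 / 4 - (k + 1) v + (k + 1)^2 / c, a perfect square
    over c, is nonnegative. *)
Lemma exp_quad_bound c k : 0 < c -> exists2 M, 0 < M &
  forall v, 0 <= v -> expR (k * v - c * expR v) <= M * expR (- v).
Proof.
move=> c0; exists (expR ((k + 1) ^+ 2 / c)); first exact: expR_gt0.
move=> v v0; rewrite -expRD ler_expR.
have h : v ^+ 2 / 4 <= expR v.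
  have -> : expR v = expR (v / 2) ^+ 2 by rewrite -expRM_natl; congr expR; field.
  have -> : v ^+ 2 / 4 = (v / 2) ^+ 2 by field.
  rewrite ler_pXn2r ?nnegrE ?expR_ge0 ?divr_ge0//.
  by apply: le_trans (expR_ge1Dx _); rewrite lerDr.
have {}h : c * (v ^+ 2 / 4) <= c * expR v by rewrite ler_wpM2l// ltW.
have q : 0 <= (c * v / 2 - (k + 1)) ^+ 2 / c by rewrite divr_ge0 ?sqr_ge0// ltW.
have qE : (c * v / 2 - (k + 1)) ^+ 2 / c = c * (v ^+ 2 / 4) - (k + 1) * v + (k + 1) ^+ 2 / c.
  by field; rewrite gt_eqF.
rewrite qE in q; lra.
Qed.

Variable th : R.
Hypothesis th_gt : pi / 2 < th.
Hypothesis th_le : th <= pi.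

Lemma th_gt0 : 0 < th.
Proof. by apply: lt_trans th_gt; rewrite divr_gt0 ?pi_gt0. Qed.

Definition sgn s := s = th \/ s = - th.

Lemma sgn_norm s : sgn s -> `|s| = th.
Proof. by case=> ->; rewrite ?normrN ger0_norm// ltW// th_gt0. Qed.

Lemma angle_ge0 v : 0 <= v -> 0 <= 1 - expR (- v).
Proof. by move=> v0; rewrite subr_ge0 expR_le1 oppr_le0. Qed.

Lemma angle_le1 v : 1 - expR (- v) <= 1.
Proof. by rewrite gerBl expR_ge0. Qed.

Lemma angle_pi v : 0 <= v -> 0 <= th * (1 - expR (- v)) <= pi.
Proof.
move=> v0; rewrite mulr_ge0 ?angle_ge0 ?(ltW th_gt0)//=.
by apply: le_trans th_le; rewrite ler_piMr ?angle_le1// ltW ?th_gt0.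
Qed.

Lemma cos_angle_sgn s v : sgn s -> cos (s * (1 - expR (- v))) = cos (th * (1 - expR (- v))).
Proof. by case=> ->//; rewrite mulNr cosN. Qed.

Lemma cos_angle_lt0 : exists c v1, [/\ 0 < c, 0 <= v1 &
  forall v, v1 <= v -> cos (th * (1 - expR (- v))) <= - c].
Proof.
have t0 := th_gt0; have tg := th_gt; have p0 := pi_gt0 R.
(* [t'] lies halfway between pi / 2 and [th], and th (1 - q) = t'; the angle exceeds [t'] once e^-v
   <= q. *)
pose t' := (th + pi / 2) / 2; pose q := (th - pi / 2) / (2 * th).
have q0 : 0 < q by rewrite divr_gt0 ?subr_gt0// mulr_gt0.
have q1 : q <= 1.
  rewrite ler_pdivrMr ?mulr_gt0// mul1r; lra.
have I0 : 0 <= (pi : R) / 2 <= pi by apply/andP; split; lra.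
have I1 : 0 <= t' <= pi by apply/andP; split; rewrite /t'; move: th_le; lra.
exists (- cos t'), (- ln q); split.
- rewrite oppr_gt0 -(@cos_pihalf R) ltr_cos ?in_itv//= /t'; lra.
- by rewrite oppr_ge0; apply: ln_le0.
move=> v v1; rewrite opprK.
have v0 : 0 <= v by apply: le_trans v1; rewrite oppr_ge0; exact: ln_le0.
have := angle_pi v0 => Iv.
rewrite leNgt ltr_cos ?in_itv//= -leNgt.
have : expR (- v) <= q.
  by rewrite -(@lnK _ q) ?posrE// ler_expR lerNl.
move=> /(ler_wpM2l (ltW t0)).
have -> : th * q = (th - pi / 2) / 2 by rewrite /q; field; rewrite gt_eqF.
rewrite /t' mulrBr mulr1; lra.
Qed.

Definition kern w := cexp (cexp w).

Lemma nrm_kern x s v : sgn s ->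
  nrm (kern (W x s v)) = expR (expR (x + v) * cos (th * (1 - expR (- v)))).
Proof. by move=> hs; rewrite /kern nrm_cexp /= cos_angle_sgn. Qed.

Lemma kern_decay X k : exists2 M, 0 < M & forall x s v, sgn s -> `|x| <= X -> 0 <= v ->
  nrm (kern (W x s v)) * expR (k * v) <= M * expR (- (1 * v)).
Proof.
have [c [v1 [c0 v10 hc]]] := cos_angle_lt0.
pose c1 := c * expR (- X).
have c10 : 0 < c1 by rewrite mulr_gt0 ?expR_gt0.
(* Before [v1] the cosine may be positive: e^X e^v1 bounds the exponent there, and c1 e^v1 pays for
   the subtracted c1 e^v. *)
pose A := (expR X + c1) * expR v1.
have [M M0 hM] := exp_quad_bound k c10.
exists (expR A * M); first by rewrite mulr_gt0 ?expR_gt0.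
move=> x s v hs; rewrite ler_norml => /andP[xl xu] v0; rewrite nrm_kern// mul1r -mulrA.
apply: le_trans (ler_wpM2l (expR_ge0 A) (hM _ v0)).
rewrite -!expRD ler_expR.
suff : expR (x + v) * cos (th * (1 - expR (- v))) <= A - c1 * expR v by lra.
have [vv1|vv1] := lerP v1 v.
- have A0 : 0 <= A by rewrite mulr_ge0 ?addr_ge0 ?expR_ge0// ltW.
  have h1 := ler_wpM2l (expR_ge0 (x + v)) (hc _ vv1).
  apply: le_trans h1 _.
  suff : c1 * expR v <= expR (x + v) * c by lra.
  rewrite mulrC expRD (mulrC _ c) /c1 mulrA (mulrC _ c) -!mulrA ler_wpM2l ?(ltW c0)//.
  by rewrite mulrC ler_wpM2r ?expR_ge0// ler_expR.
- apply: (@le_trans _ _ (expR X * expR v1)).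
    apply: (@le_trans _ _ (expR (x + v))).
      by rewrite ler_piMr ?expR_ge0 ?cos_le1.
    by rewrite -expRD ler_expR lerD// ltW.
  rewrite /A mulrDl -addrA lerDl subr_ge0 ler_wpM2l ?(ltW c10)//.
  by rewrite ler_expR ltW.
Qed.

Lemma kern_hol w : hol (fun w => kern w) (cexp w * kern w) w.
Proof.
apply: eq_hol; first exact: (hol_exp (hol_exp (@hol_id _ w))).
by rewrite mul1r.
Qed.

Arguments kern_hol : clear implicits.

Definition pw (a : R) w := cexp (a%:C * w).

Lemma pw_hol a w : hol (pw a) (a%:C * pw a w) w.
Proof.
apply: eq_hol; first exact: (hol_exp (holM (@hol_cst _ a%:C w) (@hol_id _ w))).
by rewrite mul0r add0r mulr1.
Qed.

Arguments pw_hol : clear implicits.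

Lemma nrm_pw a w : nrm (pw a w) = expR (a * RE w).
Proof. by rewrite nrm_cexp reZ. Qed.

Lemma pwD a b w : pw (a + b) w = pw a w * pw b w.
Proof. by rewrite /pw rmorphD /= mulrDl cexpD. Qed.

Lemma pw0 w : pw 0 w = 1. Proof. by rewrite /pw mul0r cexp0. Qed.

Lemma pw1 w : pw 1 w = cexp w. Proof. by rewrite /pw mul1r. Qed.

Definition tame x G := forall s, sgn s ->
  (forall v, 0 < v -> ccont (fun v => G (W x s v)) v) /\
  exists K k, forall v, 0 < v -> nrm (G (W x s v)) <= K * expR (k * v).

Lemma hol_path_cont G dG x s v : hol G dG (W x s v) -> ccont (fun v => G (W x s v)) v.
Proof. by move=> h; exact: hol_comp_cont h (W_deriv _ _ _). Qed.

Lemma tame_bound x G s : tame x G -> sgn s -> exists K k, [/\ 0 <= K, 0 <= k &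
   forall v, 0 < v -> nrm (G (W x s v)) <= K * expR (k * v)].
Proof.
move=> h /h[_ [K [k b]]]; exists `|K|, `|k|; split => // v v0.
apply: (le_trans (b _ v0)); apply: (le_trans (ler_wpM2r (expR_ge0 _) (ler_norm K))).
by rewrite ler_wpM2l// ler_expR ler_wpM2r ?ler_norm// ltW.
Qed.

Lemma tame_cst x z : tame x (fun=> z).
Proof.
move=> s hs; split; first by move=> v _; exact: ccont_cst.
by exists (nrm z), 0 => v _; rewrite mul0r expR0 mulr1.
Qed.

Lemma tameD x G H : tame x G -> tame x H -> tame x (fun w => G w + H w).
Proof.
move=> hG hH s hs; split.
  by move=> v v0; apply: ccontD; [have [h _] := hG _ hs|have [h _] := hH _ hs]; exact: h.
have [K [k [K0 k0 b]]] := tame_bound hG hs; have [L [l [L0 l0 d]]] := tame_bound hH hs.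
exists (K + L), (k + l) => v v0.
rewrite (le_trans (ler_nrmD _ _))// mulrDl mulrDl expRD lerD//.
- apply: (le_trans (b _ v0)); rewrite mulrA ler_peMr ?mulr_ge0 ?expR_ge0//.
  by rewrite -expR0 ler_expR mulr_ge0// ltW.
- apply: (le_trans (d _ v0)); rewrite ler_wpM2l// ler_peMl ?expR_ge0//.
  by rewrite -expR0 ler_expR mulr_ge0// ltW.
Qed.

Lemma tameM x G H : tame x G -> tame x H -> tame x (fun w => G w * H w).
Proof.
move=> hG hH s hs; split.
  by move=> v v0; apply: ccontM; [have [h _] := hG _ hs|have [h _] := hH _ hs]; exact: h.
have [K [k [K0 k0 b]]] := tame_bound hG hs; have [L [l [L0 l0 d]]] := tame_bound hH hs.
exists (K * L), (k + l) => v v0.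
rewrite nrmM mulrDl expRD mulrACA; apply: ler_pM; rewrite ?nrm_ge0 ?b ?d//.
Qed.

Lemma tameN x G : tame x G -> tame x (fun w => - G w).
Proof.
move=> hG; have := tameM (tame_cst x (-1)) hG.
by have -> : (fun w => -1 * G w) = (fun w => - G w) by apply/funext => w; rewrite mulN1r.
Qed.

Lemma tame_pw x a : tame x (pw a).
Proof.
move=> s hs; split; first by move=> v _; exact: (hol_path_cont (pw_hol a (W x s v))).
exists (expR (a * x)), a => v _.
by rewrite nrm_pw /= -expRD -mulrDr.
Qed.

Lemma tameV x G d : 0 < d -> (forall s v, sgn s -> 0 <= v -> d <= nrm (G (W x s v))) ->
  (forall s v, sgn s -> 0 <= v -> exists dG, hol G dG (W x s v)) ->
  tame x (fun w => (G w)^-1).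
Proof.
move=> d0 hd hG s hs; split.
  move=> v /ltW v0; have [dG h] := hG s v hs v0.
  have G0 : G (W x s v) != 0 by rewrite -nrm_gt0 (lt_le_trans d0)// hd.
  exact: (hol_path_cont (holV G0 h)).
exists d^-1, 0 => v /ltW v0; rewrite mul0r expR0 mulr1 nrmV lef_pV2 ?hd// posrE//.
by rewrite (lt_le_trans d0)// hd.
Qed.

Lemma tame_rapid x G s : tame x G -> sgn s ->
  rapid (fun v => kern (W x s v) * G (W x s v) * dW s v).
Proof.
move=> hG hs; have [cG _] := hG _ hs; split.
  move=> v v0; apply: ccontM; last exact: dW_cont.
  by apply: ccontM; [exact: (hol_path_cont (kern_hol (W x s v)))|exact: cG].
have [K [k [K0 k0 b]]] := tame_bound hG hs.
have [M M0 hM] := kern_decay `|x| k.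
exists (M * K * (1 + `|s|)), 1; split => // v v0.
rewrite nrmM mulrAC; apply: ler_pM; [exact: nrm_ge0|exact: nrm_ge0| |exact/nrm_dW/ltW].
rewrite nrmM; apply: (le_trans (ler_wpM2l (nrm_ge0 _) (b _ v0))).
by rewrite mulrCA [M * K]mulrC -mulrA ler_wpM2l// hM// ltW.
Qed.

(** With zeta = e^w this is the integral of e^zeta G(ln zeta) dzeta / zeta, oriented from the lower
    end to the upper one. Because of the division by zeta, the power zeta^-a appears as
    [pw (1 - a)]. *)
Definition hk G x := contour (fun w => kern w * G w) x th.

Lemma eq_hk x G H : (forall s v, sgn s -> 0 < v -> G (W x s v) = H (W x s v)) ->
  hk G x = hk H x.
Proof.
move=> GH; rewrite /hk /contour /ray.
by congr (_ - _); apply: eq_cint => v v0; rewrite GH//; [left|right].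
Qed.

Lemma hkD x G H : tame x G -> tame x H -> hk (fun w => G w + H w) x = hk G x + hk H x.
Proof.
move=> hG hH; rewrite /hk /contour /ray.
have E s : sgn s -> cint (fun v => kern (W x s v) * (G (W x s v) + H (W x s v)) * dW s v) =
    cint (fun v => kern (W x s v) * G (W x s v) * dW s v) +
    cint (fun v => kern (W x s v) * H (W x s v) * dW s v).
  move=> hs; rewrite -cintD; try exact: tame_rapid.
  by apply: eq_cint => v _; ring.
rewrite !E; [ring|by right|by left].
Qed.

Lemma hkZ x z G : tame x G -> hk (fun w => z * G w) x = z * hk G x.
Proof.
move=> hG; rewrite /hk /contour /ray.
have E s : sgn s -> cint (fun v => kern (W x s v) * (z * G (W x s v)) * dW s v) =
    z * cint (fun v => kern (W x s v) * G (W x s v) * dW s v).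
  move=> hs; rewrite -cintM; try exact: tame_rapid.
  by apply: eq_cint => v _; ring.
rewrite !E; [ring|by right|by left].
Qed.

Lemma hkN x G : tame x G -> hk (fun w => - G w) x = - hk G x.
Proof.
by move=> hG; rewrite -mulN1r -hkZ//; apply: eq_hk => s v _ _; rewrite mulN1r.
Qed.

(** [M] is chosen before [G] and the bound is linear in [K]. It therefore serves for remainders
    tending to 0 and for Lipschitz constants alike. The factor 4 counts two rays, each with a real
    and an imaginary part. *)
Lemma hk_bound x k : exists2 M, 0 < M & forall G K, tame x G ->
  (forall s v, sgn s -> 0 < v -> nrm (G (W x s v)) <= K * expR (k * v)) ->
  nrm (hk G x) <= M * K.
Proof.
have [M M0 hM] := kern_decay `|x| k.
exists (4 * (M * (1 + th))); first by rewrite !mulr_gt0 ?addr_gt0 ?th_gt0.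
move=> G K hG b.
have E s : sgn s -> nrm (cint (fun v => kern (W x s v) * G (W x s v) * dW s v)) <=
    2 * (M * (1 + th)) * K.
  move=> hs.
  apply: (@le_trans _ _ (M * (1 + th) * K / 1 + M * (1 + th) * K / 1)); last by lra.
  apply: (cint_bound _ ltr01); first by case: (tame_rapid hG hs).
  move=> v v0.
  have -> : M * (1 + th) * K * expR (- (1 * v)) = M * K * expR (- (1 * v)) * (1 + `|s|).
    by rewrite sgn_norm//; ring.
  rewrite nrmM; apply: ler_pM; [exact: nrm_ge0|exact: nrm_ge0| |exact/nrm_dW/ltW].
  rewrite nrmM; apply: (le_trans (ler_wpM2l (nrm_ge0 _) (b _ _ hs v0))).
  have K0 : 0 <= K.
    by have := le_trans (nrm_ge0 _) (b _ _ hs v0); rewrite pmulr_lge0 ?expR_gt0.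
  by rewrite mulrCA [M * K]mulrC -mulrA ler_wpM2l// hM// ltW.
apply: (le_trans (ler_nrmB _ _)).
apply: (le_trans (lerD (E _ (or_introl erefl)) (E _ (or_intror erefl)))).
by rewrite -mulrDl -mulrDl; rewrite -natrD.
Qed.

(** Unlike [tame], uniform in the starting point, as differentiation under the integral in x
    demands, and including v = 0, where the boundary term is read. *)
Definition moderate X G := exists K k, [/\ 0 <= K, 0 <= k &
  forall x s v, `|x| < X -> sgn s -> 0 <= v -> nrm (G (W x s v)) <= K * expR (k * v)].

Lemma moderateM X G H : moderate X G -> moderate X H -> moderate X (fun w => G w * H w).
Proof.
move=> [K [k [K0 k0 b]]] [L [l [L0 l0 d]]]; exists (K * L), (k + l).
split; rewrite ?mulr_ge0 ?addr_ge0// => x s v xX hs v0.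
by rewrite nrmM mulrDl expRD mulrACA; apply: ler_pM; rewrite ?nrm_ge0 ?b ?d.
Qed.

Lemma moderateD X G H : moderate X G -> moderate X H -> moderate X (fun w => G w + H w).
Proof.
move=> [K [k [K0 k0 b]]] [L [l [L0 l0 d]]]; exists (K + L), (k + l).
split; rewrite ?addr_ge0// => x s v xX hs v0.
rewrite (le_trans (ler_nrmD _ _))// mulrDl mulrDl expRD lerD//.
- apply: (le_trans (b _ _ _ xX hs v0)); rewrite mulrA ler_peMr ?mulr_ge0 ?expR_ge0//.
  by rewrite -expR0 ler_expR mulr_ge0.
- apply: (le_trans (d _ _ _ xX hs v0)); rewrite ler_wpM2l// ler_peMl ?expR_ge0//.
  by rewrite -expR0 ler_expR mulr_ge0.
Qed.

Lemma moderate_cst X z : moderate X (fun=> z).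
Proof.
exists (nrm z), 0; split; rewrite ?nrm_ge0// => x s v _ _ _.
by rewrite mul0r expR0 mulr1.
Qed.

Lemma moderate_pw X a : moderate X (pw a).
Proof.
exists (expR (`|a| * X)), `|a|; split; rewrite ?expR_ge0// => x s v xX hs v0.
rewrite nrm_pw /= -expRD -mulrDr ler_expR.
apply: (le_trans (ler_norm _)); rewrite normrM ler_wpM2l//.
by rewrite (le_trans (ler_normD _ _))// lerD ?(ltW xX)// ger0_norm.
Qed.

Definition adm X G dG := [/\ (forall x s v, `|x| < X -> sgn s -> 0 <= v ->
   hol G (dG (W x s v)) (W x s v) /\ ccont (fun u => dG (W x s u)) v),
   moderate X G & moderate X dG].

Lemma adm_pw X a : adm X (pw a) (fun w => a%:C * pw a w).
Proof.
split; [|exact: moderate_pw|by apply: moderateM; [exact: moderate_cst|exact: moderate_pw]].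
move=> x s v _ _ _; split; first exact: pw_hol.
by apply: ccontM; [exact: ccont_cst|exact: (hol_path_cont (pw_hol a (W x s v)))].
Qed.

Lemma adm_M X G dG H dH : adm X G dG -> adm X H dH ->
  adm X (fun w => G w * H w) (fun w => dG w * H w + G w * dH w).
Proof.
move=> [G1 G2 G3] [H1 H2 H3]; split.
- move=> x s v xX hs v0; have [a b] := G1 _ _ _ xX hs v0; have [c d] := H1 _ _ _ xX hs v0.
  split; first exact: holM.
  by apply: ccontD; apply: ccontM => //; [exact: (hol_path_cont c)|exact: (hol_path_cont a)].
- exact: moderateM.
- by apply: moderateD; apply: moderateM.
Qed.

Lemma adm_inv X G dG d : 0 < d ->
  (forall x s v, `|x| < X -> sgn s -> 0 <= v -> d <= nrm (G (W x s v))) ->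
  adm X G dG -> adm X (fun w => (G w)^-1) (fun w => - dG w / G w ^+ 2).
Proof.
move=> d0 hd [G1 G2 G3].
have G0 x s v : `|x| < X -> sgn s -> 0 <= v -> G (W x s v) != 0.
  by move=> xX hs v0; rewrite -nrm_gt0 (lt_le_trans d0)// hd.
have mV : moderate X (fun w => (G w)^-1).
  exists d^-1, 0; split => //; first by rewrite invr_ge0 ltW.
  move=> x s v xX hs v0.
  rewrite mul0r expR0 mulr1 nrmV lef_pV2 ?hd// posrE//.
  by rewrite (lt_le_trans d0)// hd.
split; [|exact: mV|].
- move=> x s v xX hs v0; have [a b] := G1 _ _ _ xX hs v0.
  have hV := holV (G0 _ _ _ xX hs v0) a.
  split; first exact: hV.
  have cV := hol_path_cont hV.
  rewrite (_ : (fun u => _) = (fun u => -1 * dG (W x s u) * ((G (W x s u))^-1 * (G (W x s u))^-1))).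
    exact: (ccontM (ccontM (ccont_cst _ _) b) (ccontM cV cV)).
  by apply/funext => u; rewrite mulN1r expr2 invfM.
- rewrite (_ : (fun w => - dG w / G w ^+ 2) = (fun w => -1 * dG w * ((G w)^-1 * (G w)^-1))).
    by apply: moderateM; apply: moderateM => //; exact: moderate_cst.
  by apply/funext => u; rewrite mulN1r expr2 invfM.
Qed.

Lemma adm_kern X G dG : adm X G dG -> exists c, forall s y v, sgn s -> `|y| < X -> 0 <= v ->
  let F w := kern w * G w in let dF w := kern w * (cexp w * G w + dG w) in
  [/\ hol F (dF (W y s v)) (W y s v), ccont (fun u => dF (W y s u)) v,
    nrm (F (W y s v)) <= c * expR (- (1 * v)) & nrm (dF (W y s v)) <= c * expR (- (1 * v))].
Proof.
move=> [G1 G2 G3].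
have mE : moderate X (fun w => cexp w).
  by have := moderate_pw X 1; rewrite (_ : pw 1 = fun w => cexp w)//; apply/funext => w; exact: pw1.
have [K [k [K0 k0 b]]] := G2.
have [L [l [L0 l0 d]]] := moderateD (moderateM mE G2) G3.
have [M M0 hM] := kern_decay X (k + l).
have bd T (K' k' : R) x' s' v' : 0 <= K' -> k' <= k + l -> K' <= K + L ->
    `|x'| < X -> sgn s' -> 0 <= v' -> nrm T <= K' * expR (k' * v') ->
    nrm (kern (W x' s' v') * T) <= (K + L) * M * expR (- (1 * v')).
  move=> K'0 kk KK xX' hs v0 hT; rewrite nrmM.
  apply: (le_trans (ler_wpM2l (nrm_ge0 _) hT)).
  rewrite mulrCA -mulrA; apply: ler_pM => //; first by rewrite mulr_ge0 ?nrm_ge0 ?expR_ge0.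
  apply: le_trans (hM _ _ _ hs (ltW xX') v0).
  by rewrite ler_wpM2l ?nrm_ge0// ler_expR ler_wpM2r.
exists ((K + L) * M) => s z v hs zX v0; have [g1 g2] := G1 _ _ _ zX hs v0.
split.
- apply: (eq_hol (holM (kern_hol (W z s v)) g1)).
  by rewrite mulrDr mulrA (mulrC (cexp _)).
- apply: ccontM; first exact: (hol_path_cont (kern_hol (W z s v))).
  apply: ccontD => //; apply: ccontM; last exact: (hol_path_cont g1).
  exact: (hol_path_cont (hol_exp (@hol_id _ (W z s v)))).
- by apply: (bd _ K k) => //; rewrite ?lerDl// b.
- by apply: (bd _ L l) => //; rewrite ?lerDr// d.
Qed.

Lemma hk_const X G dG x y : adm X G dG -> `|x| < X -> `|y| < X -> hk G x = hk G y.
Proof.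
move=> /adm_kern[c H] xX yX.
have I (z : R) : (- X < z < X) = (`|z| < X) by rewrite ltr_norml.
apply: (@contour_const _ _ (fun w => kern w * (cexp w * G w + dG w)) th (- X) X x y c 1 _ _ ltr01).
- by rewrite I.
- by rewrite I.
- by move=> s z v hs; rewrite I => zX v0; exact: H.
Qed.

(** Multiplied by [kern w], the integrand is the derivative of [kern w * G w]; this is integration
    by parts against e^zeta. *)
Lemma hk_exact X G dG x : adm X G dG -> `|x| < X -> hk (fun w => cexp w * G w + dG w) x = 0.
Proof.
move=> /adm_kern[c H] xX.
have E s : sgn s -> ray (fun w => kern w * (cexp w * G w + dG w)) x s = - (kern x%:C * G x%:C).
  move=> hs.
  apply: (@ray_exact _ (fun w => kern w * G w) _ s x c 1 ltr01) => v v0;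
    have [h1 h2 h3 h4] := H s x v hs xX v0; [exact: h1|exact: h2|exact: h3|exact: h4].
by rewrite /hk /contour !E ?subrr//; [right|left].
Qed.

Lemma adm_tame X G dG x : adm X G dG -> `|x| < X -> tame x G.
Proof.
move=> [G1 [K [k [K0 k0 b]]] _] xX s hs; split.
  by move=> v /ltW v0; have [h _] := G1 _ _ _ xX hs v0; exact: hol_path_cont h.
by exists K, k => v /ltW v0; exact: b.
Qed.

(** Hankel's integral for 2 pi i / Gamma(a). It makes sense for every real a, including a <= 0,
    where Euler's integral diverges. *)
Definition HH a := hk (pw (1 - a)) 0.

Lemma HHE a x : hk (pw (1 - a)) x = HH a.
Proof.
apply: (@hk_const (`|x| + 1) _ _ _ _ (adm_pw _ _)); rewrite ?normr0 ltr_pwDr//.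
Qed.

(** The functional equation 1 / Gamma(a) = a / Gamma(a + 1), obtained from the exactness of e^zeta
    zeta^-a. *)
Lemma HH_rec a : HH a = a%:C * HH (a + 1).
Proof.
have T b : tame 0 (pw b) by exact: tame_pw.
have := @hk_exact 1 _ _ 0 (adm_pw 1 (- a)); rewrite normr0 => /(_ ltr01).
rewrite (@eq_hk _ _ (fun w => pw (1 - a) w + (- a)%:C * pw (- a) w)); last first.
  by move=> s v _ _; rewrite -pw1 -pwD.
rewrite hkD; [|exact: T|exact: (tameM (tame_cst _ _) (T _))].
rewrite hkZ// /HH => /eqP; rewrite addr_eq0 => /eqP ->.
have -> : 1 - (a + 1) = - a by ring.
by rewrite rmorphN mulNr opprK.
Qed.

Lemma HH0 : HH 0 = 0.
Proof. by rewrite HH_rec mul0r. Qed.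

End HankelContour.

Arguments pw_hol {R} a w.
Arguments kern_hol {R} w.

(** * The residue at a simple pole *)

Section Residue.
Variable R : realType.
Local Notation C := R[i].
Implicit Types (G H : C -> C) (z w : C) (x v c e s : R).
Variable th : R.
Hypothesis th_gt : pi / 2 < th.
Hypothesis th_le : th <= pi.
Local Notation sgn := (sgn th).

(** The form zeta^-a / (1 - zeta) dzeta in the variable w. On the contours used, its only pole is
    the starting point w = 0. *)
Definition FA a w : C := pw (1 - a) w / (1 - cexp w).
Definition dFA a w : C := (1 - a)%:C * pw (1 - a) w / (1 - cexp w) +
  pw (1 - a) w * (cexp w / (1 - cexp w) ^+ 2).

Lemma FA_hol a w : 1 - cexp w != 0 -> hol (FA a) (dFA a w) w.
Proof.
move=> w0.
have h : hol (fun w => 1 - cexp w) (0 - 1 * cexp w) w.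
  by apply: holD; [exact: hol_cst|apply: holN; exact: (hol_exp (@hol_id _ w))].
refine (eq_hol (holM (pw_hol (1 - a) w) (holV (F := fun w => 1 - cexp w) w0 h)) _).
by rewrite /dFA sub0r opprK mul1r.
Qed.

(** The law of cosines. The two nonnegative terms separate the two ways of staying away from 1:
    through the modulus and through the angle. *)
Lemma nrm_cexpB1 w : nrm (cexp w - 1) ^+ 2 =
  (expR (RE w) - 1) ^+ 2 + 2 * expR (RE w) * (1 - cos (IM w)).
Proof.
rewrite sqnrm !reimE /= oppr0 addr0.
have := cos2Dsin2 (IM w).
set c := cos _; set s := sin _ => h.
have -> : (expR (RE w) * s) ^+ 2 = expR (RE w) ^+ 2 * (1 - c ^+ 2).
  by rewrite exprMn -h; ring.
ring.
Qed.

Lemma nrm_1Bcexp w : nrm (1 - cexp w) = nrm (cexp w - 1).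
Proof. by rewrite -nrmN opprB. Qed.

Lemma nrm_1Bcexp_ge w : expR (RE w) - 1 <= nrm (1 - cexp w).
Proof.
rewrite nrm_1Bcexp; apply: le_trans (nrm_sub_ge _ _).
by rewrite nrm_cexp Normc.normc1.
Qed.

Lemma nrm_1Bcexp_ge' w : 1 - expR (RE w) <= nrm (1 - cexp w).
Proof. by apply: le_trans (nrm_sub_ge _ _); rewrite nrm_cexp Normc.normc1. Qed.

Lemma cos_angle_lt1 v : 0 < v -> cos (th * (1 - expR (- v))) < 1.
Proof.
move=> v0; rewrite -[ltRHS](@cos0 R) ltr_cos.
- have h : expR (- v) < 1 by rewrite expR_lt1 oppr_lt0.
  by apply: mulr_gt0; [exact: th_gt0 th_gt|rewrite subr_gt0].
- by rewrite in_itv /= lexx pi_ge0.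
- by rewrite in_itv /=; apply: angle_pi => //; exact: ltW.
Qed.

Lemma one_sub_neq0 x s v : sgn s -> 0 < v -> 1 - cexp (W x s v) != 0.
Proof.
move=> hs v0; apply/eqP => h.
have := nrm_cexpB1 (W x s v); rewrite -nrm_1Bcexp h Normc.normc0 expr0n /= (cos_angle_sgn _ hs).
apply/eqP; rewrite lt_eqF//.
by rewrite ltr_pwDr ?sqr_ge0// !mulr_gt0 ?expR_gt0// subr_gt0 cos_angle_lt1.
Qed.

(** To the right of the pole the modulus of e^w exceeds 1 throughout. To the left it stays below 1
    until v = - hi / 2, and by then the angle has opened enough for the cosine term to take over. *)
Lemma one_sub_lower lo hi : lo < hi -> hi < 0 \/ 0 < lo ->
  exists2 c, 0 < c & forall x s v, lo < x < hi -> sgn s -> 0 <= v ->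
    c * expR v <= nrm (1 - cexp (W x s v)).
Proof.
move=> lohi [hi0|lo0]; last first.
  exists (1 - expR (- lo)); first by rewrite subr_gt0 expR_lt1 oppr_lt0.
  move=> x s v /andP[lx _] hs v0; apply: le_trans (nrm_1Bcexp_ge _) => /=.
  have h1 : 1 <= expR (- lo) * expR (x + v).
    by rewrite -expRD -[leLHS](@expR0 R) ler_expR; lra.
  have h2 : expR v <= expR (x + v) by rewrite ler_expR; lra.
  have h3 : 0 <= 1 - expR (- lo) by rewrite subr_ge0 expR_le1; lra.
  have := ler_wpM2l h3 h2; lra.
pose d1 := 1 - expR (hi / 2).
have d10 : 0 < d1 by rewrite subr_gt0 expR_lt1; lra.
pose q := Num.min (1 - cos (th * (1 - expR (- (- hi / 2))))) 1.
have q0 : 0 < q by rewrite lt_min ltr01 andbT subr_gt0 cos_angle_lt1//; lra.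
have q1 : q <= 1 by rewrite ge_min lexx orbT.
pose c := Num.min (d1 * expR (hi / 2)) (Num.sqrt q * expR lo).
exists c; first by rewrite lt_min !mulr_gt0 ?expR_gt0 ?sqrtr_gt0.
move=> x s v /andP[lx xh] hs v0.
have [vh|vh] := lerP v (- hi / 2).
  apply: le_trans (nrm_1Bcexp_ge' _) => /=.
  apply: (@le_trans _ _ d1); last by rewrite lerD2l lerN2 ler_expR; lra.
  apply: (@le_trans _ _ (d1 * expR (hi / 2) * expR v)).
    by rewrite ler_wpM2r ?expR_ge0// ge_min lexx.
  by rewrite -mulrA ler_piMr ?(ltW d10)// -expRD expR_le1; lra.
apply: (@le_trans _ _ (Num.sqrt q * expR lo * expR v)).
  by rewrite ler_wpM2r ?expR_ge0// ge_min lexx orbT.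
rewrite -(@ler_pXn2r _ 2) ?nnegrE ?nrm_ge0 ?mulr_ge0 ?sqrtr_ge0 ?expR_ge0//.
rewrite !exprMn sqr_sqrtr ?(ltW q0)// nrm_1Bcexp nrm_cexpB1 /= (cos_angle_sgn _ hs).
have hc : cos (th * (1 - expR (- v))) <= 1 - q.
  apply: (@le_trans _ _ (cos (th * (1 - expR (- (- hi / 2)))))); last first.
    by rewrite lerBrDl -lerBrDr ge_min lexx.
  rewrite leNgt ltr_cos ?in_itv /=; try (apply: angle_pi => //; lra).
  rewrite -leNgt ler_wpM2l ?(ltW (th_gt0 th_gt))// lerD2l lerN2 ler_expR; lra.
have hu : expR lo * expR v <= expR (x + v) by rewrite -expRD ler_expR; lra.
have hu2 : (expR lo * expR v) ^+ 2 <= expR (x + v) ^+ 2.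
  by rewrite ler_pXn2r ?nnegrE ?mulr_ge0 ?expR_ge0.
have {}hu2 := ler_wpM2l (ltW q0) hu2.
rewrite -mulrA -exprMn; apply: (le_trans hu2).
(* With u = e^(x + v) and q <= 1: (u - 1)^2 + 2 u q >= q ((u - 1)^2 + 2 u) >= q u^2. *)
have u0 : 0 <= 2 * expR (x + v) by rewrite mulr_ge0 ?expR_ge0.
have hc2 : q <= 1 - cos (th * (1 - expR (- v))) by lra.
have := ler_wpM2l u0 hc2.
have := mulr_ge0 (ltW q0) (sqr_ge0 (expR (x + v))).
have q1' : 0 <= 1 - q by rewrite subr_ge0.
have := mulr_ge0 q1' (sqr_ge0 (expR (x + v) - 1)).
set u := expR (x + v); set k := cos _; move=> h1 h2 h3; nra.
Qed.

Lemma FA_bound a lo hi : lo < hi -> hi < 0 \/ 0 < lo ->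
  exists c, forall x s v, lo < x < hi -> sgn s -> 0 <= v ->
    nrm (FA a (W x s v)) <= c * expR (- (a * v)) /\
    nrm (dFA a (W x s v)) <= c * expR (- (a * v)).
Proof.
move=> lohi hlh; have [c c0 hc] := one_sub_lower lohi hlh.
pose X := `|lo| + `|hi|.
pose P (k : R) := expR (`|k| * X).
have hP (k x v : R) : lo < x < hi -> expR (k * (x + v)) <= P k * expR (k * v).
  move=> /andP[lx xh]; rewrite mulrDr expRD ler_wpM2r ?expR_ge0// ler_expR.
  apply: (le_trans (ler_norm _)); rewrite normrM ler_wpM2l//.
  rewrite ler_norml /X; have := ler_norm hi; have := ler_norm (- lo).
  by rewrite normrN; have := normr_ge0 lo; have := normr_ge0 hi => *; apply/andP; split; lra.
have B x s v : lo < x < hi -> sgn s -> 0 <= v ->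
    nrm (FA a (W x s v)) <= P (1 - a) / c * expR (- (a * v)).
  move=> xI hs v0; rewrite /FA nrmM nrmV nrm_pw.
  have h := hc _ _ _ xI hs v0.
  have cv : 0 < c * expR v by rewrite mulr_gt0 ?expR_gt0.
  apply: (@le_trans _ _ (P (1 - a) * expR ((1 - a) * v) / (c * expR v))).
    apply: ler_pM; rewrite ?expR_ge0 ?invr_ge0 ?nrm_ge0 ?hP//.
    by rewrite lef_pV2 ?posrE// (lt_le_trans cv).
  have -> : (1 - a) * v = - (a * v) + v by ring.
  rewrite expRD le_eqVlt; apply/orP; left; apply/eqP; field.
  by rewrite !gt_eqF ?expR_gt0.
exists (P (1 - a) / c + (`|1 - a| * (P (1 - a) / c) + P (2 - a) / c ^+ 2)) => x s v xI hs v0.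
have Pc (k : R) : 0 <= P k / c by rewrite divr_ge0 ?expR_ge0// ltW.
have Pc2 (k : R) : 0 <= P k / c ^+ 2 by rewrite divr_ge0 ?expR_ge0 ?exprn_ge0// ltW.
split.
  apply: (le_trans (B _ _ _ xI hs v0)); rewrite ler_wpM2r ?expR_ge0// lerDl.
  by apply: addr_ge0 => //; exact: mulr_ge0.
apply: (le_trans (ler_nrmD _ _)).
rewrite mulrDl; apply: ler_wpDl; first by rewrite mulr_ge0 ?expR_ge0.
rewrite mulrDl; apply: lerD.
  by rewrite -mulrA nrmM nrmC -mulrA ler_wpM2l// B.
have h := hc _ _ _ xI hs v0.
have cv : 0 < c * expR v by rewrite mulr_gt0 ?expR_gt0.
rewrite nrmM nrm_pw nrmM nrmV nrmX nrm_cexp mulrA -expRD.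
apply: (@le_trans _ _ (P (2 - a) * expR ((2 - a) * v) / (c * expR v) ^+ 2)).
  apply: ler_pM; rewrite ?expR_ge0 ?invr_ge0 ?exprn_ge0 ?nrm_ge0//.
    by have := hP (2 - a) _ v xI; congr (expR _ <= _) => /=; ring.
  rewrite lef_pV2 ?posrE ?exprn_gt0// ?(lt_le_trans cv)//.
  by rewrite ler_pXn2r ?nnegrE ?nrm_ge0// ltW.
have -> : (2 - a) * v = - (a * v) + v + v by ring.
rewrite !expRD le_eqVlt; apply/orP; left; apply/eqP; field.
by rewrite !gt_eqF ?expR_gt0.
Qed.

Lemma one_sub_neq0_off lo hi x s v : lo < hi -> hi < 0 \/ 0 < lo -> lo < x < hi -> sgn s -> 0 <= v ->
  1 - cexp (W x s v) != 0.
Proof.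
move=> lohi hlh xI hs v0; have [c c0 hc] := one_sub_lower lohi hlh.
by rewrite -nrm_gt0 (lt_le_trans _ (hc _ _ _ xI hs v0))// mulr_gt0 ?expR_gt0.
Qed.

Lemma FA_props a lo hi : lo < hi -> hi < 0 \/ 0 < lo ->
  exists c, forall s y v, sgn s -> lo < y < hi -> 0 <= v ->
    [/\ hol (FA a) (dFA a (W y s v)) (W y s v), ccont (fun u => dFA a (W y s u)) v,
        nrm (FA a (W y s v)) <= c * expR (- (a * v)) &
        nrm (dFA a (W y s v)) <= c * expR (- (a * v))].
Proof.
move=> lohi hlh; have [c hc] := FA_bound a lohi hlh; exists c => s y v hs yI v0.
have w0 := one_sub_neq0_off lohi hlh yI hs v0.
have [b1 b2] := hc _ _ _ yI hs v0; split; [exact: FA_hol| |exact: b1|exact: b2].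
have h1 := hol_path_cont (FA_hol a w0).
have h2 := hol_path_cont (hol_exp (@hol_id _ (W y s v))).
have h3 := hol_path_cont (FA_hol 1 w0).
(* As [FA 1] is 1 / (1 - e^w), the derivative is a polynomial in functions already known to be
   continuous. *)
have E : (fun u => dFA a (W y s u)) = (fun u => (1 - a)%:C * FA a (W y s u) +
    FA a (W y s u) * (cexp (W y s u) * FA 1 (W y s u))).
  apply/funext => u; rewrite /dFA /FA subrr pw0 div1r expr2 invfM.
  set A := pw _ _; set B := (1 - cexp _)^-1; set D := cexp _; ring.
rewrite E; exact: (ccontD (ccontM (ccont_cst _ _) h1) (ccontM h1 (ccontM h2 h3))).
Qed.

Lemma FA_const a lo hi x y : 0 < a -> hi < 0 \/ 0 < lo -> lo < x < hi -> lo < y < hi ->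
  contour (FA a) x th = contour (FA a) y th.
Proof.
move=> a0 hlh xI yI.
have lohi : lo < hi by move: xI => /andP[] /lt_trans; apply.
have [c hc] := FA_props a lohi hlh.
by apply: (@contour_const _ _ (dFA a) th lo hi x y c a) => // s z v hs zI v0; exact: hc.
Qed.

Lemma FA_rapid a x s : 0 < a -> x != 0 -> sgn s ->
  rapid (fun v => FA a (W x s v) * dW s v).
Proof.
move=> a0 x0 hs.
have [lo [hi [hlh xI]]] : exists lo hi, (hi < 0 \/ 0 < lo) /\ lo < x < hi.
  have [xn|xp|xe] := ltgtP x 0.
  - by exists (x - 1), (x / 2); split; [left; lra|apply/andP; split; lra].
  - by exists (x / 2), (x + 1); split; [right; lra|apply/andP; split; lra].
  - by rewrite xe eqxx in x0.
have lohi : lo < hi by move: xI => /andP[] /lt_trans; apply.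
have [c hc] := FA_props a lohi hlh.
by apply: (@ray_rapid _ _ (dFA a) s x c a) => // v /ltW v0; have [] := hc s x v hs xI v0.
Qed.

(** To the right of the pole the contour can be pushed to infinity: the integral does not change,
    while it is bounded by a multiple of e^(- a y) at the start y. *)
Lemma FA_right a x : 0 < a -> 0 < x -> contour (FA a) x th = 0.
Proof.
move=> a0 x0; apply/eqP; rewrite -nrm_eq0; apply/eqP/le_anti; rewrite nrm_ge0 andbT.
pose K := 8 * (1 + th) / a.
have K0 : 0 < K.
  by rewrite divr_gt0// mulr_gt0// addr_gt0// (th_gt0 th_gt).
have B y : 1 <= y -> nrm (contour (FA a) x th) <= K * expR (- (a * y)).
  move=> y1.
  have -> : contour (FA a) x th = contour (FA a) y th.
    apply: (@FA_const a (Num.min x 1 / 2) (x + y)) => //.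
    - by right; rewrite divr_gt0// lt_min x0 ltr01.
    - apply/andP; split; last by lra.
      by apply: (@le_lt_trans _ _ (x / 2)); [rewrite ler_wpM2r ?ge_min ?lexx|lra].
    - apply/andP; split; last by lra.
      by apply: (@le_lt_trans _ _ (1 / 2)); [rewrite ler_wpM2r ?ge_min ?lexx ?orbT|lra].
  have E s : sgn s -> nrm (ray (FA a) y s) <= K / 2 * expR (- (a * y)).
    move=> hs.
    have y0 : y != 0 by rewrite gt_eqF// (lt_le_trans ltr01).
    apply: (@le_trans _ _ (2 * expR (- (a * y)) * (1 + th) / a + 2 * expR (- (a * y)) * (1 + th) / a)).
      apply: (cint_bound _ a0); first by case: (FA_rapid a0 y0 hs).
      move=> v v0; rewrite nrmM mulrAC -[in leRHS](sgn_norm th_gt hs).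
      apply: ler_pM; rewrite ?nrm_ge0 ?nrm_dW ?(ltW v0)//.
      rewrite /FA nrmM nrmV nrm_pw /=.
      have e2 : 2 <= expR (y + v).
        by apply: le_trans (expR_ge1Dx _); lra.
      have h : expR (y + v) / 2 <= nrm (1 - cexp (W y s v)).
        by apply: le_trans (nrm_1Bcexp_ge _) => /=; lra.
      have p0 : 0 < expR (y + v) / 2 by rewrite divr_gt0 ?expR_gt0.
      apply: (@le_trans _ _ (expR ((1 - a) * (y + v)) / (expR (y + v) / 2))).
        by rewrite ler_wpM2l ?expR_ge0// lef_pV2 ?posrE// (lt_le_trans p0).
      have -> : (1 - a) * (y + v) = - (a * y) + (- (a * v)) + (y + v) by ring.
      rewrite 2!expRD le_eqVlt; apply/orP; left; apply/eqP; field.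
      by rewrite gt_eqF ?expR_gt0.
    by rewrite le_eqVlt; apply/orP; left; apply/eqP; rewrite /K; field; rewrite gt_eqF.
  apply: (le_trans (ler_nrmB _ _)).
  apply: (le_trans (lerD (E _ (or_introl erefl)) (E _ (or_intror erefl)))).
  by rewrite -mulrDl -splitr.
rewrite leNgt; apply/negP => n0.
set r := nrm _ in B n0.
have ar : 0 < a * r by rewrite mulr_gt0.
(* At y = K / (a r) + 1 the bound e^(- a y) < 1 / (a y) already gives K e^(- a y) < r. *)
have y1 : 1 <= K / (a * r) + 1 by rewrite lerDr divr_ge0// ltW.
have := B _ y1.
set y := K / (a * r) + 1.
have ay : 0 < a * y by rewrite mulr_gt0// (lt_le_trans ltr01).
have h : expR (- (a * y)) < (a * y)^-1.
  rewrite expRN ltf_pV2 ?posrE ?expR_gt0//.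
  by apply: lt_le_trans (expR_ge1Dx _); rewrite ltrDr.
move=> h2.
have : r < K * (a * y)^-1 by apply: (le_lt_trans h2); rewrite ltr_pM2l.
rewrite ltr_pdivlMr// mulrA => h3.
have : r * a * y = K + a * r by rewrite /y; field; rewrite !gt_eqF.
by move: h3 => /[swap] ->; rewrite ltNge lerDl ltW.
Qed.

End Residue.

(** * Cancelling the pole: to its left the contour integral does not depend on a in ]0, 1] *)

Section ResidueLeft.
Variable R : realType.
Local Notation C := R[i].
Implicit Types (G H : C -> C) (z w : C) (x v c e s : R).
Variable th : R.
Hypothesis th_gt : pi / 2 < th.
Hypothesis th_le : th <= pi.
Local Notation sgn := (sgn th).

Lemma expR1_le4 : expR (1 : R) <= 4.
Proof.
have h : expR (- (2^-1 : R)) >= 2^-1.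
  by apply: le_trans (expR_ge1Dx _); lra.
have -> : (1 : R) = 2^-1 + 2^-1 by lra.
rewrite expRD -[expR _]invrK -expRN.
have i2 : (expR (- (2^-1 : R)))^-1 <= 2.
  by rewrite -[leRHS]invrK lef_pV2 ?posrE ?expR_gt0 ?invr_gt0.
have i0 : 0 <= (expR (- (2^-1 : R)))^-1 by rewrite invr_ge0 expR_ge0.
nra.
Qed.

(* Both squared norms are (e^{Re} - 1)^2 + 2 e^{Re} (1 - cos Im), and each term is monotone in b. *)
Lemma pwB1_le b w : 0 <= b -> b <= 1 -> -1 <= RE w -> `|IM w| <= pi ->
  nrm (pw b w - 1) <= 2 * nrm (1 - cexp w).
Proof.
move=> b0 b1 w1 wpi.
suff : nrm (pw b w - 1) ^+ 2 <= (2 * nrm (1 - cexp w)) ^+ 2.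
  by rewrite ler_pXn2r ?nnegrE ?nrm_ge0 ?mulr_ge0 ?nrm_ge0.
rewrite exprMn nrm_1Bcexp /pw !nrm_cexpB1.
rewrite reZ imZ.
have ph : 0 <= `|IM w| <= pi by rewrite normr_ge0.
have hc : cos (IM w) <= cos (b * IM w).
  rewrite -[cos (IM w)]cos_norm -[cos (b * _)]cos_norm normrM (ger0_norm b0).
  rewrite leNgt ltr_cos ?in_itv//=; last first.
    by rewrite mulr_ge0//= (le_trans _ wpi)// ler_piMl.
  by rewrite -leNgt ler_piMl.
have c1 : cos (b * IM w) <= 1 by exact: cos_le1.
have h1 : (expR (b * RE w) - 1) ^+ 2 <= (expR (RE w) - 1) ^+ 2.
  have [w0|w0] := lerP 0 (RE w).
    rewrite ler_pXn2r ?nnegrE ?subr_ge0 ?expR_ge0 //.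
    - by rewrite lerD2r ler_expR ler_piMl.
    - by rewrite -[leLHS]expR0 ler_expR mulr_ge0.
    - by rewrite -[leLHS]expR0 ler_expR.
  rewrite -sqrrN -[leRHS]sqrrN !opprB ler_pXn2r ?nnegrE ?subr_ge0 ?expR_le1 ?(ltW w0)//.
  - by rewrite lerD2l lerN2 ler_expR; nra.
  - nra.
(* From Re w >= -1 one gets b Re w <= 1 + Re w, and e <= 4; this 4 is the square of the 2 in the
   claim. *)
have h2 : expR (b * RE w) <= 4 * expR (RE w).
  apply: (@le_trans _ _ (expR (1 + RE w))); first by rewrite ler_expR; nra.
  by rewrite expRD ler_wpM2r ?expR_ge0 ?expR1_le4.
have e0 := expR_ge0 (RE w).
have h3 : expR (b * RE w) * (1 - cos (b * IM w)) <= 4 * expR (RE w) * (1 - cos (IM w)).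
  apply: ler_pM; rewrite ?expR_ge0 ?subr_ge0//; first by rewrite lerD2l lerN2.
have h4 := sqr_ge0 (expR (RE w) - 1).
rewrite mulrDr -!mulrA in h3 *; lra.
Qed.

(* The pole at w = 0 cancels.  For x > 0 the contour integrals vanish, so by continuity at
   x = 0 those of FA a and FA 1 agree for x < 0 too; FA 1 has primitive w - ln (1 - e^w). *)
Definition EA a w : C := FA a w - FA 1 w.

Lemma EAE a w : EA a w = (pw (1 - a) w - 1) / (1 - cexp w).
Proof. by rewrite /EA /FA -mulrBl subrr pw0. Qed.

(** An integrable bound uniform in x across 0, so that the integral is continuous there by
    domination. Up to v = 1 the quotient is at most 2 by [pwB1_le], whose exponent 1 - a forces a <=
    1; beyond, the denominator grows like e^(x + v). *)
Lemma EA_bound a : 0 < a -> a <= 1 -> exists c, forall x s v, `|x| < 1 / 2 -> sgn s -> 0 < v ->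
  nrm (EA a (W x s v)) <= c * expR (- (a * v)).
Proof.
move=> a0 a1.
pose k := 1 - expR (- (1 / 2) : R).
have k0 : 0 < k by rewrite subr_gt0 expR_lt1; lra.
exists (2 * expR a + 2 / k * expR (a / 2)) => x s v; rewrite ltr_norml => /andP[x1 x2] hs v0.
rewrite EAE nrmM nrmV.
have d0 : 0 < nrm (1 - cexp (W x s v)) by rewrite nrm_gt0 (one_sub_neq0 th_gt th_le).
rewrite ler_pdivrMr//.
have T1 : 0 <= 2 / k * expR (a / 2) by rewrite mulr_ge0 ?expR_ge0// divr_ge0// ltW.
have T2 : 0 <= 2 * expR a by rewrite mulr_ge0 ?expR_ge0.
have [v1|v1] := lerP v 1.
  apply: (@le_trans _ _ (2 * nrm (1 - cexp (W x s v)))).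
    apply: pwB1_le => /=; rewrite ?subr_ge0 ?gerBl ?(ltW a0)//; first by lra.
    rewrite normrM (sgn_norm th_gt hs) ger0_norm ?angle_ge0 ?(ltW v0)//.
    by have /andP[] := angle_pi th_gt th_le (ltW v0).
  rewrite ler_wpM2r ?nrm_ge0// mulrDl; apply: ler_wpDr.
    by rewrite mulr_ge0 ?expR_ge0.
  rewrite -mulrA -expRD ler_peMr// -[leLHS]expR0 ler_expR; nra.
have xv : 1 / 2 <= x + v by lra.
have h1 : nrm (pw (1 - a) (W x s v) - 1) <= 2 * expR ((1 - a) * (x + v)).
  apply: (le_trans (ler_nrmB _ _)); rewrite nrm_pw Normc.normc1 /=.
  have : 1 <= expR ((1 - a) * (x + v)) by rewrite -[leLHS]expR0 ler_expR; nra.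
  lra.
have h2 : k * expR (x + v) <= nrm (1 - cexp (W x s v)).
  apply: le_trans (nrm_1Bcexp_ge _) => /=.
  have : 1 <= expR (- (1 / 2)) * expR (x + v).
    by rewrite -expRD -[leLHS]expR0 ler_expR; lra.
  rewrite /k; lra.
apply: (le_trans h1).
apply: (@le_trans _ _ (2 / k * expR (a / 2) * expR (- (a * v)) * nrm (1 - cexp (W x s v)))); last first.
  by rewrite ler_wpM2r ?nrm_ge0// ler_wpM2r ?expR_ge0// lerDr.
apply: le_trans (ler_wpM2l _ h2); last by rewrite mulr_ge0 ?expR_ge0.
have -> : 2 / k * expR (a / 2) * expR (- (a * v)) * (k * expR (x + v)) =
    2 * (expR (a / 2) * expR (- (a * v)) * expR (x + v)) by field; rewrite gt_eqF.
rewrite ler_wpM2l// -!expRD ler_expR; nra.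
Qed.

Lemma EA_hol a w : 1 - cexp w != 0 -> hol (EA a) (dFA a w - dFA 1 w) w.
Proof. by move=> w0; apply: holD; [exact: FA_hol|apply: holN; exact: FA_hol]. Qed.

Lemma EA_ray_cont a s : 0 < a -> a <= 1 -> sgn s -> ccont (fun x => ray (EA a) x s) 0.
Proof.
move=> a0 a1 hs; have [c hc] := EA_bound a0 a1.
have B x v : - (1 / 2) < x < 1 / 2 -> 0 < v ->
    nrm (EA a (W x s v) * dW s v) <= c * (1 + `|s|) * expR (- (a * v)).
  rewrite -ltr_norml => xI v0; rewrite nrmM mulrAC.
  apply: ler_pM; [exact: nrm_ge0|exact: nrm_ge0|exact: hc|exact/nrm_dW/ltW].
have H x v : 0 < v -> hol (EA a) (dFA a (W x s v) - dFA 1 (W x s v)) (W x s v).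
  by move=> v0; apply: EA_hol; exact: (one_sub_neq0 th_gt th_le).
apply: (cint_continuous (K := fun x v => EA a (W x s v) * dW s v) (a := - (1 / 2)) (b := 1 / 2)
    (c := c * (1 + `|s|)) (e := a) _ a0); last by apply/andP; split; lra.
- move=> y yI; split; last by exists (c * (1 + `|s|)), a; split => // v; exact: B.
  by move=> v v0; apply: ccontM; [exact: (hol_path_cont (H y v v0))|exact: dW_cont].
- move=> y v yI v0; apply: ccontM; last exact: ccont_cst.
  exact: (hol_comp_cont (g := fun y => W y s v) (H y v v0) (W_deriv1 y s v)).
- by move=> y v yI v0; exact: B.
Qed.

Lemma right_const (f : R -> R) (u d : R) : 0 < d -> {for 0, continuous f} ->
  (forall x, 0 < x < d -> f x = u) -> f 0 = u.
Proof.
move=> d0 cf fu.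
have h1 : f x @[x --> 0^'+] --> f 0 by apply: cvg_at_right_filter; exact: cf.
have h2 : f x @[x --> 0^'+] --> u.
  apply: cvg_near_cst; near=> x; apply: fu; apply/andP; split.
    by near: x; exact: nbhs_right_gt.
  by near: x; exact: nbhs_right_lt.
exact: (cvg_unique _ h1 h2).
Unshelve. all: by end_near. Qed.

Lemma left_const (f : R -> R) (u d : R) : d < 0 -> {for 0, continuous f} ->
  (forall x, d < x < 0 -> f x = u) -> f 0 = u.
Proof.
move=> d0 cf fu.
have h1 : f x @[x --> 0^'-] --> f 0 by apply: cvg_at_left_filter; exact: cf.
have h2 : f x @[x --> 0^'-] --> u.
  apply: cvg_near_cst; near=> x; apply: fu; apply/andP; split.
    by near: x; exact: nbhs_left_gt.
  by near: x; exact: nbhs_left_lt.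
exact: (cvg_unique _ h1 h2).
Unshelve. all: by end_near. Qed.

Lemma contour_EA a x : 0 < a -> x != 0 ->
  contour (EA a) x th = contour (FA a) x th - contour (FA 1) x th.
Proof.
move=> a0 x0; rewrite /contour /ray.
have E s : sgn s -> cint (fun v => EA a (W x s v) * dW s v) =
    cint (fun v => FA a (W x s v) * dW s v) - cint (fun v => FA 1 (W x s v) * dW s v).
  move=> hs; rewrite -cintB; [|exact: (FA_rapid th_gt th_le)|exact: (FA_rapid th_gt th_le)].
  by apply: eq_cint => v _; rewrite mulrBl.
rewrite !E; [ring|by right|by left].
Qed.

Local Opaque contour EA FA.

Lemma FA_left_eq a x : 0 < a -> a <= 1 -> x < 0 -> contour (FA a) x th = contour (FA 1) x th.
Proof.
move=> a0 a1 x0; apply/eqP; rewrite -subr_eq0 -(@contour_EA a x a0 (ltr0_neq0 x0)); apply/eqP.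
have [c1 c2] : ccont (fun x => contour (EA a) x th) 0.
  exact: (ccontB (EA_ray_cont a0 a1 (or_introl erefl)) (EA_ray_cont a0 a1 (or_intror erefl))).
have R0 y : 0 < y < 1 -> contour (EA a) y th = 0.
  move=> /andP[y0 _]; rewrite (@contour_EA a y a0 (lt0r_neq0 y0)).
  by rewrite (FA_right th_gt th_le a0 y0) (FA_right th_gt th_le ltr01 y0) subr0.
have L0 y : -1 < y < 0 -> contour (EA a) y th = contour (EA a) x th.
  move=> /andP[_ y0].
  rewrite (@contour_EA a y a0 (ltr0_neq0 y0)) (@contour_EA a x a0 (ltr0_neq0 x0)).
  have lo (z : R) : z < 0 -> z = x \/ z = y -> x + y - 1 < z < Num.max x y / 2.
    move=> z0 hz; have mz : Num.max x y < 0 by rewrite gt_max x0.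
    apply/andP; split; first by case: hz => ->; lra.
    have : z <= Num.max x y by rewrite le_max; case: hz => ->; rewrite lexx ?orbT.
    lra.
  have mz : Num.max x y / 2 < 0 by rewrite pmulr_llt0// gt_max x0.
  have F b : 0 < b -> contour (FA b) y th = contour (FA b) x th.
    move=> b0; apply: (FA_const th_gt th_le b0 (or_introl mz)).
      exact: (lo y y0 (or_intror erefl)).
    exact: (lo x x0 (or_introl erefl)).
  by rewrite (F a a0) (F 1 ltr01).
apply: cplx_ext.
- rewrite -(left_const (ltrN10 _) c1 (fun y hy => congr1 _ (L0 y hy))).
  exact: (right_const ltr01 c1 (fun y hy => congr1 _ (R0 y hy))).
- rewrite -(left_const (ltrN10 _) c2 (fun y hy => congr1 _ (L0 y hy))).
  exact: (right_const ltr01 c2 (fun y hy => congr1 _ (R0 y hy))).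
Qed.

End ResidueLeft.

(** * The value 2 pi i to the left of the pole, as the growth of an argument *)

Section Argument.
Variable R : realType.
Local Notation C := R[i].
Implicit Types (f : R -> C) (z w : C) (x v c e s : R).

Lemma nrmE z : nrm z = Num.sqrt (RE z ^+ 2 + IM z ^+ 2).
Proof. by case: z. Qed.

(* The half-angle formula gives a smooth argument on the plane slit along the negative imaginary axis. *)
Definition uarg z : R := pi / 2 - 2 * atan (RE z / (nrm z + IM z)).

Lemma uarg_deriv_eq (p n p' n' r : R) : 0 < r -> 0 < r + n -> r ^+ 2 = p ^+ 2 + n ^+ 2 ->
  0 - (0 * atan (p / (r + n)) + 2 * ((1 + (p / (r + n)) ^+ 2)^-1 *
    (p' * (r + n)^-1 + p * (- ((p * p' + n * n') / r + n') / (r + n) ^+ 2)))) =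
  (n' * p - p' * n) / r ^+ 2.
Proof.
move=> r0 rn0 hr; have r0' := gt_eqF r0; have rn0' := gt_eqF rn0.
have -> : 1 + (p / (r + n)) ^+ 2 = 2 * r / (r + n).
  have -> : 1 + (p / (r + n)) ^+ 2 = ((p ^+ 2 + n ^+ 2) + r ^+ 2 + 2 * r * n) / (r + n) ^+ 2.
    by field; rewrite rn0'.
  by rewrite -hr; field; rewrite rn0'.
(* The two sides of the claim differ by a multiple of r^2 - (p^2 + n^2), here made explicit. *)
rewrite [LHS](_ : _ = (n' * p - p' * n) / r ^+ 2 -
    p' * (r ^+ 2 - (p ^+ 2 + n ^+ 2)) / (r ^+ 2 * (r + n))).
  by rewrite hr subrr mulr0 mul0r subr0.
by field; rewrite r0' rn0'.
Qed.

Lemma is_derive_nrm f df v : f v != 0 -> cderiv f df v ->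
  is_derive v (1 : R) (fun v => nrm (f v)) ((RE (f v) * RE df + IM (f v) * IM df) / nrm (f v)).
Proof.
move=> f0 [f1 f2].
have q0 : 0 < RE (f v) ^+ 2 + IM (f v) ^+ 2.
  by rewrite -sqnrm exprn_gt0// nrm_gt0.
rewrite (_ : (fun v => _) = fun v => Num.sqrt (RE (f v) * RE (f v) + IM (f v) * IM (f v))); last first.
  by apply/funext => u; rewrite nrmE !expr2.
have dq := rderD (rderM f1 f1) (rderM f2 f2).
have q0' : 0 < RE (f v) * RE (f v) + IM (f v) * IM (f v) by rewrite -!expr2.
apply: (is_derive_eq (rder_comp dq (is_derive1_sqrt q0'))).
rewrite -!expr2 -nrmE; field; by rewrite gt_eqF ?nrm_gt0.
Qed.

(** The argument is the imaginary part of a logarithm, so its derivative is that of df / f. The sign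
    of the imaginary part keeps the curve off the slit, where the denominator in [uarg] vanishes. *)
Lemma uarg_deriv f df v : f v != 0 -> 0 <= IM (f v) -> cderiv f df v ->
  is_derive v (1 : R) (fun v => uarg (f v)) (IM (df / f v)).
Proof.
move=> f0 i0 hf; have [f1 f2] := hf.
have r0 : 0 < nrm (f v) by rewrite nrm_gt0.
have rn0 : 0 < nrm (f v) + IM (f v) by rewrite ltr_pwDl.
have dn := rderD (is_derive_nrm f0 hf) f2.
have dq := rderM f1 (rderV (f := fun v => nrm (f v) + IM (f v)) (lt0r_neq0 rn0) dn).
apply: (is_derive_eq (rderB (is_derive_cst (pi / 2 : R) v 1)
  (rderM (is_derive_cst (2 : R) v 1) (rder_comp dq (is_derive1_atan _))))).
rewrite imM reV imV -sqnrm.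
rewrite uarg_deriv_eq//; last exact: sqnrm.
by field; rewrite gt_eqF.
Qed.

Lemma uarg_pos (r : R) : 0 < r -> uarg r%:C = 0.
Proof.
move=> r0; rewrite /uarg nrmC /= addr0 gtr0_norm// divff ?gt_eqF// atan1; by field.
Qed.

Variable th : R.
Hypothesis th_gt : pi / 2 < th.
Hypothesis th_le : th <= pi.
Local Notation sgn := (sgn th).

(** The function e^-w - 1 has logarithmic derivative [- FA 1]. Along the lower ray it stays in the
    closed upper half-plane, running for x < 0 from a positive real number to -1, so its argument
    grows by pi. *)
Definition lcurve x v : C := cexp (- W x (- th) v) - 1.

Lemma lcurve_neq0 x v : x < 0 -> 0 <= v -> 1 - cexp (W x (- th) v) != 0.
Proof.
move=> x0 v0; apply: (@one_sub_neq0_off _ th th_gt th_le (x - 1) (x / 2)) => //.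
- lra.
- left; lra.
- apply/andP; split; lra.
- by right.
Qed.

Lemma lcurve_im x v : 0 <= v -> 0 <= IM (lcurve x v).
Proof.
move=> v0; rewrite /lcurve /= subr0 mulr_ge0 ?expR_ge0// mulNr opprK.
by apply: sin_ge0_pi; exact: angle_pi.
Qed.

Lemma lcurve_deriv x v : cderiv (lcurve x) (- dW (- th) v * cexp (- W x (- th) v)) v.
Proof.
have := cderivB (cderiv_exp (cderivN (W_deriv x (- th) v))) (cderiv_cst 1 v).
by rewrite subr0.
Qed.

Lemma lcurve_log x v : x < 0 -> 0 <= v ->
  - dW (- th) v * cexp (- W x (- th) v) / lcurve x v = - (FA 1 (W x (- th) v) * dW (- th) v).
Proof.
move=> x0 v0; have h := lcurve_neq0 x0 v0.
rewrite /FA subrr pw0 /lcurve cexpN.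
have c0 := cexp_neq0 (W x (- th) v).
move: h c0; set E := cexp _ => h c0; field.
by rewrite c0 /= h.
Qed.

Lemma cvg_norm_expbound (h : R -> R) (l c e : R) : 0 < e ->
  (forall v, 0 <= v -> `|h v - l| <= c * expR (- (e * v))) -> h v @[v --> +oo] --> l.
Proof.
move=> e0 hb; have := cvg_expbound e0 hb.
by move=> /subr_cvg0.
Qed.

Lemma uarg_lcurve_cvg x : x < 0 -> uarg (lcurve x v) @[v --> +oo] --> (pi : R).
Proof.
move=> x0.
have B v : 0 <= v -> nrm (lcurve x v + 1) <= expR (- x) * expR (- (1 * v)).
  by move=> v0; rewrite /lcurve subrK nrm_cexp /= -expRD mul1r opprD.
have hR : RE (lcurve x v) @[v --> +oo] --> (-1 : R).
  apply: (cvg_norm_expbound (c := expR (- x)) (e := 1)) => // v v0.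
  rewrite opprK; apply: le_trans (B _ v0).
  by have := normRe_le (lcurve x v + 1); rewrite reD.
have hI : IM (lcurve x v) @[v --> +oo] --> (0 : R).
  apply: (cvg_expbound (c := expR (- x)) (e := 1)) => // v v0.
  apply: le_trans (B _ v0).
  by have := normIm_le (lcurve x v + 1); rewrite imD addr0.
have hN : nrm (lcurve x v) @[v --> +oo] --> (1 : R).
  apply: (cvg_norm_expbound (c := expR (- x)) (e := 1)) => // v v0.
  apply: le_trans (B _ v0).
  have h1 : 1 <= nrm (lcurve x v + 1) + nrm (lcurve x v).
    by have := ler_nrmB (lcurve x v + 1) (lcurve x v); rewrite addrAC subrr add0r Normc.normc1.
  have h2 : nrm (lcurve x v) <= nrm (lcurve x v + 1) + 1.
    by have := ler_nrmB (lcurve x v + 1) 1; rewrite addrK Normc.normc1.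
  by rewrite ler_norml; apply/andP; split; lra.
have -> : (pi : R) = pi / 2 - 2 * atan (-1 / (1 + 0)).
  by rewrite addr0 divr1 atanN atan1; field.
apply: cvgB; first exact: cvg_cst.
apply: cvgM; first exact: cvg_cst.
apply: continuous_cvg; first exact: continuous_atan.
apply: cvgM => //; apply: cvgV; first by rewrite addr0 oner_eq0.
exact: cvgD.
Qed.

Lemma FA1_im x : x < 0 -> IM (ray (FA 1) x (- th)) = - pi.
Proof.
move=> x0.
have lohi : x - 1 < x / 2 by lra.
have hlt : x / 2 < 0 by lra.
have [c hc] := FA_props th_gt th_le 1 lohi (or_introl hlt).
have xI : x - 1 < x < x / 2 by apply/andP; split; lra.
have A0 : uarg (lcurve x 0) = 0.
  rewrite /lcurve W0 -rmorphN cexpC -[1]/((1 : R)%:C) -rmorphB; apply: uarg_pos.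
  by rewrite subr_gt0 -[ltLHS]expR0 ltr_expR oppr_gt0.
have rI : rapidR (fun v => IM (FA 1 (W x (- th) v) * dW (- th) v)).
  apply: (rapid_Im (f := fun v => FA 1 (W x (- th) v) * dW (- th) v)).
  by apply: (FA_rapid th_gt th_le) => //; [rewrite lt_eqF|right].
suff : rint (fun v => -1 * IM (FA 1 (W x (- th) v) * dW (- th) v)) = pi - uarg (lcurve x 0).
  by rewrite A0 subr0 rintZ// mulN1r => <-; rewrite opprK.
have bnd v : 0 <= v -> nrm (FA 1 (W x (- th) v) * dW (- th) v) <= c * (1 + `|- th|) * expR (- (1 * v)).
  move=> v0; rewrite nrmM mulrAC; apply: ler_pM; [exact: nrm_ge0|exact: nrm_ge0| |exact: nrm_dW].
  by have [] := hc (- th) x v (or_intror erefl) xI v0.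
apply: (@rint_FTC _ (fun v => -1 * IM (FA 1 (W x (- th) v) * dW (- th) v)) (fun v => uarg (lcurve x v)) pi (c * (1 + `|- th|)) 1).
- move=> v v0; apply: continuousM; first exact: cst_continuous.
  have [h _ _ _] := hc (- th) x v (or_intror erefl) xI v0.
  by have [] := ccontM (hol_path_cont h) (@dW_cont _ (- th) v).
- exact: ltr01.
- move=> v v0; rewrite mulN1r normrN; exact: le_trans (normIm_le _) (bnd _ v0).
- move=> v v0.
  have -> : -1 * IM (FA 1 (W x (- th) v) * dW (- th) v) =
      IM (- dW (- th) v * cexp (- W x (- th) v) / lcurve x v).
    by rewrite (lcurve_log x0 v0) imN mulN1r.
  apply: uarg_deriv; [|exact: lcurve_im|exact: lcurve_deriv].
  have := lcurve_neq0 x0 v0; rewrite /lcurve cexpN => h; apply/eqP => h2.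
  move/eqP: h2; rewrite subr_eq0 => /eqP h2.
  by move: h; rewrite -[cexp _]invrK h2 invr1 subrr eqxx.
- exact: uarg_lcurve_cvg.
Qed.

Lemma cexp_conj z : cexp z^*%C = (cexp z)^*%C.
Proof. by case: z => a b; rewrite /cexp /= cosN sinN mulrN. Qed.

Lemma re_conj z : RE z^*%C = RE z. Proof. by case: z. Qed.
Lemma im_conj z : IM z^*%C = - IM z. Proof. by case: z. Qed.

(** The two rays are complex conjugates: the real parts cancel, and the imaginary part - pi of the
    lower one counts twice. *)
Lemma FA1_left x : x < 0 -> contour (FA 1) x th = (2 * pi) *i.
Proof.
move=> x0.
have E v : FA 1 (W x th v) * dW th v = (FA 1 (W x (- th) v) * dW (- th) v)^*%C.
  have -> : W x th v = (W x (- th) v)^*%C by rewrite /W /= mulNr opprK.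
  have -> : dW th v = (dW (- th) v)^*%C by rewrite /dW /= mulNr opprK.
  by rewrite /FA subrr !pw0 cexp_conj !rmorphM fmorphV rmorphB !rmorph1.
have rp : rapid (fun v => FA 1 (W x (- th) v) * dW (- th) v).
  by apply: (FA_rapid th_gt th_le) => //; [rewrite lt_eqF|right].
have hI := FA1_im x0.
apply: cplx_ext; rewrite /contour !reimE [RHS]/=.
- rewrite /ray /cint /=; apply/eqP; rewrite subr_eq0; apply/eqP.
  by apply: eq_rint => v _; exact: (etrans (congr1 (fun z => RE z) (E v)) (re_conj _)).
- rewrite hI opprK.
  have -> : IM (ray (FA 1) x th) = - IM (ray (FA 1) x (- th)).
    rewrite /ray /cint /= -[RHS]mulN1r -(rintZ _ (rapid_Im rp)).
    by apply: eq_rint => v _; rewrite mulN1r; exact: (etrans (congr1 (fun z => IM z) (E v)) (im_conj _)).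
  by rewrite hI; ring.
Qed.

Lemma pwN_contour a x : 0 < a -> contour (pw (- a)) x th = 0.
Proof.
move=> a0.
have B y s v : 0 <= v -> nrm (pw (- a) (W y s v)) = expR (- (a * y)) * expR (- (a * v)).
  by move=> v0; rewrite nrm_pw /= -expRD; congr expR; ring.
pose k : R := (- a)^-1.
have k0 : - a != 0 by rewrite oppr_eq0 gt_eqF.
have E s : ray (pw (- a)) x s = - (k%:C * pw (- a) x%:C).
  apply: (@ray_exact _ (fun w => k%:C * pw (- a) w) (pw (- a)) s x ((1 + `|k|) * expR (- (a * x))) a) => //.
  - move=> v v0; apply: (eq_hol (holM (@hol_cst _ k%:C (W x s v)) (pw_hol (- a) (W x s v)))).
    by rewrite mul0r add0r mulrA -rmorphM mulVf// mul1r.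
  - by move=> v v0; exact: (hol_path_cont (pw_hol (- a) (W x s v))).
  - move=> v v0; rewrite nrmM nrmC B// mulrA ler_wpM2r ?expR_ge0// ler_wpM2r ?expR_ge0// lerDr//.
  - move=> v v0; rewrite B// ler_wpM2r ?expR_ge0// ler_peMl ?expR_ge0// lerDl//.
by rewrite /contour !E subrr.
Qed.

(** The difference of the two integrands is [pw (- a)], which has a decaying primitive. This carries
    the value found for a <= 1 to every a > 0. *)
Lemma FA_succ a x : 0 < a -> x < 0 -> contour (FA (a + 1)) x th = contour (FA a) x th.
Proof.
move=> a0 x0.
have a10 : 0 < a + 1 by rewrite addr_gt0.
have xn0 : x != 0 by rewrite lt_eqF.
have E s : sgn s -> ray (FA (a + 1)) x s = ray (FA a) x s + ray (pw (- a)) x s.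
  move=> hs; rewrite /ray -cintD.
  - apply: eq_cint => v v0; rewrite -mulrDl; congr (_ * _).
    have n0 := one_sub_neq0 th_gt th_le x hs v0.
    rewrite /FA (_ : 1 - (a + 1) = - a); last by ring.
    rewrite (_ : 1 - a = 1 + - a)// pwD pw1.
    by move: n0; set q := cexp _; set r := pw _ _ => n0; field.
  - exact: (FA_rapid th_gt th_le).
  - apply: (@ray_rapid _ (pw (- a)) (fun w => (- a)%:C * pw (- a) w) s x (expR (- (a * x))) a) => //.
      by move=> v _; exact: pw_hol.
    by move=> v _; rewrite nrm_pw /= -expRD le_eqVlt; apply/orP; left; apply/eqP; congr expR; ring.
rewrite /contour !E; [|by right|by left].
have := pwN_contour x a0; rewrite /contour => /eqP; rewrite subr_eq0 => /eqP ->.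
ring.
Qed.

Lemma FA_left a x : 0 < a -> x < 0 -> contour (FA a) x th = (2 * pi) *i.
Proof.
move=> a0 x0.
suff H n b : 0 < b -> b <= n.+1%:R -> contour (FA b) x th = (2 * pi) *i.
  have [n an] : exists n : nat, a <= n%:R.
    by exists (Num.bound a); rewrite ltW// archi_boundP// ltW.
  by apply: (H n) => //; apply: (le_trans an); rewrite ler_nat.
elim: n b => [|n IH] b b0 bn; first by rewrite (FA_left_eq th_gt th_le)// FA1_left.
have [b1|b1] := lerP b 1; first by rewrite (FA_left_eq th_gt th_le)// FA1_left.
have -> : b = (b - 1) + 1 by ring.
rewrite FA_succ ?subr_gt0//; apply: IH; first by rewrite subr_gt0.
by rewrite lerBlDr natr1.
Qed.

End Argument.

(** * The reciprocal Gamma function *)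

Section GammaFTC.
Variable R : realType.
Implicit Types (a u v x y : R).
Let mu : {measure set _ -> \bar R} := @lebesgue_measure R.
Local Notation D := (`]0%R, +oo[%classic : set R).

(** The damped integrals below are controlled for Y >= 0 only. Composing with the absolute value
    turns their one-sided continuity at 0 into the two-sided one that continuity under the integral
    delivers. *)
Lemma abs_right_cvg (f : R -> R) : {for 0, continuous (fun y => f `|y|)} ->
  f y @[y --> 0^'+] --> f 0.
Proof.
move=> cf.
have h : f `|y| @[y --> 0^'+] --> f `|0| := cvg_at_right_filter cf.
rewrite normr0 in h; apply: cvg_trans h; apply: near_eq_cvg.
near=> y; rewrite gtr0_norm//; near: y; exact: nbhs_right_gt.
Unshelve. all: by end_near. Qed.

Definition gfun a y : R := y `^ (a - 1) * expR (- y).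

Lemma gfun_cont a y : 0 < y -> {for y, continuous (gfun a)}.
Proof.
move=> y0; apply: continuousM; last first.
  exact: (is_derive_cont (is_derive_expN1 y)).
have := is_derive1_powR (a - 1) y0; exact: is_derive_cont.
Qed.

Lemma gfun_ge0 a y : 0 <= gfun a y.
Proof. by rewrite mulr_ge0 ?powR_ge0 ?expR_ge0. Qed.

(* The integrand of Gamma may be unbounded at 0, so the fundamental theorem is applied on
   [eta, +oo[ and eta tends to 0. *)
Lemma Gamma_limit a (F : R -> R) L :
  (forall y, 0 < y -> is_derive y (1 : R) F (gfun a y)) ->
  F y @[y --> 0^'+] --> (0 : R) -> F y @[y --> +oo] --> L -> Gamma a = L.
Proof.
move=> dF F0 FL.
have I eta : 0 < eta -> (\int[mu]_(x in `[eta, +oo[) (gfun a x)%:E = (L - F eta)%:E)%E.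
  move=> e0; rewrite (@ge0_continuous_FTC2y _ (gfun a) F eta L) ?EFinD//.
  - by move=> x _; exact: gfun_ge0.
  - apply/continuous_within_itvcyP; split.
      by move=> x; rewrite in_itv /= andbT => ex; apply: gfun_cont; exact: lt_trans ex.
    by apply: cvg_at_right_filter; exact: gfun_cont.
  - by move=> x ex; have [] := dF x (lt_trans e0 ex).
  - by apply: cvg_at_right_filter; exact: (is_derive_cont (dF _ e0)).
  - move=> x; rewrite in_itv /= andbT => ex; rewrite derive1E.
    by have [] := dF x (lt_trans e0 ex).
pose P n := `[@harmonic R n, +oo[%classic.
pose g' n := (EFin \o gfun a) \_ (P n).
have mD : measurable D by exact: measurable_itv.
have mgD : measurable_fun D (EFin \o gfun a).
  by apply/measurable_EFinP; apply: measurable_Dcont => v; exact: gfun_cont.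
have mg n : measurable_fun D (g' n).
  apply/measurable_restrict => //; first exact: measurable_itv.
  by apply: measurable_funS mgD => //; move=> x [].
have g0 n x : D x -> (0 <= g' n x)%E.
  by move=> _; rewrite /g' /patch; case: ifP => // _; rewrite lee_fin gfun_ge0.
have ng x : D x -> nondecreasing_seq (g' ^~ x).
  move=> _ m n mn; rewrite /g' /patch.
  case: ifPn => xm; case: ifPn => xn //.
  - move: xn; rewrite notin_setE => /negP; move: xm; rewrite inE /P /= !in_itv /= !andbT => hm.
    by case/negP; apply: le_trans hm; rewrite lef_pV2 ?posrE// ler_nat ltnS.
  - by rewrite lee_fin gfun_ge0.
have lim_g x : D x -> limn (g' ^~ x) = (gfun a x)%:E.
  rewrite /= in_itv /= andbT => x0; apply/cvg_lim => //; apply: cvg_near_cst.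
  have := @cvg_harmonic R; move/cvgrPdist_lt => /(_ _ x0); apply: filterS => n /=.
  rewrite sub0r normrN ger0_norm ?invr_ge0// => hn.
  by rewrite /g' /patch mem_set// /P /= in_itv /= andbT ltW.
have E : (\int[mu]_(x in D) (gfun a x)%:E = L%:E)%E.
  have := @cvg_monotone_convergence _ _ _ mu D mD g' mg g0 ng.
  rewrite (_ : (\int[mu]_(x in D) (limn (g' ^~ x)) = \int[mu]_(x in D) (gfun a x)%:E)%E); last first.
    by apply: eq_integral => x /set_mem; exact: lim_g.
  rewrite (_ : (fun n => (\int[mu]_(x in D) g' n x)%E) = EFin \o (fun n => L - F (harmonic n))); last first.
    apply/funext => n; rewrite /g' -integral_mkcondr.
    have -> : D `&` P n = P n.
      apply/setIidPr => x; rewrite /P /= !in_itv /= !andbT.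
      by apply: lt_le_trans; rewrite invr_gt0.
    exact: (I _ (harmonic_gt0 n)).
  move=> h1; apply: (cvg_unique _ h1) => //.
  apply: cvg_EFin; first exact: nearW.
  rewrite -[X in _ --> X]subr0; apply: cvgB; first exact: cvg_cst.
  move/cvg_at_rightP: F0; apply; split; last exact: cvg_harmonic.
  by move=> n; rewrite /= invr_gt0.
by rewrite /Gamma /Rintegral -/mu E.
Qed.

(** The factor [h] will be the real or imaginary part of [HH a]. The former turns out to be 0; in
    that case [U] is constant and its two limits agree. *)
Lemma Gamma_scaled a (U : R -> R) h L :
  (forall y, 0 < y -> is_derive y (1 : R) U (h * gfun a y)) ->
  U y @[y --> 0^'+] --> (0 : R) -> U y @[y --> +oo] --> L -> h * Gamma a = L.
Proof.
move=> dU U0 UL.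
have [h0|h0] := eqVneq h 0.
  rewrite h0 mul0r.
  have c y : 0 < y -> U y = U 1.
    move=> y0; apply: (@rderiv0_const _ U 0 (y + 1 + 1)).
    - by apply/andP; split => //; lra.
    - by apply/andP; split => //; lra.
    by move=> z /andP[z0 _]; have := dU z z0; rewrite h0 mul0r.
  have h1 : U y @[y --> 0^'+] --> U 1.
    apply: cvg_near_cst; near=> y; apply: c; near: y; exact: nbhs_right_gt.
  have h2 : U y @[y --> +oo] --> U 1.
    apply: cvg_near_cst; near=> y; apply: c; near: y; exact: nbhs_pinfty_gt.
  by rewrite (cvg_unique _ UL h2)// (cvg_unique _ h1 U0).
have -> : L = h * (h^-1 * L) by rewrite mulrA divff// mul1r.
congr (_ * _); apply: (@Gamma_limit a (fun y => h^-1 * U y)).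
- move=> y y0; apply: (is_derive_eq (rderM (is_derive_cst h^-1 y 1) (dU y y0))).
  by rewrite mul0r add0r mulrA mulVf// mul1r.
- by rewrite -[X in _ --> X](mulr0 h^-1); apply: cvgM; [exact: cvg_cst|exact: U0].
- by apply: cvgM; [exact: cvg_cst|exact: UL].
Unshelve. all: by end_near. Qed.

End GammaFTC.

(** * Hankel's formula: [HH] is 2 pi i times the reciprocal of Euler's Gamma *)

Section HankelGamma.
Variable R : realType.
Local Notation C := R[i].
Implicit Types (z w : C) (x v c e s Y : R).
Variable th : R.
Hypothesis th_gt : pi / 2 < th.
Hypothesis th_le : th <= pi.
Local Notation sgn := (sgn th).

(** With x0 = - (v1 + 1) the modulus of e^w is at most e^-1 <= 1 / 2 until [v1], and afterwards its
    real part is negative. The lower bound on Re (1 - zeta) along the whole contour is what makes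
    e^(- Y (1 - zeta)) decay in Y. *)
Lemma start_point : exists2 x0 : R, x0 < 0 & forall s v, sgn s -> 0 <= v ->
  1 / 2 <= RE (1 - cexp (W x0 s v)).
Proof.
have [c [v1 [c0 v10 hc]]] := cos_angle_lt0 th_gt th_le.
exists (- (v1 + 1)); first by lra.
move=> s v hs v0; rewrite reD reN /= (cos_angle_sgn _ hs).
suff : expR (- (v1 + 1) + v) * cos (th * (1 - expR (- v))) <= 1 / 2 by lra.
have [vv1|vv1] := lerP v1 v.
  have := hc _ vv1; set k := cos _ => hk.
  have : expR (- (v1 + 1) + v) * k <= 0.
    by rewrite pmulr_rle0 ?expR_gt0//; lra.
  lra.
apply: (@le_trans _ _ (expR (- (v1 + 1) + v))).
  by rewrite ler_piMr ?expR_ge0 ?cos_le1.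
apply: (@le_trans _ _ (expR (- 1))); first by rewrite ler_expR; lra.
rewrite expRN div1r lef_pV2 ?posrE ?expR_gt0//.
by apply: le_trans (expR_ge1Dx _); lra.
Qed.

Section FixedStart.
Variables (a x0 : R).
Hypothesis a0 : 0 < a.
Hypothesis x00 : x0 < 0.
Hypothesis hx0 : forall s v, sgn s -> 0 <= v -> 1 / 2 <= RE (1 - cexp (W x0 s v)).

Definition damp Y w : C := cexp (- (Y%:C * (1 - cexp w))).

(* The contour integral of GY Y vanishes at Y = 0, tends to that of FA a, i.e. to 2 pi i, as
   Y -> +oo, and its derivative in Y is Y^(a-1) e^-Y HH a; integrating gives HH a * Gamma a. *)
Definition GY Y w : C := (1 - damp Y w) * FA a w.

Lemma nrm_damp Y s v : 0 <= Y -> sgn s -> 0 <= v -> nrm (damp Y (W x0 s v)) <= expR (- (Y / 2)).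
Proof.
move=> Y0 hs v0; rewrite nrm_cexp reN reZ ler_expR lerN2.
by rewrite ler_wpM2l//; have := hx0 hs v0; lra.
Qed.

Lemma x0_neq0 : x0 != 0. Proof. by rewrite lt_eqF. Qed.

Lemma W_neq s v : sgn s -> 0 < v -> 1 - cexp (W x0 s v) != 0.
Proof. by move=> hs v0; exact: (one_sub_neq0 th_gt th_le). Qed.

Lemma damp_cont Y s v : ccont (fun v => damp Y (W x0 s v)) v.
Proof.
have h1 : hol (fun w => 1 - cexp w) (0 - 1 * cexp (W x0 s v)) (W x0 s v).
  by apply: holD; [exact: hol_cst|apply: holN; exact: (hol_exp (@hol_id _ _))].
exact: (hol_path_cont (hol_exp (holN (holM (@hol_cst _ Y%:C _) h1)))).
Qed.

Lemma damp_rapid Y s : 0 <= Y -> sgn s -> rapid (fun v => damp Y (W x0 s v) * (FA a (W x0 s v) * dW s v)).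
Proof.
move=> Y0 hs; have [cF [c [e [e0 Fb]]]] := FA_rapid th_gt th_le a0 x0_neq0 hs.
split; first by move=> v v0; apply: ccontM; [exact: damp_cont|exact: cF].
exists c, e; split => // v v0; rewrite nrmM; apply: le_trans (Fb _ v0).
rewrite ler_piMl ?nrm_ge0//; apply: (le_trans (nrm_damp Y0 hs (ltW v0))).
by rewrite expR_le1 oppr_le0 divr_ge0.
Qed.

Lemma GY_rapid Y s : 0 <= Y -> sgn s -> rapid (fun v => GY Y (W x0 s v) * dW s v).
Proof.
move=> Y0 hs.
apply: (eq_rapid _ (rapidD (FA_rapid th_gt th_le a0 x0_neq0 hs) (rapidN (damp_rapid Y0 hs)))).
by move=> v; rewrite /GY; ring.
Qed.

Lemma ray_GY_lim s : sgn s -> exists k, forall Y, 0 <= Y ->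
  nrm (ray (GY Y) x0 s - ray (FA a) x0 s) <= k * expR (- (1 / 2 * Y)).
Proof.
move=> hs; have [cF [c [e [e0 Fb]]]] := FA_rapid th_gt th_le a0 x0_neq0 hs.
exists (c / e + c / e) => Y Y0.
have -> : ray (GY Y) x0 s - ray (FA a) x0 s =
    - cint (fun v => damp Y (W x0 s v) * (FA a (W x0 s v) * dW s v)).
  rewrite /ray.
  have -> : cint (fun v => GY Y (W x0 s v) * dW s v) =
      cint (fun v => FA a (W x0 s v) * dW s v - damp Y (W x0 s v) * (FA a (W x0 s v) * dW s v)).
    by apply: eq_cint => v _; rewrite /GY; ring.
  rewrite cintB; [ring|exact: (FA_rapid th_gt th_le a0 x0_neq0 hs)|exact: damp_rapid].
rewrite nrmN (_ : (c / e + c / e) * _ = c * expR (- (1 / 2 * Y)) / e + c * expR (- (1 / 2 * Y)) / e); last by ring.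
apply: (cint_bound _ e0).
  by move=> v v0; have [h _] := damp_rapid Y0 hs; exact: h.
move=> v v0.
have -> : c * expR (- (1 / 2 * Y)) * expR (- (e * v)) = c * expR (- (e * v)) * expR (- (1 / 2 * Y)) by ring.
rewrite nrmM [nrm _ * _]mulrC.
apply: ler_pM; [exact: nrm_ge0|exact: nrm_ge0|exact: Fb|].
by have := nrm_damp Y0 hs (ltW v0); rewrite mulrC div1r.
Qed.

Lemma contour_GY_lim : exists k, forall Y, 0 <= Y ->
  nrm (contour (GY Y) x0 th - contour (FA a) x0 th) <= k * expR (- (1 / 2 * Y)).
Proof.
have [k1 h1] := ray_GY_lim (or_introl erefl); have [k2 h2] := ray_GY_lim (or_intror erefl).
exists (k1 + k2) => Y Y0; rewrite /contour mulrDl.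
rewrite (_ : _ - _ = ray (GY Y) x0 th - ray (FA a) x0 th -
  (ray (GY Y) x0 (- th) - ray (FA a) x0 (- th))); last by ring.
by apply: (le_trans (ler_nrmB _ _)); apply: lerD; [exact: h1|exact: h2].
Qed.

Lemma ccont_exp (f : R -> C) v : ccont f v -> ccont (fun v => cexp (f v)) v.
Proof.
move=> [f1 f2]; split => /=; apply: continuousM.
- exact: (continuous_comp f1 (@continuous_expR _ _)).
- exact: (continuous_comp f2 (@continuous_cos _ _)).
- exact: (continuous_comp f1 (@continuous_expR _ _)).
- exact: (continuous_comp f2 (@continuous_sin _ _)).
Qed.

Lemma ray_GY_cont s : sgn s -> ccont (fun y => ray (GY `|y|) x0 s) 0.
Proof.
move=> hs; have [cF [c [e [e0 Fb]]]] := FA_rapid th_gt th_le a0 x0_neq0 hs.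
have I : -1 < (0 : R) < 1 by rewrite ltrN10 ltr01.
apply: (cint_continuous (K := fun y v => GY `|y| (W x0 s v) * dW s v) (a := -1) (b := 1)
    (c := 2 * c) (e := e) _ e0 _ _ I).
- by move=> y _; exact: GY_rapid.
- move=> y v _ v0; apply: ccontM; last exact: ccont_cst.
  apply: ccontM; last exact: ccont_cst.
  apply: ccontB; first exact: ccont_cst.
  apply: ccont_exp.
  rewrite (_ : (fun u => _) = fun u => - (1 - cexp (W x0 s v)) * (`|u|)%:C); last first.
    by apply/funext => u; rewrite mulNr mulrC.
  apply: ccontM; first exact: ccont_cst.
  by split => /=; [exact: norm_continuous|exact: cst_continuous].
- move=> y v _ v0; rewrite /GY -[_ * FA a _ * _]mulrA nrmM -mulrA; apply: ler_pM; [exact: nrm_ge0|exact: nrm_ge0| |exact: Fb].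
  apply: (le_trans (ler_nrmB _ _)); rewrite Normc.normc1.
  have := nrm_damp (normr_ge0 y) hs (ltW v0).
  have : expR (- (`|y| / 2)) <= 1 by rewrite expR_le1 oppr_le0 divr_ge0.
  lra.
Qed.

Lemma contour_GY0 : contour (GY 0) x0 th = 0.
Proof.
have E s : sgn s -> ray (GY 0) x0 s = 0.
  move=> hs; rewrite /ray -[RHS](mul0r (cint (fun v => FA a (W x0 s v) * dW s v))) -cintM.
    have d0 w : damp 0 w = 1.
      by rewrite /damp (_ : (0 : R)%:C * (1 - cexp w) = 0) ?oppr0 ?cexp0//; exact: mul0r.
    by apply: eq_cint => v _; rewrite /GY d0 subrr !mul0r.
  exact: (FA_rapid th_gt th_le a0 x0_neq0 hs).
by rewrite /contour !E ?subrr//; [right|left].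
Qed.

Lemma gfunE y : 0 < y -> gfun a y = expR ((a - 1) * ln y) * expR (- y).
Proof. by move=> y0; rewrite /gfun /powR gt_eqF. Qed.

(** Scaling zeta by y translates w by ln y: e^(y zeta) zeta^-a dzeta becomes Hankel's integrand on a
    translated contour, and the power y^(a - 1) left over is that of Euler's integrand. *)
Lemma damp_shift y w : 0 < y -> damp y w * pw (1 - a) w =
  (gfun a y)%:C * (kern (w + (ln y)%:C) * pw (1 - a) (w + (ln y)%:C)).
Proof.
move=> y0.
have e1 : cexp (w + (ln y)%:C) = cexp w * y%:C by rewrite cexpD cexpC lnK// posrE.
have e2 : pw (1 - a) (w + (ln y)%:C) = pw (1 - a) w * (expR ((1 - a) * ln y))%:C.
  by rewrite /pw mulrDr cexpD -rmorphM cexpC.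
have e3 : damp y w = (expR (- y))%:C * cexp (cexp w * y%:C).
  by rewrite /damp -cexpC -cexpD; congr cexp; rewrite rmorphN; ring.
have e4 : (expR ((a - 1) * ln y))%:C * (expR ((1 - a) * ln y))%:C = 1.
  by rewrite -rmorphM -expRD -mulrDl (_ : a - 1 + (1 - a) = 0) ?mul0r ?expR0//; ring.
rewrite gfunE// /kern e1 e2 e3 rmorphM -[LHS]mul1r -e4; ring.
Qed.

Lemma W_shift s v (d : R) : W x0 s v + d%:C = W (x0 + d) s v.
Proof. by apply: cplx_ext; rewrite !reimE /= ?addr0//; ring. Qed.

Lemma ray_GY_deriv s Y : 0 < Y -> sgn s -> cderiv (fun Y => ray (GY Y) x0 s)
  ((gfun a Y)%:C * cint (fun v => kern (W (x0 + ln Y) s v) * pw (1 - a) (W (x0 + ln Y) s v) * dW s v)) Y.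
Proof.
move=> Y0 hs.
rewrite -cintM; last exact: (tame_rapid th_gt th_le (tame_pw _ _) hs).
have YI : Y / 2 < Y < 2 * Y by apply/andP; split; lra.
pose L := `|ln (Y / 2)| + `|ln (2 * Y)|.
have hL y : Y / 2 < y < 2 * Y -> `|ln y| <= L.
  move=> /andP[y1 y2].
  have y0 : 0 < y by lra.
  have l1 : ln (Y / 2) <= ln y by rewrite ler_ln ?posrE//; lra.
  have l2 : ln y <= ln (2 * Y) by rewrite ler_ln ?posrE//; lra.
  rewrite ler_norml /L; have := ler_norm (ln (2 * Y)); have := ler_norm (- ln (Y / 2)).
  by rewrite normrN; have := normr_ge0 (ln (Y / 2)); have := normr_ge0 (ln (2 * Y)) => *;
    apply/andP; split; lra.
pose X := `|x0| + L.
have hX y : Y / 2 < y < 2 * Y -> `|x0 + ln y| <= X.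
  by move=> yI; apply: (le_trans (ler_normD _ _)); rewrite lerD2l hL.
have [M M0 hM] := kern_decay th_gt th_le X `|1 - a|.
have bG y : Y / 2 < y < 2 * Y -> gfun a y <= expR (`|a - 1| * L).
  move=> yI; have /andP[y1 y2] := yI; have y0 : 0 < y by lra.
  rewrite gfunE// -[leRHS]mulr1; apply: ler_pM; rewrite ?expR_ge0//; last first.
    by rewrite expR_le1; lra.
  by rewrite ler_expR; apply: (le_trans (ler_norm _)); rewrite normrM ler_wpM2l// hL.
apply: (cint_deriv (K := fun Y v => GY Y (W x0 s v) * dW s v)
  (dK := fun Y v => (gfun a Y)%:C * (kern (W (x0 + ln Y) s v) * pw (1 - a) (W (x0 + ln Y) s v) * dW s v))
  (c := expR (`|a - 1| * L) * (expR (`|1 - a| * X) * M * (1 + `|s|))) (e := 1) YI).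
- by move=> y /andP[y1 y2]; apply: GY_rapid => //; lra.
- exact: ltr01.
- move=> y v /andP[y1 y2] v0; have y0 : 0 < y by lra.
  have q0 := W_neq hs v0.
  have hd : cderiv (fun y => damp y (W x0 s v)) (- (1 - cexp (W x0 s v)) * damp y (W x0 s v)) y.
    apply: (eq_cderiv (cderiv_exp (cderivN (cderivM (cderiv_real (is_derive_id y 1))
      (cderiv_cst (1 - cexp (W x0 s v)) y))))).
    by congr (- _ * _); rewrite mulr0 addr0 -[RHS]mul1r.
  apply: (eq_cderiv (cderivM (cderivM (cderivB (cderiv_cst 1 y) hd) (cderiv_cst (FA a (W x0 s v)) y)) (cderiv_cst (dW s v) y))).
  rewrite -W_shift [in RHS]mulrA -damp_shift// /FA.
  by move: q0; set q := 1 - cexp _ => q0; field.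
- move=> y v yI v0; rewrite nrmM nrmC ger0_norm ?gfun_ge0// -[expR _ * _ * _]mulrA.
  apply: ler_pM; rewrite ?gfun_ge0 ?nrm_ge0 ?bG//.
  rewrite nrmM mulrAC; apply: ler_pM; [exact: nrm_ge0|exact: nrm_ge0| |exact/nrm_dW/ltW].
  rewrite nrmM nrm_pw /=.
  apply: (@le_trans _ _ (nrm (kern (W (x0 + ln y) s v)) * (expR (`|1 - a| * X) * expR (`|1 - a| * v)))).
    rewrite ler_wpM2l ?nrm_ge0// -expRD -mulrDr ler_expR.
    apply: (le_trans (ler_norm _)); rewrite normrM ler_wpM2l//.
    by apply: (le_trans (ler_normD _ _)); rewrite (ger0_norm (ltW v0)) lerD2r hX.
  rewrite mulrCA -mulrA ler_wpM2l ?expR_ge0//.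
  by apply: hM => //; [exact: hX|exact: ltW].
Qed.

(** Differentiating in Y brings down 1 - zeta and cancels the pole; the start x0 + ln Y that remains
    does not affect Hankel's integral. *)
Lemma contour_GY_deriv Y : 0 < Y -> cderiv (fun Y => contour (GY Y) x0 th) ((gfun a Y)%:C * HH th a) Y.
Proof.
move=> Y0.
apply: (eq_cderiv (cderivB (ray_GY_deriv Y0 (or_introl erefl)) (ray_GY_deriv Y0 (or_intror erefl)))).
by rewrite -mulrBr -(HHE th_gt th_le a (x0 + ln Y)).
Qed.

Lemma HH_Gamma_fixed : HH th a * (Gamma a)%:C = (2 * pi) *i.
Proof.
have cc : ccont (fun y => contour (GY `|y|) x0 th) 0.
  exact: (ccontB (ray_GY_cont (or_introl erefl)) (ray_GY_cont (or_intror erefl))).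
have [k hk] := contour_GY_lim.
have FAv := FA_left th_gt th_le a0 x00.
apply: cplx_ext; rewrite !reimE /= ?mulr0 ?subr0 ?add0r.
- apply: (@Gamma_scaled _ a (fun Y => RE (contour (GY Y) x0 th))).
  + move=> y y0; have [h _] := contour_GY_deriv y0.
    by apply: (is_derive_eq h); rewrite reZ mulrC.
  + have [c1 c2] := cc.
    have := @abs_right_cvg _ (fun Y => RE (contour (GY Y) x0 th)) c1.
    by rewrite contour_GY0.
  + apply: (@cvg_norm_expbound _ _ _ k (1 / 2)) => // Y hY.
    by apply: le_trans (hk _ hY); rewrite FAv; have := normRe_le (contour (GY Y) x0 th - (2 * pi) *i); rewrite reD reN.
- apply: (@Gamma_scaled _ a (fun Y => IM (contour (GY Y) x0 th))).
  + move=> y y0; have [_ h] := contour_GY_deriv y0.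
    by apply: (is_derive_eq h); rewrite imZ mulrC.
  + have [c1 c2] := cc.
    have := @abs_right_cvg _ (fun Y => IM (contour (GY Y) x0 th)) c2.
    by rewrite contour_GY0.
  + apply: (@cvg_norm_expbound _ _ _ k (1 / 2)) => // Y hY.
    by apply: le_trans (hk _ hY); rewrite FAv; have := normIm_le (contour (GY Y) x0 th - (2 * pi) *i); rewrite imD imN.
Qed.

End FixedStart.

Lemma HH_Gamma a : 0 < a -> HH th a * (Gamma a)%:C = (2 * pi) *i.
Proof. by move=> a0; have [x0 x00 hx] := start_point; exact: (HH_Gamma_fixed a0 x00 hx). Qed.

(** The integrand gives nonnegativity; Gamma cannot vanish because its product with [HH] is 2 pi
    i. *)
Lemma Gamma_gt0 (a : R) : 0 < a -> 0 < Gamma a.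
Proof.
move=> a0; rewrite lt_neqAle; apply/andP; split; last first.
  by apply: Rintegral_ge0 => x _; exact: gfun_ge0.
rewrite eq_sym; apply/eqP => G0; have := HH_Gamma a0; rewrite G0 mulr0 => -[/eqP].
by rewrite eq_sym mulf_eq0 pnatr_eq0 /= gt_eqF ?pi_gt0.
Qed.

Lemma HH_inv_Gamma a : 0 < a -> HH th a = (2 * pi) *i / (Gamma a)%:C.
Proof.
move=> a0; rewrite -(HH_Gamma a0) mulfK//.
by rewrite fmorph_eq0 gt_eqF// Gamma_gt0.
Qed.

End HankelGamma.

(** * The Mittag-Leffler function as a contour integral *)

Section MLcontour.
Variable R : realType.
Local Notation C := R[i].
Implicit Types (z w : C) (x v c e s b : R).
Variable th : R.
Hypothesis th_gt : pi / 2 < th.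
Hypothesis th_le : th <= pi.
Local Notation sgn := (sgn th).

Lemma limn_geometric (u : nat -> C) (L : C) (K : R) :
  (forall n, nrm (u n - L) <= K * (1 / 2) ^+ n) -> limn (u : nat -> R[i]^o) = L.
Proof.
move=> uL; apply/cvg_lim; first exact: norm_hausdorff.
apply/cvgrPdist_lt => e e0.
(* The radius ranges over positive elements of the complex field, which are real. *)
have eE : e = (RE e)%:C by apply/esym/RRe_real/gtr0_real.
have re0 : 0 < RE e by move: e0; rewrite {1}eE ltcR.
have : (fun n => K * (1 / 2) ^+ n) n @[n --> \oo] --> (0 : R).
  rewrite -[X in _ --> X](mulr0 K); apply: cvgM; first exact: cvg_cst.
  by apply: cvg_expr; rewrite ger0_norm; lra.
move=> /cvgrPdist_lt/(_ _ re0); apply: filterS => n.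
rewrite sub0r normrN => h.
have : nrm (L - u n) < RE e.
  by rewrite -nrmN opprB (le_lt_trans (uL n))// (le_lt_trans _ h)// ler_norm.
by rewrite eE -ltcR.
Qed.

Lemma pi2i_neq0 : (2 * pi) *i != 0 :> C.
Proof. by rewrite eq_complex /= eqxx /= mulf_neq0 ?pnatr_eq0// gt_eqF ?pi_gt0. Qed.

Section FixedPole.
Variables (b : R) (z : C) (d : R).
Hypothesis b0 : 0 < b.
Hypothesis d0 : 0 < d.
Hypothesis hd : forall x s v, sgn s -> 0 <= v -> d <= nrm (pw b (W x s v) - z).

Definition Q w : C := (pw b w - z)^-1.

Lemma den_adm X : adm th X (fun w => pw b w - z) (fun w => b%:C * pw b w).
Proof.
have [h1 h2 h3] := adm_pw th X b.
split => //; last by apply: moderateD => //; exact: moderate_cst.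
move=> x s v xX hs v0; have [g1 g2] := h1 x s v xX hs v0; split => //.
by have := holD g1 (holN (@hol_cst _ z (W x s v))); rewrite oppr0 addr0.
Qed.

Lemma Q_adm X : adm th X Q (fun w => - (b%:C * pw b w) / (pw b w - z) ^+ 2).
Proof. by apply: (adm_inv d0 _ (den_adm X)) => x s v _; exact: hd. Qed.

Lemma Q_tame x : tame th x Q.
Proof. by apply: (adm_tame (Q_adm (`|x| + 1))); rewrite ltrDl. Qed.

(** The separation [hd] is assumed at every starting point, so no pole is crossed when the contour
    moves. *)
Lemma pwQ_const x : hk th (fun w => pw 1 w * Q w) x = hk th (fun w => pw 1 w * Q w) 0.
Proof.
apply: (@hk_const _ _ th_gt th_le (`|x| + 1) _ _ _ _ (adm_M (adm_pw _ _ _) (Q_adm _))).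
- by rewrite ltrDl.
- by rewrite normr0 ltr_pwDr.
Qed.

(** Each step uses 1 / (P - z) = 1 / P + z / (P (P - z)) with P = zeta^b. The terms split off are
    values of [HH], independent of x, so x can be chosen afterwards to make the remainder small. *)
Lemma hk_expansion x n : hk th (fun w => pw 1 w * Q w) x =
  \sum_(0 <= k < n) z ^+ k * HH th (b * k%:R + b) +
  z ^+ n * hk th (fun w => pw (1 - b * n%:R) w * Q w) x.
Proof.
elim: n => [|n IH].
  by rewrite big_geq// add0r expr0 mul1r mulr0 subr0.
rewrite big_nat_recr//= IH -addrA; congr (_ + _).
have T : tame th x (fun w => pw (1 - b * n.+1%:R) w * Q w).
  by apply: tameM; [exact: tame_pw|exact: Q_tame].
have -> : hk th (fun w => pw (1 - b * n%:R) w * Q w) x =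
    hk th (fun w => pw (1 - (b * n%:R + b)) w + z * (pw (1 - b * n.+1%:R) w * Q w)) x.
  apply: eq_hk => s v hs v0.
  have q0 : pw b (W x s v) - z != 0 by rewrite -nrm_gt0 (lt_le_trans d0)// hd// ltW.
  have -> : 1 - b * n%:R = (1 - b * n.+1%:R) + b by rewrite -natr1; ring.
  have -> : 1 - (b * n%:R + b) = 1 - b * n.+1%:R by rewrite -natr1; ring.
  rewrite pwD /Q; move: q0; set p := pw b _; set q := pw (1 - _) _ => q0; field.
  exact: q0.
rewrite (hkD th_gt th_le (tame_pw _ _)); last by apply: tameM => //; exact: tame_cst.
rewrite (hkZ th_gt th_le _ T) (HHE th_gt th_le) exprS; ring.
Qed.

Lemma hk_expansion_rem : exists K, forall n,
  nrm (\sum_(0 <= k < n) z ^+ k * HH th (b * k%:R + b) - hk th (fun w => pw 1 w * Q w) 0) <=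
  K * (1 / 2) ^+ n.
Proof.
(* Here e^(b x) = e^(2 |z|) >= 1 + 2 |z|, so the geometric ratio |z| e^(- b x) is at most 1 / 2. *)
pose x := 2 * nrm z / b.
have hx : nrm z * expR (- (b * x)) <= 1 / 2.
  have -> : b * x = 2 * nrm z by rewrite /x mulrCA divff ?mulr1// gt_eqF.
  rewrite expRN ler_pdivrMr ?expR_gt0//.
  by have := expR_ge1Dx (2 * nrm z); lra.
have x0 : 0 <= x by rewrite divr_ge0 ?mulr_ge0 ?nrm_ge0// ltW.
have [M M0 hM] := hk_bound th_gt th_le x 1.
exists (M * (expR x / d)) => n.
rewrite -(pwQ_const x) (hk_expansion x n) opprD addrA subrr sub0r nrmN.
have T : tame th x (fun w => pw (1 - b * n%:R) w * Q w).
  by apply: tameM; [exact: tame_pw|exact: Q_tame].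
rewrite -(hkZ th_gt th_le _ T) -mulrA; apply: hM.
  by apply: tameM => //; exact: tame_cst.
move=> s v hs v0; rewrite nrmM nrmX nrmM nrmV nrm_pw /=.
have h1 : nrm z ^+ n * expR ((1 - b * n%:R) * (x + v)) <= (1 / 2) ^+ n * (expR x * expR (1 * v)).
  have -> : (1 - b * n%:R) * (x + v) = n%:R * (- (b * x)) + (x + 1 * v) - b * n%:R * v by ring.
  rewrite expRB expRD expRM_natl (expRD x).
  rewrite (_ : nrm z ^+ n * _ = (nrm z * expR (- (b * x))) ^+ n *
    (expR x * expR (1 * v) / expR (b * n%:R * v))); last by rewrite exprMn; ring.
  apply: ler_pM; rewrite ?exprn_ge0 ?mulr_ge0 ?nrm_ge0 ?expR_ge0 ?invr_ge0 ?expR_ge0//.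
    by rewrite lerXn2r ?nnegrE ?mulr_ge0 ?nrm_ge0 ?expR_ge0// divr_ge0.
  rewrite ler_piMr ?mulr_ge0 ?expR_ge0//.
  by rewrite invf_le1 ?expR_gt0// -[leLHS]expR0 ler_expR !mulr_ge0// ltW.
rewrite mulrA (_ : _ * expR (1 * v) = (1 / 2) ^+ n * (expR x * expR (1 * v)) / d); last by ring.
apply: ler_pM => //.
- by rewrite mulr_ge0 ?exprn_ge0 ?nrm_ge0 ?expR_ge0.
- by rewrite invr_ge0 nrm_ge0.
- have h := hd x hs (ltW v0); by rewrite lef_pV2 ?posrE// (lt_le_trans d0).
Qed.

Lemma ml_contour : mittag_leffler b b z = hk th (fun w => pw 1 w * Q w) 0 / (2 * pi) *i.
Proof.
have [K hK] := hk_expansion_rem.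
apply: (@limn_geometric _ _ (K / nrm ((2 * pi) *i))) => n.
have -> : series (fun k : nat => z ^+ k / (Gamma (b * k%:R + b))%:C) n =
    (\sum_(0 <= k < n) z ^+ k * HH th (b * k%:R + b)) / (2 * pi) *i.
  rewrite /series /= big_distrl /=; apply: eq_bigr => k _.
  have p0 : 0 < b * k%:R + b by rewrite ltr_wpDl// mulr_ge0// ltW.
  rewrite (HH_inv_Gamma th_gt th_le p0).
  have := pi2i_neq0; set q := _ *i => q0.
  by rewrite (mulrC q) !mulrA mulfK.
rewrite -mulrBl nrmM nrmV mulrAC ler_wpM2r ?invr_ge0 ?nrm_ge0//.
Qed.

End FixedPole.
End MLcontour.

(** * Estimates *)

Section Estimates.
Variable R : realType.
Local Notation C := R[i].
Implicit Types (z w : C) (x v c e s b t : R).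

Lemma sin_le (x : R) : 0 <= x -> sin x <= x.
Proof.
rewrite le_eqVlt => /predU1P[<-|x0]; first by rewrite sin0.
have h1 (y : R) : y \in `]0, x[ -> is_derive y (1 : R) sin (cos y) by move=> _; exact: is_derive_sin.
have h2 : {within `[0, x], continuous (@sin R)} by apply: continuous_subspaceT; exact: continuous_sin.
have [c _] := MVT x0 h1 h2.
by rewrite sin0 !subr0 => ->; rewrite ler_piMl ?cos_le1// ltW.
Qed.

Lemma cos_ge (x : R) : 0 <= x -> 1 - x <= cos x.
Proof.
rewrite le_eqVlt => /predU1P[<-|x0]; first by rewrite cos0 subr0.
have h1 (y : R) : y \in `]0, x[ -> is_derive y (1 : R) cos (- sin y) by move=> _; exact: is_derive_cos.
have h2 : {within `[0, x], continuous (@cos R)} by apply: continuous_subspaceT; exact: continuous_cos.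
have [c _] := MVT x0 h1 h2.
rewrite cos0 subr0 => h; have := sin_le1 c; have : cos x = 1 - sin c * x by lra.
by move=> -> k1; rewrite lerD2l lerN2 ler_piMl// ltW.
Qed.

Lemma nrm_cexpB1_le z : nrm (cexp z - 1) <= (`|RE z| + 2 * `|IM z|) * expR (Num.max 0 (RE z)).
Proof.
have hE : `|expR (RE z) - 1| <= `|RE z| * expR (Num.max 0 (RE z)).
  have [z0|z0] := lerP 0 (RE z).
    rewrite !ger0_norm ?subr_ge0 -?[leLHS]expR0 ?ler_expR//.
    have := expR_ge1Dx (- RE z); have e0 := expR_gt0 (RE z) => h.
    have := ler_wpM2l (ltW e0) h; rewrite -expRD subrr expR0; lra.
  rewrite expR0 mulr1 ler0_norm ?subr_le0 ?expR_le1 ?(ltW z0)// ltr0_norm//.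
  have := expR_ge1Dx (RE z); lra.
have hI : `|sin (IM z)| <= `|IM z|.
  wlog i0 : z {hE} / 0 <= IM z.
    move=> h; have [i0|i0] := lerP 0 (IM z); first exact: h.
    by have := h (RE z +i* - IM z); rewrite /= sinN !normrN; apply; rewrite oppr_ge0 ltW.
  have := sin_le i0; rewrite (ger0_norm i0) => h; rewrite ler_norml h andbT.
  have [ip|ip] := lerP (IM z) pi.
    by have := @sin_ge0_pi _ (IM z); rewrite i0 ip => /(_ isT); lra.
  have := sin_geN1 (IM z); have := pi_ge2 R; lra.
have hC : `|cos (IM z) - 1| <= `|IM z|.
  rewrite -cos_norm; have := cos_ge (normr_ge0 (IM z)); have := cos_le1 `|IM z| => h1 h2.
  by rewrite ler0_norm ?subr_le0//; lra.
have m0 : expR (RE z) <= expR (Num.max 0 (RE z)) by rewrite ler_expR le_max lexx orbT.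
have m1 : 1 <= expR (Num.max 0 (RE z)) by rewrite -[leLHS]expR0 ler_expR le_max lexx.
have e0 := expR_ge0 (RE z).
apply: (le_trans (nrm_le_ReIm _)); rewrite reD imD reN imN /= oppr0 addr0.
rewrite normrM (ger0_norm e0).
have -> : expR (RE z) * cos (IM z) - 1 = expR (RE z) * (cos (IM z) - 1) + (expR (RE z) - 1) by ring.
have t := ler_normD (expR (RE z) * (cos (IM z) - 1)) (expR (RE z) - 1).
rewrite normrM (ger0_norm e0) in t.
have p1 := ler_pM e0 (normr_ge0 _) m0 hC.
have p2 := ler_pM e0 (normr_ge0 _) m0 hI.
rewrite mulrDl; lra.
Qed.

(** Factoring out [pw q w] leaves e^((p - q) w) - 1; the two exponents add up to q Re w + max(0, (p
    - q) Re w), the maximum in the bound. *)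
Lemma pw_lip p q w : nrm (pw p w - pw q w) <=
  `|p - q| * ((`|RE w| + 2 * `|IM w|) * expR (Num.max (p * RE w) (q * RE w))).
Proof.
have -> : pw p w - pw q w = pw q w * (cexp ((p - q)%:C * w) - 1).
  have e : pw p w = pw q w * cexp ((p - q)%:C * w).
    by rewrite -[X in pw X w](subrK q) addrC pwD.
  by rewrite e mulrBr mulr1.
rewrite nrmM nrm_pw.
apply: (le_trans (ler_wpM2l (expR_ge0 _) (nrm_cexpB1_le _))).
rewrite reZ imZ !normrM.
have -> : `|p - q| * `|RE w| + 2 * (`|p - q| * `|IM w|) = `|p - q| * (`|RE w| + 2 * `|IM w|) by ring.
rewrite mulrCA -mulrA ler_wpM2l// ler_wpM2l ?addr_ge0 ?mulr_ge0//.
rewrite -expRD ler_expR addr_maxr addr0 le_eqVlt; apply/orP; left; apply/eqP.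
by rewrite maxC; congr (Num.max _ _); ring.
Qed.

(** The variation of D may have the wrong sign. But E1 - E2 >= E2 (b2 - b1) tau by e^y >= 1 + y, so
    for tau >= L / c0 the decay of the exponential absorbs it, and D1 E1 (b2 - b1), coming from the
    factor 1 - b, is left. *)
Lemma main_gap (c0 L tau b1 b2 D1 D2 : R) : 0 < tau -> 0 <= L -> L <= c0 * tau ->
  b1 < b2 -> b2 <= 1 -> c0 <= D1 -> D2 - D1 <= L * (b2 - b1) ->
  c0 * expR (- (b1 * tau)) * (b2 - b1) <=
    expR (- (b1 * tau)) * (1 - b1) * D1 - expR (- (b2 * tau)) * (1 - b2) * D2.
Proof.
move=> t0 L0 Lc b12 b21 cD DL.
set E1 := expR _; set E2 := expR (- (b2 * tau)).
have E20 : 0 < E2 by exact: expR_gt0.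
have E10 : 0 < E1 by exact: expR_gt0.
have h : E2 * (1 + (b2 - b1) * tau) <= E1.
  have -> : E1 = E2 * expR ((b2 - b1) * tau) by rewrite -expRD; congr expR; ring.
  by rewrite ler_wpM2l ?(ltW E20)// expR_ge1Dx.
have -> : E1 * (1 - b1) * D1 - E2 * (1 - b2) * D2 =
  D1 * ((1 - b2) * (E1 - E2) + E1 * (b2 - b1)) - E2 * (1 - b2) * (D2 - D1) by ring.
have c00 : 0 <= c0 by rewrite -(pmulr_lge0 _ t0); lra.
have b0 : 0 <= 1 - b2 by lra.
have db : 0 < b2 - b1 by lra.
have h1 : E2 * ((b2 - b1) * tau) <= E1 - E2 by lra.
have h2 := ler_wpM2l b0 h1.
have D10 : 0 <= D1 by lra.
have h3 := ler_wpM2l D10 h2.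
have h4 : L <= D1 * tau by apply: (le_trans Lc); rewrite ler_wpM2r// ltW.
have w0 : 0 <= (1 - b2) * E2 by rewrite mulr_ge0// ltW.
have h5 := ler_wpM2l (mulr_ge0 w0 (ltW db)) h4.
have h6 := ler_wpM2l w0 DL.
have h7 := ler_wpM2r (mulr_ge0 (ltW E10) (ltW db)) cD.
nra.
Qed.

Lemma exp_mul_bound (a y : R) : 0 < a -> 0 <= y -> y * expR (- (a * y)) <= a^-1.
Proof.
move=> a0 y0; rewrite expRN ler_pdivrMr ?expR_gt0// [leRHS]mulrC ler_pdivlMr// mulrC.
by apply: le_trans (expR_ge1Dx _); rewrite lerDr.
Qed.

(** Add Re s - Re z <= |s - z| and k (|s| - |z|) <= k |s - z|: the terms in |s| cancel and k |z|
    remains below (1 + k) |s - z|. *)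
Lemma cone_lower (k : R) (z s : C) : 0 <= k -> RE z <= - (2 * k * nrm z) -> - (k * nrm s) <= RE s ->
  k * nrm z / (1 + k) <= nrm (s - z).
Proof.
move=> k0 hz hs.
rewrite ler_pdivrMr; last by lra.
have h1 := nrm_sub_ge s z.
have h2 : RE s - RE z <= nrm (s - z).
  by have := normRe_le (s - z); rewrite reD reN; apply: le_trans; exact: ler_norm.
have h3 := ler_wpM2l k0 h1.
lra.
Qed.

(** Here v^(a - 1) <= 1 + v <= 2 e^(v / 2), and 2 e^(- v / 2) integrates to 4. *)
Lemma Gamma_le4 (a : R) : 1 <= a -> a <= 2 -> Gamma a <= 4.
Proof.
move=> a1 a2.
have -> : (4 : R) = 2 / (1 / 2) by field.
apply: (le_trans (ler_norm _)).
apply: (@rint_bound _ (gfun a)) => [v v0||v v0]; [exact: gfun_cont|by lra|].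
rewrite ger0_norm ?gfun_ge0// /gfun.
have -> : - v = - (1 / 2 * v) + - (v / 2) by field.
rewrite expRD mulrCA mulrC ler_wpM2r ?expR_ge0// expRN ler_pdivrMr ?expR_gt0//.
have h := expR_ge1Dx (v / 2).
suff : v `^ (a - 1) <= 1 + v by lra.
have [v1|v1] := lerP v 1.
  apply: (@le_trans _ _ 1); last by lra.
  by rewrite -[leRHS](powRr0 v); apply: ger_powR; [rewrite v0|lra].
apply: (@le_trans _ _ v); last by lra.
have q : a - 1 <= 1 by lra.
by have := ler_powR (ltW v1) q; rewrite powRr1// ltW.
Qed.

End Estimates.

(** * Injectivity in the order of differentiation *)

Section Injectivity.
Variable R : realType.
Local Notation C := R[i].
Implicit Types (z w : C) (x v c e s b t tau : R).
Variables (lam : C) (beta0 : R).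
Hypothesis lam_lt0 : RE lam < 0.
Hypothesis beta0_gt0 : 0 < beta0.

(** Half of - cos(arg lam). The contour of opening acos(- k) stays in the cone Re s >= - k |s|,
    whereas Re lam = - 2 k |lam|; the factor 2 is the room between them. *)
Let k : R := - RE lam / (2 * nrm lam).

Lemma lam_neq0 : lam != 0.
Proof. by apply/eqP => l0; move: lam_lt0; rewrite l0 ltxx. Qed.

Lemma nlam_gt0 : 0 < nrm lam. Proof. by rewrite nrm_gt0 lam_neq0. Qed.

Lemma k_gt0 : 0 < k.
Proof. by rewrite divr_gt0 ?oppr_gt0// mulr_gt0 ?nlam_gt0. Qed.

Lemma k_le : k <= 1 / 2.
Proof.
rewrite ler_pdivrMr ?mulr_gt0 ?nlam_gt0//.
have := normRe_le lam; have := ler_norm (- RE lam); rewrite normrN; lra.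
Qed.

Lemma Re_lam : RE lam = - (2 * k * nrm lam).
Proof. by rewrite /k; field; rewrite gt_eqF ?nlam_gt0. Qed.

Definition theta : R := acos (- k).

Lemma k_itv : -1 <= - k <= 1.
Proof. by have := k_gt0; have := k_le => *; apply/andP; split; lra. Qed.

Lemma cos_theta : cos theta = - k.
Proof. by rewrite acosK// in_itv /= k_itv. Qed.

Lemma theta_le : theta <= pi. Proof. exact/acos_lepi/k_itv. Qed.

Lemma theta_gt : pi / 2 < theta.
Proof.
have p0 := pi_gt0 R.
have th0 : 0 <= theta <= pi by rewrite /theta acos_ge0 ?acos_lepi ?k_itv.
rewrite -ltr_cos ?in_itv //=; last by apply/andP; split; lra.
by rewrite cos_theta cos_pihalf oppr_lt0 k_gt0.
Qed.

Local Notation th := theta.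
Local Notation sgn := (sgn theta).
Let tg := theta_gt.
Let tl := theta_le.

(** For b <= 1 the power zeta^b only narrows the angle, so a single cone contains these curves for
    all b and all starting points. *)
Lemma pw_cone b x s v : 0 <= b -> b <= 1 -> sgn s -> 0 <= v ->
  - (k * nrm (pw b (W x s v))) <= RE (pw b (W x s v)).
Proof.
move=> b0 b1 hs v0; rewrite nrm_pw.
have -> : RE (pw b (W x s v)) = expR (b * RE (W x s v)) * cos (b * IM (W x s v)).
  have h u : RE (cexp u) = expR (RE u) * cos (IM u) by [].
  by rewrite h reZ imZ.
suff : - k <= cos (b * IM (W x s v)).
  by move=> h; have := ler_wpM2l (expR_ge0 (b * RE (W x s v))) h; lra.
rewrite -cos_theta -[leRHS]cos_norm.
have ht : 0 <= theta by rewrite ltW// (th_gt0 tg).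
have hle : `|b * IM (W x s v)| <= theta.
  rewrite /= !normrM (sgn_norm tg hs) (ger0_norm b0) (ger0_norm (angle_ge0 v0)).
  have a1 := angle_le1 v; have a0 := angle_ge0 v0.
  have : b * (theta * (1 - expR (- v))) <= theta * (1 - expR (- v)) by rewrite ler_piMl ?mulr_ge0.
  by move=> /le_trans; apply; rewrite ler_piMr.
rewrite leNgt ltr_cos ?in_itv /= -?leNgt ?hle ?ht ?tl ?normr_ge0 ?(le_trans hle tl)//.
Qed.

Definition dl : R := k * nrm lam / (1 + k).

Lemma dl_gt0 : 0 < dl.
Proof.
have := k_gt0 => k0.
by apply: divr_gt0; [rewrite mulr_gt0 ?nlam_gt0|lra].
Qed.

Definition pt tau b w : C := (expR (- (b * tau)))%:C * pw b w.
Definition Sf tau b w : C := pt tau b w * pt tau b w * (pt tau b w - lam)^-1.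

Lemma nrm_pt tau b w : nrm (pt tau b w) = expR (b * (RE w - tau)).
Proof.
rewrite nrmM nrmC ger0_norm ?expR_ge0// nrm_pw -expRD; congr expR; ring.
Qed.

(** Dividing by t^b is a positive scaling and preserves the cone; the bound [dl] depends neither on
    t nor on b. *)
Lemma pt_lower tau b x s v : 0 <= b -> b <= 1 -> sgn s -> 0 <= v ->
  dl <= nrm (pt tau b (W x s v) - lam).
Proof.
move=> b0 b1 hs v0; apply: cone_lower; first exact: ltW k_gt0.
  by rewrite Re_lam.
rewrite /pt nrmM reZ nrmC ger0_norm ?expR_ge0//.
have := ler_wpM2l (expR_ge0 (- (b * tau))) (pw_cone x b0 b1 hs v0); lra.
Qed.

Lemma pt_neq tau b x s v : 0 <= b -> b <= 1 -> sgn s -> 0 <= v ->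
  pt tau b (W x s v) - lam != 0.
Proof.
by move=> b0 b1 hs v0; rewrite -nrm_gt0 (lt_le_trans dl_gt0)// pt_lower.
Qed.

Lemma tame_pt tau b x : tame th x (pt tau b).
Proof. by apply: tameM; [exact: tame_cst|exact: tame_pw]. Qed.

Lemma tame_Sf tau b x : 0 <= b -> b <= 1 -> tame th x (Sf tau b).
Proof.
move=> b0 b1; apply: tameM; first by apply: tameM; exact: tame_pt.
apply: (tameV (G := fun w => pt tau b w - lam) dl_gt0); first by move=> s v; exact: pt_lower.
move=> s v _ _; eexists; apply: holD; last by apply: holN; exact: hol_cst.
apply: holM; [exact: hol_cst|exact: pw_hol].
Qed.

Lemma RL_formula b t : 0 < b -> b <= 1 -> 0 < t ->
  lam ^+ 2 * t%:C * (2 * pi) *i * RL_factor lam b t =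
  (expR (- (b * ln t)) * (b * (1 - b)))%:C * HH th (2 - b) +
  hk th (fun w => pw 1 w * Sf (ln t) b w) 0.
Proof.
move=> b0 b1 t0.
pose T := t `^ b.
have TE : T = expR (b * ln t) by rewrite /T /powR gt_eqF.
have T0 : 0 < T by rewrite TE expR_gt0.
pose z := lam * T%:C.
have nz : nrm z = nrm lam * T by rewrite nrmM nrmC gtr0_norm.
have hd x s v : sgn s -> 0 <= v -> k * nrm z / (1 + k) <= nrm (pw b (W x s v) - z).
  move=> hs v0; apply: cone_lower; first exact: ltW k_gt0.
    by rewrite nz /z mulrC reZ Re_lam; lra.
  exact: (pw_cone x (ltW b0) b1 hs v0).
have d0 : 0 < k * nrm z / (1 + k).
  have k0 := k_gt0; rewrite nz; apply: divr_gt0; last by lra.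
  apply: mulr_gt0 => //; apply: mulr_gt0 => //; exact: nlam_gt0.
rewrite /RL_factor -/T -/z (ml_contour tg tl b0 d0 hd).
have q0 := @pi2i_neq0 R.
have tT : t%:C * (t `^ (b - 1))%:C = T%:C by rewrite -rmorphM mulr_powRB1// ltW.
rewrite (_ : _ * _ = lam ^+ 2 * T%:C * hk th (fun w => pw 1 w * Q b z w) 0); last first.
  rewrite -tT; move: q0; set q := _ *i => q0; field; exact: q0.
have TQ : tame th 0 (Q b z) by exact: (Q_tame d0 hd).
rewrite -(hkZ tg tl); last by apply: tameM => //; exact: tame_pw.
(* With p = (zeta / t)^b this is lam^2 / (p - lam) = - lam - p + p^2 / (p - lam). *)
rewrite (@eq_hk _ _ _ _ (fun w => - lam * pw 1 w + (- (expR (- (b * ln t)))%:C * pw (1 + b) w + pw 1 w * Sf (ln t) b w))); last first.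
  move=> s v hs v0.
  have p0 := pt_neq (ln t) 0 (ltW b0) b1 hs (ltW v0).
  have TN : T%:C != 0 :> C by rewrite fmorph_eq0 gt_eqF.
  have rE : (expR (- (b * ln t)))%:C = (T%:C)^-1 :> C by rewrite expRN -TE fmorphV.
  rewrite pwD /Q /z /Sf; move: p0; rewrite /pt rE.
  set P := pw b _; set O := pw 1 _; move=> p0.
  have h : P - lam * T%:C != 0.
    by move: p0; apply: contra_neq => h; apply: (mulfI TN); rewrite mulr0 mulrBr mulrA divff// mul1r mulrC.
  by field; move: h; rewrite TN /= -mulNr.
have S0 : tame th 0 (Sf (ln t) b) by apply: tame_Sf => //; exact: ltW.
have P0 a : tame th 0 (pw a) by exact: tame_pw.
have Z0 a (c : C) : tame th 0 (fun w => c * pw a w) by apply: tameM => //; exact: tame_cst.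
have PS : tame th 0 (fun w => pw 1 w * Sf (ln t) b w) by exact: tameM.
rewrite (hkD tg tl (Z0 _ _) (tameD (Z0 _ _) PS)) (hkD tg tl (Z0 _ _) PS) !(hkZ tg tl _ (P0 _)).
(* The first term is a multiple of 1 / Gamma(0) = 0. *)
have -> : hk th (pw 1) 0 = 0 by have := HH0 tg tl; rewrite /HH subr0.
(* Two uses of the recurrence move the argument from - b, where Euler's integral diverges, to 2 - b
   >= 1. *)
have -> : hk th (pw (1 + b)) 0 = (- (b * (1 - b)))%:C * HH th (2 - b).
  have := HH_rec tg tl (- b); rewrite {1}/HH opprK => ->.
  rewrite (_ : - b + 1 = 1 - b); last by ring.
  rewrite (HH_rec tg tl (1 - b)) mulrA -rmorphM; congr (_%:C * HH _ _); ring.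
rewrite mulr0 add0r; congr (_ + _).
rewrite mulrA; congr (_ * _); rewrite -rmorphN -rmorphM; congr (_%:C); ring.
Qed.

End Injectivity.

(** * Lipschitz bounds in the order, and injectivity for large t *)

Section Uniqueness.
Variable R : realType.
Local Notation C := R[i].
Implicit Types (z w : C) (x v c e s b t tau : R).

(** Here l stands for v - ln t. For l < 0 the product decays like e^(2 b1 l) with 2 b1 >= b1 +
    beta0: half of the spare beta0 absorbs the factor |l|, the other half is the gain beta0 / 2 over
    the main term. For l >= 0 the factors are at most constants times e^l, e^l and e^(2 l), whence
    the 4. *)
Lemma log_growth beta0 b1 b2 l m : 0 < beta0 -> beta0 <= b1 -> b1 <= b2 -> b2 <= 1 ->
  m = Num.max (b1 * l) (b2 * l) ->
  (`|l| + 2 * pi) * expR m * expR (Num.max m (2 * m)) <=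
  (2 / beta0 + 2 * pi + (1 + 2 * pi)) * expR (Num.max ((b1 + beta0 / 2) * l) (4 * l)).
Proof.
move=> b0 b01 b12 b21 m_def; have p0 := pi_gt0 R.
have [l0|l0] := lerP 0 l.
- have hm : m <= l.
    rewrite m_def ge_max; apply/andP; split; rewrite ler_piMl//; lra.
  have hmm : Num.max m (2 * m) <= 2 * l by rewrite ge_max; apply/andP; split; lra.
  have hl : `|l| + 2 * pi <= (1 + 2 * pi) * expR l.
    rewrite ger0_norm//; have h := expR_ge1Dx l.
    by have := ler_wpM2l (ltW p0) (_ : 1 <= expR l); [move=> /(_ ltac:(lra)); lra].
  apply: (@le_trans _ _ ((1 + 2 * pi) * expR (4 * l))).
    have -> : 4 * l = l + l + 2 * l by ring.
    rewrite 2!expRD !mulrA; apply: ler_pM; rewrite ?mulr_ge0 ?addr_ge0 ?mulr_ge0 ?expR_ge0 ?ler_expR ?(ltW p0)//.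
    by apply: ler_pM; rewrite ?addr_ge0 ?mulr_ge0 ?expR_ge0 ?ler_expR ?(ltW p0).
  apply: ler_pM; rewrite ?expR_ge0 ?ler_expR ?le_max ?lexx ?orbT//; first lra.
  by rewrite lerDr addr_ge0 ?divr_ge0 ?mulr_ge0 ?(ltW p0)// ltW.
- have mE : m = b1 * l by rewrite m_def; apply/max_idPl; rewrite ler_wnM2r// ltW.
  have -> : Num.max m (2 * m) = m.
    have ml0 : b1 * l <= 0 by rewrite mulr_ge0_le0 ?(ltW l0)//; lra.
    by apply/max_idPl; rewrite mE; lra.
  apply: (@le_trans _ _ ((2 / beta0 + 2 * pi) * expR ((b1 + beta0 / 2) * l))); last first.
    apply: ler_pM; rewrite ?expR_ge0 ?ler_expR ?le_max ?lexx//.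
      by rewrite addr_ge0 ?divr_ge0 ?mulr_ge0 ?(ltW p0)// ltW.
    by rewrite lerDl; lra.
  have hm : m + m <= beta0 / 2 * l + (b1 + beta0 / 2) * l.
    have h : (b1 - beta0) * l <= 0 by rewrite mulr_ge0_le0 ?(ltW l0)//; lra.
    by rewrite mE; lra.
  rewrite -mulrA -expRD.
  apply: (@le_trans _ _ ((`|l| + 2 * pi) * (expR (beta0 / 2 * l) * expR ((b1 + beta0 / 2) * l)))).
    by rewrite ler_wpM2l ?addr_ge0 ?mulr_ge0 ?(ltW p0)// -expRD ler_expR.
  rewrite mulrA ler_wpM2r ?expR_ge0// mulrDl lerD//.
    have := @exp_mul_bound R (beta0 / 2) `|l| ltac:(lra) (normr_ge0 _).
    by rewrite ltr0_norm// mulrN opprK invf_div.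
  rewrite ler_piMr ?mulr_ge0 ?(ltW p0)// expR_le1 mulr_ge0_le0 ?(ltW l0)//; lra.
Qed.

Lemma sub_eq_sub (x y h k : C) : x + h = y + k -> x - y = k - h.
Proof. by move=> e; apply: (addIr (y + h)); rewrite addrA subrK [RHS]addrCA subrK e. Qed.

Lemma mul_lip (b1 b2 g1 g2 g L : R) : 0 <= L -> 0 <= b1 -> b1 <= b2 -> b2 <= 1 ->
  g2 - g1 <= L * (b2 - b1) -> g2 <= g + L ->
  b2 * g2 - b1 * g1 <= (g + L + L) * (b2 - b1).
Proof.
move=> L0 b10 b12 b21 h1 h2.
have db : 0 <= b2 - b1 by lra.
have h3 := ler_wpM2l b10 h1.
have h4 := ler_wpM2l db h2.
have b11 : b1 <= 1 by lra.
have h5 := ler_piMl (mulr_ge0 L0 db) b11.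
lra.
Qed.

Variables (lam : C) (beta0 : R).
Hypothesis lam_lt0 : RE lam < 0.
Hypothesis beta0_gt0 : 0 < beta0.
Local Notation th := (theta lam).
Local Notation sgn := (sgn th).
Let tg := theta_gt lam_lt0.
Let tl := theta_le lam_lt0.

Lemma im_W_le x s v : sgn s -> 0 <= v -> `|IM (W x s v)| <= pi.
Proof.
move=> hs v0; rewrite /= normrM (sgn_norm tg hs) (ger0_norm (angle_ge0 v0)).
by have /andP[_] := angle_pi tg tl v0.
Qed.

Lemma ptE tau b w : pt tau b w = pw b (w - tau%:C).
Proof.
rewrite /pt -cexpC /pw -cexpD; congr cexp.
by rewrite mulrBr addrC -rmorphM -rmorphN.
Qed.

Lemma ptB_le tau b1 b2 s v : b1 <= b2 -> sgn s -> 0 <= v ->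
  nrm (pt tau b1 (W 0 s v) - pt tau b2 (W 0 s v)) <= (b2 - b1) *
    ((`|v - tau| + 2 * pi) * expR (Num.max (b1 * (v - tau)) (b2 * (v - tau)))).
Proof.
move=> b12 hs v0; rewrite !ptE.
have rE : RE (W 0 s v - tau%:C) = v - tau by rewrite reD reN /= add0r.
have iE : IM (W 0 s v - tau%:C) = IM (W 0 s v) by rewrite imD imN /= oppr0 addr0.
apply: (le_trans (pw_lip _ _ _)); rewrite rE iE.
rewrite distrC ger0_norm ?subr_ge0// ler_wpM2l ?subr_ge0//.
rewrite ler_wpM2r ?expR_ge0// lerD2l ler_wpM2l//; exact: im_W_le.
Qed.

Lemma Sf_lip : exists2 K, 0 < K & forall tau b1 b2 s v, 0 <= tau ->
  beta0 <= b1 -> b1 <= b2 -> b2 <= 1 -> sgn s -> 0 < v ->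
  nrm (Sf lam tau b1 (W 0 s v) - Sf lam tau b2 (W 0 s v)) <=
    K * (b2 - b1) * expR (- ((b1 + beta0 / 2) * tau)) * expR (4 * v).
Proof.
have bg := beta0_gt0; have d0 := dl_gt0 lam_lt0; have p0 := pi_gt0 R.
pose K0 : R := 2 / beta0 + 2 * pi + (1 + 2 * pi).
have K00 : 0 < K0.
  have : 0 < 2 / beta0 by rewrite divr_gt0.
  rewrite /K0; lra.
have A0 : 0 < 1 + 2 * nrm lam by have := nrm_ge0 lam; lra.
exists (K0 * (1 + 2 * nrm lam) / dl lam ^+ 2); first exact: (divr_gt0 (mulr_gt0 K00 A0) (exprn_gt0 2 d0)).
move=> tau b1 b2 s v t0 b01 b12 b21 hs v0.
pose l := v - tau; pose m := Num.max (b1 * l) (b2 * l).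
have b1p : 0 <= b1 by lra.
have b2p : 0 <= b2 by lra.
have b11 : b1 <= 1 by lra.
have N1 := pt_neq lam_lt0 tau 0 b1p b11 hs (ltW v0).
have N2 := pt_neq lam_lt0 tau 0 b2p b21 hs (ltW v0).
have L1 := pt_lower lam_lt0 tau 0 b1p b11 hs (ltW v0).
have L2 := pt_lower lam_lt0 tau 0 b2p b21 hs (ltW v0).
have hpq := ptB_le tau b12 hs (ltW v0).
have n1 : nrm (pt tau b1 (W 0 s v)) <= expR m.
  by rewrite nrm_pt /= add0r ler_expR le_max lexx.
have n2 : nrm (pt tau b2 (W 0 s v)) <= expR m.
  by rewrite nrm_pt /= add0r ler_expR le_max lexx orbT.
rewrite /Sf; move: N1 N2 L1 L2 hpq n1 n2; rewrite -/l -/m.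
set P := pt _ b1 _; set q := pt _ b2 _; clearbody P q => N1 N2 L1 L2 hpq n1 n2.
(* The factor P - q supplies b2 - b1. The next one is of the size of P and q, and so brings the
   second power of decay for v < tau. *)
have -> : P * P / (P - lam) - q * q / (q - lam) =
    (P - q) * (P * q - lam * (P + q)) * ((P - lam)^-1 * (q - lam)^-1).
  by field; rewrite N1 N2.
have hV : nrm ((P - lam)^-1 * (q - lam)^-1) <= (dl lam ^+ 2)^-1.
  rewrite nrmM !nrmV expr2 invfM; apply: ler_pM; rewrite ?invr_ge0 ?nrm_ge0//.
  - by rewrite lef_pV2// posrE// nrm_gt0.
  - by rewrite lef_pV2// posrE// nrm_gt0.
have hN : nrm (P * q - lam * (P + q)) <= (1 + 2 * nrm lam) * expR (Num.max m (2 * m)).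
  apply: (le_trans (ler_nrmB _ _)); rewrite !nrmM mulrDl mul1r; apply: lerD.
    apply: (le_trans (ler_pM (nrm_ge0 _) (nrm_ge0 _) n1 n2)).
    have mm : m + m = 2 * m by ring.
    by rewrite -expRD ler_expR mm le_max lexx orbT.
  have -> : 2 * nrm lam * expR (Num.max m (2 * m)) = nrm lam * (2 * expR (Num.max m (2 * m))) by ring.
  rewrite ler_wpM2l ?nrm_ge0//; apply: (le_trans (ler_nrmD _ _)).
  have : expR m <= expR (Num.max m (2 * m)) by rewrite ler_expR le_max lexx.
  lra.
rewrite nrmM nrmM.
have h1 := ler_pM (nrm_ge0 _) (nrm_ge0 _) hpq hN.
have h2 := ler_pM (mulr_ge0 (nrm_ge0 _) (nrm_ge0 _)) (nrm_ge0 _) h1 hV.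
apply: (le_trans h2).
have db : 0 <= b2 - b1 by lra.
have lg := log_growth beta0_gt0 b01 b12 b21 (erefl m).
have ex : expR (Num.max ((b1 + beta0 / 2) * l) (4 * l)) <=
    expR (- ((b1 + beta0 / 2) * tau)) * expR (4 * v).
  rewrite -expRD ler_expR ge_max /l; apply/andP; split.
    have : (b1 + beta0 / 2) * v <= 4 * v by rewrite ler_wpM2r ?(ltW v0)//; lra.
    lra.
  have : (b1 + beta0 / 2) * tau <= 4 * tau by rewrite ler_wpM2r//; lra.
  lra.
have {}lg := le_trans lg (ler_wpM2l (ltW K00) ex).
have cf : 0 <= (b2 - b1) * (1 + 2 * nrm lam) / dl lam ^+ 2.
  exact: (divr_ge0 (mulr_ge0 db (ltW A0)) (exprn_ge0 2 (ltW d0))).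
have := ler_wpM2l cf lg.
rewrite -/m; move: (expR m) (expR (Num.max m _)) (expR (- _)) (expR (4 * v)) => a1 a2 a3 a4.
rewrite (_ : (b2 - b1) * (1 + 2 * nrm lam) / dl lam ^+ 2 * ((`|l| + 2 * pi) * a1 * a2) =
  (b2 - b1) * ((`|l| + 2 * pi) * a1) * ((1 + 2 * nrm lam) * a2) / dl lam ^+ 2); last by ring.
move=> /le_trans; apply; rewrite le_eqVlt; apply/orP; left; apply/eqP; ring.
Qed.

(** Both reciprocals are Hankel integrals over one contour, so the Lipschitz bound of [pw] in its
    exponent passes through the integral. For arguments at least 1 the exponents 1 - a are
    nonpositive and cause no growth. *)
Lemma inv_Gamma_lip : exists2 L, 0 < L & forall a1 a2 : R, 1 <= a1 -> 1 <= a2 ->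
  `|(Gamma a1)^-1 - (Gamma a2)^-1| <= L * `|a1 - a2|.
Proof.
have p0 := pi_gt0 R.
have [M M0 hM] := hk_bound tg tl 0 1.
have L0 : 0 < M * (1 + 2 * pi) / (2 * pi) by rewrite divr_gt0 ?mulr_gt0//; lra.
exists (M * (1 + 2 * pi) / (2 * pi)) => // a1 a2 h1 h2.
have G1 := @HH_inv_Gamma R th tg tl a1 ltac:(lra).
have G2 := @HH_inv_Gamma R th tg tl a2 ltac:(lra).
have P a : tame th 0 (pw a) by exact: tame_pw.
have E : hk th (fun w => pw (1 - a1) w + - pw (1 - a2) w) 0 =
    (2 * pi) *i * ((Gamma a1)^-1 - (Gamma a2)^-1)%:C.
  rewrite (hkD tg tl (P _) (tameN (P _))) (hkN tg tl (P _)) -/(HH th a1) -/(HH th a2) G1 G2.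
  by rewrite rmorphB mulrBr !fmorphV.
have := hM _ (`|a1 - a2| * (1 + 2 * pi)) (tameD (P (1 - a1)) (tameN (P (1 - a2)))).
rewrite E nrmM nrmC.
have -> : nrm ((2 * pi)*i : C) = 2 * pi.
  by rewrite /Normc.normc expr0n add0r sqrtr_sqr ger0_norm// mulr_ge0// ltW.
move=> h; rewrite mulrAC ler_pdivlMr ?mulr_gt0// [leLHS]mulrC.
rewrite (_ : M * (1 + 2 * pi) * `|a1 - a2| = M * (`|a1 - a2| * (1 + 2 * pi))); last by ring.
apply: h => s v hs v0; apply: (le_trans (pw_lip _ _ _)).
have -> : 1 - a1 - (1 - a2) = - (a1 - a2) by ring.
rewrite normrN -mulrA ler_wpM2l// mul1r.
have rE : RE (W 0 s v) = v by rewrite /= add0r.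
rewrite rE gtr0_norm//.
have hi := im_W_le 0 hs (ltW v0).
have e1 := expR_ge1Dx v.
have hv : v + 2 * `|IM (W 0 s v)| <= (1 + 2 * pi) * expR v.
  have : pi * 1 <= pi * expR v by rewrite ler_wpM2l ?(ltW p0)//; lra.
  lra.
apply: le_trans hv; rewrite ler_piMr ?addr_ge0 ?mulr_ge0 ?(ltW v0)//.
rewrite expR_le1 ge_max; apply/andP; split; rewrite mulr_le0_ge0 ?(ltW v0)//; lra.
Qed.

Lemma ratio_Gamma_lower b : beta0 <= b -> b <= 1 -> beta0 / 4 <= b / Gamma (2 - b).
Proof.
move=> b0 b1; have bg := beta0_gt0.
have l1 : 1 <= 2 - b by lra.
have l2 : 2 - b <= 2 by lra.
rewrite ler_pdivlMr; last by apply: (Gamma_gt0 tg tl); lra.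
have := Gamma_le4 l1 l2; have b4 : 0 <= beta0 / 4 by lra.
by move=> /(ler_wpM2l b4) /le_trans; apply; lra.
Qed.

Lemma ratio_Gamma_lip : exists2 L, 0 < L & forall b1 b2, 0 <= b1 -> b1 <= b2 -> b2 <= 1 ->
  b2 / Gamma (2 - b2) - b1 / Gamma (2 - b1) <= L * (b2 - b1).
Proof.
have B b : b <= 1 -> 1 <= 2 - b by lra.
have [L L0 hL] := inv_Gamma_lip.
exists ((Gamma 1)^-1 + L + L); first by rewrite !addr_gt0 ?invr_gt0 ?(Gamma_gt0 tg tl).
move=> b1 b2 b10 b12 b21; apply: mul_lip => //; first exact: ltW.
  have -> : b2 - b1 = `|2 - b2 - (2 - b1)|.
    have -> : 2 - b2 - (2 - b1) = - (b2 - b1) by ring.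
    by rewrite normrN ger0_norm ?subr_ge0.
  apply: le_trans (ler_norm _) (hL _ _ (B _ b21) (B _ _)); exact: le_trans b21.
rewrite -lerBlDl; apply: (le_trans (ler_norm _)).
apply: (le_trans (hL _ _ (B _ b21) (lexx 1))).
have -> : 2 - b2 - 1 = 1 - b2 by ring.
rewrite ler_piMr ?(ltW L0)// ger0_norm ?subr_ge0//.
by rewrite gerBl (le_trans b10).
Qed.

(** The gain e^(- beta0 tau / 2) beats K / c0, again by e^y >= 1 + y. *)
Lemma remainder_small (c0 K tau b1 d : R) : 0 < c0 -> 0 < d -> 0 <= tau ->
  2 / beta0 * (K / c0) < tau ->
  K * (d * expR (- ((b1 + beta0 / 2) * tau))) < c0 * expR (- (b1 * tau)) * d.
Proof.
move=> c00 d0 t0 hK; have bg := beta0_gt0.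
rewrite mulrDl opprD expRD.
rewrite (_ : K * _ = K * expR (- (beta0 / 2 * tau)) * (expR (- (b1 * tau)) * d)); last by ring.
rewrite -[ltRHS]mulrA ltr_pM2r ?mulr_gt0 ?expR_gt0//.
rewrite expRN ltr_pdivrMr ?expR_gt0// -ltr_pdivrMl// mulrC.
apply: lt_le_trans (expR_ge1Dx _).
have b20 : 0 < beta0 / 2 by lra.
rewrite -(ltr_pM2l b20) in hK.
have e : beta0 / 2 * (2 / beta0 * (K / c0)) = K / c0 by field; rewrite !gt_eqF.
rewrite e in hK; lra.
Qed.

Lemma RL_inj : exists2 T, 1 < T & forall t b1 b2, T < t ->
  beta0 <= b1 <= 1 -> beta0 <= b2 <= 1 ->
  RL_factor lam b1 t = RL_factor lam b2 t -> b1 = b2.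
Proof.
have bg := beta0_gt0; have p0 := pi_gt0 R.
have [K K0 hK] := Sf_lip; have [L L0 hL] := ratio_Gamma_lip.
(* The growth rate 5 is 4 from [Sf_lip] and 1 from the factor [pw 1]. *)
have [M M0 hM] := hk_bound tg tl 0 5.
pose c0 := beta0 / 4.
have c00 : 0 < c0 by rewrite /c0 divr_gt0.
have c10 : 0 < 2 * pi * c0 by rewrite !mulr_gt0.
have T1 : 0 < L / c0 by rewrite divr_gt0.
have T2 : 0 < 2 / beta0 * (M * K / (2 * pi * c0)).
  exact: (mulr_gt0 (divr_gt0 _ bg) (divr_gt0 (mulr_gt0 M0 K0) c10)).
(* The first summand is the threshold of [main_gap], the second that of [remainder_small] with
   constants M K and 2 pi c0. *)
pose tau0 := L / c0 + 2 / beta0 * (M * K / (2 * pi * c0)).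
exists (expR tau0); first by rewrite expR_gt1 addr_gt0.
move=> t b1 b2 Tt.
wlog b12 : b1 b2 / b1 < b2.
  move=> H h1 h2 E; have [|h|//] := ltgtP b1 b2; first by move=> h; exact: (H _ _ h).
  by apply/esym; exact: (H _ _ h h2 h1 (esym E)).
move=> /andP[b01 b11] /andP[b02 b21] E; exfalso.
have t0 : 0 < t by apply: lt_trans Tt; exact: expR_gt0.
pose tau := ln t.
have tT : tau0 < tau by rewrite -ltr_expR lnK.
have tau_gt0 : 0 < tau by apply: lt_trans tT; rewrite addr_gt0.
have main b : beta0 <= b -> b <= 1 -> lam ^+ 2 * t%:C * (2 * pi) *i * RL_factor lam b t =
    (expR (- (b * tau)) * (1 - b) * (b / Gamma (2 - b)))%:C * (2 * pi)*i +
    hk th (fun w => pw 1 w * Sf lam tau b w) 0.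
  move=> h1 h2.
  rewrite RL_formula//; last exact: lt_le_trans h1.
  congr (_ + _); rewrite (HH_inv_Gamma tg tl); last by lra.
  by rewrite -fmorphV mulrCA -rmorphM [RHS]mulrC; congr (_ * _%:C); ring.
have TS b : beta0 <= b -> b <= 1 -> tame th 0 (fun w => pw 1 w * Sf lam tau b w).
  move=> h1 h2; apply: tameM; first exact: tame_pw.
  by apply: (tame_Sf lam_lt0) => //; exact: le_trans (ltW bg) h1.
have T1' := TS b1 b01 b11; have T2' := TS b2 b02 b21.
pose m b := expR (- (b * tau)) * (1 - b) * (b / Gamma (2 - b)).
have eqm : (m b2 - m b1)%:C * (2 * pi)*i =
    hk th (fun w => pw 1 w * Sf lam tau b1 w + - (pw 1 w * Sf lam tau b2 w)) 0.
  rewrite (hkD tg tl T1' (tameN T2')) (hkN tg tl T2').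
  have := main b1 b01 b11; rewrite E (main b2 b02 b21) -/(m b1) -/(m b2) rmorphB mulrBl.
  exact: sub_eq_sub.
have db : 0 < b2 - b1 by rewrite subr_gt0.
have up : nrm ((m b2 - m b1)%:C * (2 * pi)*i) <=
    M * (K * (b2 - b1) * expR (- ((b1 + beta0 / 2) * tau))).
  rewrite eqm; apply: hM; first exact: tameD T1' (tameN T2').
  move=> s v hs v0; rewrite -mulrBr nrmM nrm_pw /= add0r mul1r.
  have -> : 5 * v = v + 4 * v by ring.
  rewrite expRD [X in _ <= X]mulrCA ler_wpM2l ?expR_ge0//.
  by apply: hK => //; exact: ltW.
have low : c0 * expR (- (b1 * tau)) * (b2 - b1) <= m b1 - m b2.
  apply: (@main_gap R c0 L tau b1 b2 _ _ tau_gt0 (ltW L0) _ b12 b21).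
  - rewrite mulrC -ler_pdivrMr//; apply/ltW; apply: le_lt_trans tT.
    by rewrite lerDl ltW.
  - exact: ratio_Gamma_lower.
  - by apply: hL => //; [exact: le_trans (ltW bg) b01|exact: ltW].
have h5 : 2 / beta0 * (M * K / (2 * pi * c0)) < tau.
  by apply: le_lt_trans tT; rewrite lerDr ltW.
have := remainder_small b1 c10 db (ltW tau_gt0) h5; apply/negP; rewrite -leNgt.
rewrite -[K * _ * _]mulrA mulrA in up.
apply: le_trans up; rewrite nrmM nrmC distrC.
have -> : nrm ((2 * pi)*i : C) = 2 * pi by rewrite /Normc.normc expr0n add0r sqrtr_sqr gtr0_norm ?mulr_gt0.
rewrite (_ : 2 * pi * c0 * _ * _ = c0 * expR (- (b1 * tau)) * (b2 - b1) * (2 * pi)); last by ring.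
by rewrite ler_pM2r ?mulr_gt0// (le_trans low)// ler_norm.
Qed.

End Uniqueness.

(** * From the scalar statement to the system *)

Lemma carg_Re_lt0 (R : realType) (z : R[i]) : pi / 2 < `|carg z| -> RE z < 0.
Proof.
pose x := RE z / nrm z.
have x1 : `|x| <= 1.
  rewrite /x; have [->|z0] := eqVneq z 0; first by rewrite mul0r normr0.
  have n0 : 0 < nrm z by rewrite nrm_gt0.
  by rewrite normrM normfV (gtr0_norm n0) ler_pdivrMr// mul1r normRe_le.
have xI : -1 <= x <= 1 by rewrite -ler_norml.
have -> : `|carg z| = acos x.
  by rewrite /carg -/x; case: ifP => _; rewrite ?normrN ger0_norm// acos_ge0.
move=> h; rewrite ltNge; apply/negP => z0.
have x0 : 0 <= x by rewrite divr_ge0 ?nrm_ge0.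
have p0 := pi_gt0 R.
move: h; rewrite -ltr_cos ?in_itv /=; first by rewrite acosK ?in_itv//= cos_pihalf ltNge x0.
- by apply/andP; split; lra.
- by rewrite acos_ge0 ?acos_lepi.
Qed.

Lemma solution_fourierE (R : realType) (n m : nat) (M : 'rV[R]_n -> 'M[R[i]]_m)
    (lam : 'rV[R]_n -> 'rV[R[i]]_m) (Phih : 'I_m -> 'rV[R]_n -> R[i])
    (B : 'rV[R]_m) (j : 'I_m) (t : R) (xi : 'rV[R]_n) :
  solution_fourier M lam Phih B j t xi =
  (Kmatrix M Phih xi *m \col_l RL_factor (lam xi 0 l) (B 0 l) t) j 0.
Proof. by rewrite mxE; apply: eq_bigr => l _; rewrite [RHS]mulrC; congr (_ * _); rewrite mxE. Qed.

Theorem theorem2p5 (R : realType) (n m : nat) (n_gt0 : (0 < n)%N)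
    (m_gt0 : (0 < m)%N) (G : set 'rV[R]_n) (openG : open G)
    (p : R) (p_ge1 : 1 <= p)
    (A M : 'rV[R]_n -> 'M[R[i]]_m) (lam : 'rV[R]_n -> 'rV[R[i]]_m)
    (symbA : matrix_symbol G A M lam)
    (Phi Phih : 'I_m -> 'rV[R]_n -> R[i])
    (PsiPhi : forall j : 'I_m, in_Psi G p (Phi j) (Phih j))
    (beta0 : R) (beta0_gt0 : 0 < beta0) (beta0_lt1 : beta0 < 1)
    (xi0 : 'rV[R]_n) (Gxi0 : G xi0)
    (detK : \det (Kmatrix M Phih xi0) != 0)
    (lamReIm : forall l : 'I_m,
      `|complex.Re (lam xi0 0 l)| != `|complex.Im (lam xi0 0 l)|) :
  exists T1 : R, 1 < T1 /\
    forall t0 : R, T1 < t0 ->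
    forall d : 'cV[R[i]]_m,
      (forall l : 'I_m,
         R_RL (lam xi0 0 l) beta0 t0
           ((invmx (Kmatrix M Phih xi0) *m d) l 0)) ->
      exists! B : 'rV[R]_m,
        (forall l : 'I_m, beta0 <= B 0 l <= 1) /\
        (forall j : 'I_m, solution_fourier M lam Phih B j t0 xi0 = d j 0).
Proof.
have /choice[T hT] : forall l, exists T, 1 < T /\ forall t b1 b2, T < t ->
    beta0 <= b1 <= 1 -> beta0 <= b2 <= 1 ->
    RL_factor (lam xi0 0 l) b1 t = RL_factor (lam xi0 0 l) b2 t -> b1 = b2.
  move=> l; have lam0 := carg_Re_lt0 (symbol_arg symbA l Gxi0).
  by have [T T1 h] := RL_inj lam0 beta0_gt0; exists T.
have T0 l : 0 <= T l by have [/ltW/(le_trans ler01)] := hT l.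
(* The thresholds are nonnegative, so their sum dominates each of them, and the 2 keeps the total
   above 1. *)
exists (2 + \sum_l T l); split.
  by apply: ltr_wpDr; [exact: sumr_ge0|lra].
move=> t0 Tt0 d hd.
have Tl l : T l < t0.
  apply: le_lt_trans Tt0; rewrite (bigD1 l)//= addrCA lerDl.
  by rewrite addr_ge0// sumr_ge0.
have K_unit : Kmatrix M Phih xi0 \in unitmx by rewrite unitmxE unitfE.
have /choice[b hb] : forall l, exists b, beta0 <= b <= 1 /\
    RL_factor (lam xi0 0 l) b t0 = (invmx (Kmatrix M Phih xi0) *m d) l 0.
  move=> l; have [b] := hd l; rewrite /= in_itv /= => /andP[b0 /ltW b1] e.
  by exists b; rewrite b0 b1.
(* Existence takes the orders in [beta0, 1[ supplied by the data; uniqueness is tested against all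
   of [beta0, 1], where injectivity holds up to the end b = 1. *)
exists (\row_l b l); split.
  split; first by move=> l; rewrite mxE; have [] := hb l.
  move=> j; rewrite solution_fourierE.
  rewrite (_ : \col_l _ = invmx (Kmatrix M Phih xi0) *m d) ?mulKVmx//.
  by apply/colP => l; rewrite mxE mxE; have [_ ->] := hb l.
move=> B [hB1 hB2]; apply/rowP => l; rewrite mxE.
have [hb1 hb2] := hb l; have [_ inj] := hT l.
apply: (inj t0 _ _ (Tl l) hb1 (hB1 l)); rewrite hb2.
have -> : d = Kmatrix M Phih xi0 *m \col_l RL_factor (lam xi0 0 l) (B 0 l) t0.
  by apply/colP => j; rewrite -hB2; exact: solution_fourierE.
by rewrite mulKmx; [rewrite mxE|exact: K_unit].
Qed.
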